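(* Let $(M^4,g)$ be an oriented 4-dimensional Riemannian manifold and let $\mathcal Q$ be the quaternionic structure corresponding to the oriented conformal class generated by $g$, with local admissible bases $(J_1,J_2,J_3)$. The following conditions are equivalent: (i) the metric $g$ is anti-self-dual; (ii) the Ricci forms $\rho^g_a$ of the Levi-Civita connection $\nabla^g$ satisfy, for every local admissible basis $(J_1,J_2,J_3)$ of $\mathcal Q$, every cyclic permutation $(a,b,c)$ of $(1,2,3)$ and all vector fields $X,Y$, $$\rho^g_a(J_cX,J_cY)-\rho^g_a(X,Y)+\rho^g_b(J_cX,Y)+\rho^g_b(X,J_cY)=0;$$ (iii) for every quaternionic connection $\nabla$ on $(M,\mathcal Q)$, the torsion condition $$(T^\nabla)^{0,2}_J=0\quad\text{for all } J\in\mathcal Q \text{ with } J^2=-\mathrm{id}$$ implies the curvature condition $$\rho^\nabla_a(J_cX,J_cY)-\rho^\nabla_a(X,Y)+\rho^\nabla_b(J_cX,Y)+\rho^\nabla_b(X,J_cY)=0$$ for every local admissible basis $(J_1,J_2,J_3)$ of $\mathcal Q$, every cyclic permutation $(a,b,c)$ of $(1,2,3)$ and all vector fields $X,Y$.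
   Context: An almost quaternionic structure on a $4n$-dimensional manifold $M$ ($n\ge 1$) is a rank-3 subbundle $\mathcal Q\subset \mathrm{End}(TM)$ which is locally spanned by triples $(J_1,J_2,J_3)$ of almost complex structures with $J_\alpha^2=-\mathrm{id}$ and $J_1J_2=-J_2J_1=J_3$; such a local triple is called an admissible basis of $\mathcal Q$. In dimension 4 an almost quaternionic structure is the same as an oriented conformal structure: given an oriented Riemannian 4-manifold $(M,g)$, $\mathcal Q$ is the bundle of $g$-skew-symmetric endomorphisms corresponding via $g$ to self-dual 2-forms; its admissible bases consist of $g$-orthogonal almost complex structures inducing the given orientation (so $(e,J_1e,J_2e,J_3e)$ is an oriented frame for $e\neq0$). The Levi-Civita connection $\nabla^g$ preserves $\mathcal Q$. The metric $g$ (equivalently its conformal class) is anti-self-dual if the self-dual part $W^+$ of its Weyl tensor, acting on self-dual 2-forms, vanishes. A quaternionic connection is a linear connection $\nabla$ on $TM$ preserving $\mathcal Q$, i.e. $\nabla_X\sigma\in\Gamma(\mathcal Q)$ for every vector field $X$ and every $\sigma\in\Gamma(\mathcal Q)$; $T^\nabla$ denotes its torsion and $R^\nabla$ its curvature. With respect to a local admissible basis, its Ricci 2-forms are $$\rho^\nabla_a(X,Y)=-\tfrac12\mathrm{Tr}\big(Z\mapsto J_aR^\nabla(X,Y)Z\big),\quad a=1,2,3,$$ and $\rho^g_a:=\rho^{\nabla^g}_a$. For a $TM$-valued 2-form $B$ and $J\in\mathcal Q$ with $J^2=-\mathrm{id}$, the $(0,2)_J$-part of $B$ is $$B^{0,2}_J(X,Y)=\tfrac14\big(B(JX,JY)-B(X,Y)-JB(JX,Y)-JB(X,JY)\big).$$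 *)

(* Defs.v *)
From mathcomp Require Import all_boot all_order all_algebra.
From mathcomp Require Import all_classical all_reals all_analysis.
Import Order.TTheory GRing.Theory Num.Theory.
Import numFieldNormedType.Exports.

Set Implicit Arguments.
Unset Strict Implicit.
Unset Printing Implicit Defensive.

Local Open Scope classical_set_scope.
Local Open Scope ring_scope.

(** * Smooth functions on open subsets of R^n *)

Definition partial (R : realType) (n : nat) (k : 'I_n) (f : 'cV[R]_n -> R) :
    'cV[R]_n -> R :=
  'D_(delta_mx k 0) f.

(* All iterated partial derivatives exist and are continuous at the points
   of A; this is C^oo on A when A is open. *)
Definition smooth_on (R : realType) (n : nat) (A : set 'cV[R]_n)
    (f : 'cV[R]_n -> R) : Prop :=
  forall (s : seq 'I_n) (x : 'cV[R]_n), A x ->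
    {for x, continuous (foldr (@partial R n) f s)} /\
    forall k : 'I_n, derivable (foldr (@partial R n) f s) x (delta_mx k 0).

(** * Smooth manifolds

   A manifold is a Hausdorff, second countable space with a (not necessarily
   maximal) smooth atlas.  [cinv i] is a two-sided inverse of [cmap i] between
   [cdom i] and its image; its values elsewhere are irrelevant. *)

Record manifold (R : realType) (n : nat) := Manifold {
  mspace :> topologicalType;
  chart : Type;
  cdom : chart -> set mspace;
  cmap : chart -> mspace -> 'cV[R]_n;
  cinv : chart -> 'cV[R]_n -> mspace;
  manifold_hausdorff : hausdorff_space mspace;
  manifold_second_countable : @second_countable mspace;
  cdom_open : forall i, open (cdom i);
  cdom_cover : forall p, exists i, cdom i p;
  cimage_open : forall i, open (cmap i @` cdom i);
  cmap_continuous : forall i p, cdom i p -> {for p, continuous (cmap i)};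
  cinv_continuous : forall i p, cdom i p ->
    {for cmap i p, continuous (cinv i)};
  cmapK : forall i p, cdom i p -> cinv i (cmap i p) = p;
  transition_smooth : forall i j (l : 'I_n),
    smooth_on (cmap i @` (cdom i `&` cdom j))
      (fun x => cmap j (cinv i x) l 0) }.

Definition smooth_in_chart (R : realType) (n : nat) (M : manifold R n)
    (i : chart M) (U : set M) (f : M -> R) : Prop :=
  smooth_on (cmap i @` (U `&` cdom i)) (f \o cinv i).

Definition smooth_mx_in_chart (R : realType) (n m1 m2 : nat)
    (M : manifold R n) (i : chart M) (U : set M) (F : M -> 'M[R]_(m1, m2)) :
    Prop :=
  forall a b, smooth_in_chart i U (fun q => F q a b).

Definition dcoord (R : realType) (n : nat) (M : manifold R n) (i : chart M)
    (k : 'I_n) (f : M -> R) (p : M) : R :=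
  partial k (f \o cinv i) (cmap i p).

Definition dcoord_mx (R : realType) (n m1 m2 : nat) (M : manifold R n)
    (i : chart M) (k : 'I_n) (F : M -> 'M[R]_(m1, m2)) (p : M) :
    'M[R]_(m1, m2) :=
  \matrix_(a, b) dcoord i k (fun q => F q a b) p.

(* Jacobian at p of the transition map from chart i to chart j. *)
Definition jac (R : realType) (n : nat) (M : manifold R n) (i j : chart M)
    (p : M) : 'M[R]_n :=
  \matrix_(l, k) dcoord i k (fun q => cmap j q l 0) p.

(* The orientation is the one for which all charts are positively oriented. *)
Definition oriented_atlas (R : realType) (n : nat) (M : manifold R n) : Prop :=
  forall (i j : chart M) (p : M), cdom i p -> cdom j p -> 0 < \det (jac i j p).

(** * Tensor fields in components

   A tangent vector at p is the column of its components in a chart around p;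
   a tensor field is the family of its component functions in all the charts,
   related on the overlaps by the usual transformation law. *)

Record metric (R : realType) (n : nat) (M : manifold R n) := Metric {
  gcomp :> chart M -> M -> 'M[R]_n;
  metric_smooth : forall i, smooth_mx_in_chart i setT (gcomp i);
  metric_sym : forall i p, cdom i p -> (gcomp i p)^T = gcomp i p;
  metric_pos : forall i p (x : 'cV[R]_n), cdom i p -> x != 0 ->
    0 < (x^T *m gcomp i p *m x) 0 0;
  metric_change : forall i j p, cdom i p -> cdom j p ->
    gcomp i p = (jac i j p)^T *m gcomp j p *m jac i j p }.

(* Smooth sections of End(TM) over U. *)
Definition endo_section (R : realType) (n : nat) (M : manifold R n)
    (U : set M) (S : chart M -> M -> 'M[R]_n) : Prop :=
  (forall i, smooth_mx_in_chart i U (S i)) /\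
  (forall i j p, U p -> cdom i p -> cdom j p ->
     jac i j p *m S i p = S j p *m jac i j p).

(** * Linear connections

   [gamma i p k] is the matrix of Christoffel symbols whose (l, m) entry is
   the l-th component of nabla_{d_k} d_m in chart i.  The transformation law
   says that the covariant derivative does not depend on the chart. *)

Record connection (R : realType) (n : nat) (M : manifold R n) := Connection {
  gamma :> chart M -> M -> 'I_n -> 'M[R]_n;
  connection_smooth : forall i k,
    smooth_mx_in_chart i setT (fun p => gamma i p k);
  connection_change : forall i j p k, cdom i p -> cdom j p ->
    jac i j p *m gamma i p k =
      (\sum_l jac i j p l k *: gamma j p l) *m jac i j p
      + dcoord_mx i k (jac i j) p }.

(* nabla_X Y, for vector fields given by their components in chart i. *)
Definition cov (R : realType) (n : nat) (M : manifold R n)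
    (D : connection M) (i : chart M) (X Y : M -> 'cV[R]_n) : M -> 'cV[R]_n :=
  fun p => \sum_k X p k 0 *: (dcoord_mx i k Y p + D i p k *m Y p).

Definition bracket (R : realType) (n : nat) (M : manifold R n)
    (i : chart M) (X Y : M -> 'cV[R]_n) : M -> 'cV[R]_n :=
  fun p => \sum_k (X p k 0 *: dcoord_mx i k Y p - Y p k 0 *: dcoord_mx i k X p).

Definition torsion_field (R : realType) (n : nat) (M : manifold R n)
    (D : connection M) (i : chart M) (X Y : M -> 'cV[R]_n) : M -> 'cV[R]_n :=
  fun p => cov D i X Y p - cov D i Y X p - bracket i X Y p.

Definition curvature_field (R : realType) (n : nat) (M : manifold R n)
    (D : connection M) (i : chart M) (X Y Z : M -> 'cV[R]_n) :
    M -> 'cV[R]_n :=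
  fun p => cov D i X (cov D i Y Z) p - cov D i Y (cov D i X Z) p
           - cov D i (bracket i X Y) Z p.

(* By tensoriality, the values of torsion and curvature on tangent vectors can
   be computed on the extensions with constant components. *)
Definition torsion (R : realType) (n : nat) (M : manifold R n)
    (D : connection M) (i : chart M) (p : M) (x y : 'cV[R]_n) : 'cV[R]_n :=
  torsion_field D i (fun=> x) (fun=> y) p.

(* The matrix of the endomorphism R(x, y). *)
Definition curvature (R : realType) (n : nat) (M : manifold R n)
    (D : connection M) (i : chart M) (p : M) (x y : 'cV[R]_n) : 'M[R]_n :=
  \matrix_(l, m)
    curvature_field D i (fun=> x) (fun=> y) (fun=> delta_mx m 0) p l 0.

(* nabla_x S for a section S of End(TM) and a tangent vector x at p. *)
Definition cov_endo (R : realType) (n : nat) (M : manifold R n)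
    (D : connection M) (i : chart M) (S : chart M -> M -> 'M[R]_n) (p : M)
    (x : 'cV[R]_n) : 'M[R]_n :=
  \sum_k x k 0 *: (dcoord_mx i k (S i) p + D i p k *m S i p - S i p *m D i p k).

(* Torsion-free, and nabla g = 0. *)
Definition levi_civita (R : realType) (n : nat) (M : manifold R n)
    (g : metric M) (D : connection M) : Prop :=
  forall i p, cdom i p ->
    (forall x y, torsion D i p x y = 0) /\
    (forall k, dcoord_mx i k (g i) p - (D i p k)^T *m g i p
                 - g i p *m D i p k = 0).

(** * Two-forms and self-duality in dimension 4

   A 2-form at p is the skew matrix W with W a b = omega(e_a, e_b). *)

Definition epsilon4 (R : realType) (a b c d : 'I_4) : R :=
  \det (\matrix_(r < 4, s < 4) (tnth [tuple a; b; c; d] r == s)%:R).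

(* Hodge star of the metric with Gram matrix G in a positively oriented frame:
   ( * omega)_ab = 1/2 sqrt(det G) eps_abcd omega^cd. *)
Definition hodge (R : realType) (G W : 'M[R]_4) : 'M[R]_4 :=
  \matrix_(a, b) (2^-1 * Num.sqrt (\det G) *
    \sum_c \sum_d epsilon4 R a b c d * (invmx G *m W *m invmx G) c d).

Definition self_dual (R : realType) (G W : 'M[R]_4) : Prop :=
  W^T = - W /\ hodge G W = W.

Definition riemann (R : realType) (M : manifold R 4) (g : metric M)
    (D : connection M) (i : chart M) (p : M) (a b c d : 'I_4) : R :=
  (g i p *m curvature D i p (delta_mx a 0) (delta_mx b 0)) d c.

Definition ricci (R : realType) (M : manifold R 4) (D : connection M)
    (i : chart M) (p : M) (b c : 'I_4) : R :=
  \sum_a curvature D i p (delta_mx a 0) (delta_mx b 0) a c.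

Definition scalar_curvature (R : realType) (M : manifold R 4) (g : metric M)
    (D : connection M) (i : chart M) (p : M) : R :=
  \sum_b \sum_c invmx (g i p) b c * ricci D i p b c.

(* W_abcd, with the convention riemann a b c d = g(R(e_a, e_b) e_c, e_d); D is
   meant to be the Levi-Civita connection of g.  The coefficients are
   1/(n-2) and 1/((n-1)(n-2)) for n = 4. *)
Definition weyl (R : realType) (M : manifold R 4) (g : metric M)
    (D : connection M) (i : chart M) (p : M) (a b c d : 'I_4) : R :=
  let G := g i p in
  let Ric := ricci D i p in
  riemann g D i p a b c d
  - 2^-1 * (G a d * Ric b c + G b c * Ric a d - G a c * Ric b d - G b d * Ric a c)
  + 6^-1 * scalar_curvature g D i p * (G a d * G b c - G a c * G b d).

Definition weyl_op (R : realType) (M : manifold R 4) (g : metric M)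
    (D : connection M) (i : chart M) (p : M) (W : 'M[R]_4) : 'M[R]_4 :=
  \matrix_(a, b) (2^-1 * \sum_c \sum_d
    weyl g D i p a b c d * (invmx (g i p) *m W *m invmx (g i p)) c d).

(* W^+ is the self-dual part of the Weyl operator on self-dual 2-forms. *)
Definition anti_self_dual (R : realType) (M : manifold R 4) (g : metric M)
    (D : connection M) : Prop :=
  forall i p (W : 'M[R]_4), cdom i p -> self_dual (g i p) W ->
    2^-1 *: (weyl_op g D i p W + hodge (g i p) (weyl_op g D i p W)) = 0.

(** * The quaternionic structure of an oriented Riemannian 4-manifold *)

(* A belongs to Q_p iff it is g-skew and (x, y) |-> g(A x, y), whose matrix is
   A^T G, is self-dual. *)
Definition quat_structure (R : realType) (M : manifold R 4) (g : metric M)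
    (i : chart M) (p : M) (A : 'M[R]_4) : Prop :=
  self_dual (g i p) (A^T *m g i p).

(* Triples are indexed by Z/3, so that (a, a + 1, a + 2) runs over the cyclic
   permutations and (J_1, J_2, J_3) is (J 0, J 1, J 2). *)
Definition admissible_basis (R : realType) (M : manifold R 4) (g : metric M)
    (U : set M) (J : 'I_3 -> chart M -> M -> 'M[R]_4) : Prop :=
  (forall a, endo_section U (J a)) /\
  forall i p, U p -> cdom i p ->
    [/\ forall a, J a i p *m J a i p = - 1%:M,
        J 0 i p *m J 1 i p = J 2%:R i p,
        J 1 i p *m J 0 i p = - J 2%:R i p
      & forall A, quat_structure g i p A <->
          exists c : 'I_3 -> R, A = \sum_a c a *: J a i p].

Definition quaternionic_connection (R : realType) (M : manifold R 4)
    (g : metric M) (D : connection M) : Prop :=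
  forall (U : set M) (S : chart M -> M -> 'M[R]_4),
    open U -> endo_section U S ->
    (forall i p, U p -> cdom i p -> quat_structure g i p (S i p)) ->
    forall i p x, U p -> cdom i p -> quat_structure g i p (cov_endo D i S p x).

(* The (0,2)_J-part of a vector-valued 2-form at a point. *)
Definition part02 (R : realType) (n : nat) (J : 'M[R]_n)
    (B : 'cV[R]_n -> 'cV[R]_n -> 'cV[R]_n) (x y : 'cV[R]_n) : 'cV[R]_n :=
  4^-1 *: (B (J *m x) (J *m y) - B x y
           - J *m B (J *m x) y - J *m B x (J *m y)).

Definition torsion_condition (R : realType) (M : manifold R 4)
    (g : metric M) (D : connection M) : Prop :=
  forall i p (J : 'M[R]_4), cdom i p -> quat_structure g i p J ->
    J *m J = - 1%:M ->
    forall x y, part02 J (torsion D i p) x y = 0.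

(* The Ricci 2-form rho_a at p, for J the value at p of J_a. *)
Definition ricci_form (R : realType) (M : manifold R 4) (D : connection M)
    (i : chart M) (p : M) (J : 'M[R]_4) (x y : 'cV[R]_4) : R :=
  - 2^-1 * \tr (J *m curvature D i p x y).

Definition curvature_condition (R : realType) (M : manifold R 4)
    (g : metric M) (D : connection M) : Prop :=
  forall (U : set M) (J : 'I_3 -> chart M -> M -> 'M[R]_4),
    open U -> admissible_basis g U J ->
    forall i p, U p -> cdom i p ->
    forall (a : 'I_3) (x y : 'cV[R]_4),
      let rho_a := ricci_form D i p (J a i p) in
      let rho_b := ricci_form D i p (J (a + 1) i p) in
      let Jc := J (a + 2%:R) i p in
      rho_a (Jc *m x) (Jc *m y) - rho_a x y
      + rho_b (Jc *m x) y + rho_b x (Jc *m y) = 0.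

(* Main.v *)
Require Import Defs.
From HB Require Import structures.
From mathcomp Require Import all_boot all_order all_algebra.
From mathcomp Require Import all_classical all_reals all_analysis.
From mathcomp Require Import ring lra.
Import Order.TTheory GRing.Theory Num.Theory.

Set Implicit Arguments.
Unset Strict Implicit.
Unset Printing Implicit Defensive.

Local Open Scope ring_scope.

(** Choose a frame at a point in which the metric is Euclidean and J_1, J_2, J_3
    are the left multiplications by i, j, k on the quaternions
    ([adapted_frame]). The self-dual 2-forms are then the span of these three
    matrices, and every other skew matrix is, modulo this span, one that
    commutes with them.

    For a Levi-Civita connection, anti-self-duality is equivalent to the
    curvature condition. Let P_e be the matrix of the Ricci form rho_e, and m_fe
    = tr (J_f P_e). The left-hand side of the curvature condition is made of
    commutators with J_c, so it only sees the components of P_a and P_b on J_a,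
    J_b: as a matrix it is half of (m_aa - m_bb) J_a + (m_ba + m_ab) J_b
    ([quat_bianchi_std]). For a curvature tensor with the symmetries of a
    Riemannian one, m is symmetric and its trace is, up to sign, the scalar
    curvature; and W^+ is m minus its pure trace part, because the Ricci tensor
    enters it only through the anticommutators of the J_e, which are scalars. So
    both conditions say that m is a multiple of the identity
    ([quat_bianchi_asd]). To use the curvature condition at a given point one
    needs an admissible basis around it: the self-dual parts of dx_0 ^ dx_1 and
    dx_0 ^ dx_2 are linearly independent, since a decomposable nonzero form is
    never anti-self-dual, and Gram-Schmidt does the rest
    ([local_admissible_basis]).

    The Levi-Civita connection is one of the quaternionic connections without
    (0,2)-torsion, because it preserves the quaternionic structure
    ([lc_quaternionic]) and has no torsion.

    Conversely, the curvature condition passes from the Levi-Civita connection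
    to every quaternionic connection without (0,2)-torsion. Let A be the
    difference of a quaternionic connection and of the Levi-Civita connection.
    Each A_x normalizes the quaternionic structure, so that, up to an
    endomorphism commuting with it, A_x is the sum of the alpha_a(x) J_a for
    three 1-forms alpha_a. The torsion condition says that alpha_b(x) =
    alpha_c(J_a x) for all cyclic (a, b, c) ([torsion_alpha]), that is,
    alpha_a(x) = theta(J_a x) for a single 1-form theta ([alpha_row_theta]).
    Inserting this in R + d^nabla A + [A, A] gives, with S the covariant
    derivative of theta,
      rho_a(x, y) = rho^g_a(x, y) + 2 (S_x(J_a y) - S_y(J_a x))
        + 4 (theta(J_b x) theta(J_c y) - theta(J_c x) theta(J_b y))
    ([ricci_form_change]). Whatever S and theta are, the added terms contribute
    zero to the curvature condition ([condition_change_invariant]). So the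
    condition for the given connection is the one for the Levi-Civita
    connection. *)

(** * Matrices of order four and the Euclidean Hodge star *)

Local Notation o0 := (@Ordinal 4 0 isT).
Local Notation o1 := (@Ordinal 4 1 isT).
Local Notation o2 := (@Ordinal 4 2 isT).
Local Notation o3 := (@Ordinal 4 3 isT).

Lemma ord4P (P : 'I_4 -> Prop) : P o0 -> P o1 -> P o2 -> P o3 -> forall i, P i.
Proof.
move=> P0 P1 P2 P3 [[|[|[|[|m]]]] lti] //.
- by have -> : Ordinal lti = o0 by exact: val_inj.
- by have -> : Ordinal lti = o1 by exact: val_inj.
- by have -> : Ordinal lti = o2 by exact: val_inj.
- by have -> : Ordinal lti = o3 by exact: val_inj.
Qed.

Lemma sum4 (R : nmodType) (F : 'I_4 -> R) :
  \sum_i F i = F o0 + F o1 + F o2 + F o3.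
Proof.
rewrite !big_ord_recl big_ord0 addr0 !addrA.
by congr (_ + _ + _ + _); congr F; exact: val_inj.
Qed.

Lemma mxtraceB (R : pzRingType) n (A B : 'M[R]_n) : \tr (A - B) = \tr A - \tr B.
Proof. exact: raddfB. Qed.

Section Explicit.
Variable (R : comNzRingType).

Definition mx4 (l : seq (seq R)) : 'M[R]_4 := \matrix_(i, j) nth 0 (nth [::] l i) j.

Lemma mx4E l i j : mx4 l i j = nth 0 (nth [::] l i) j.
Proof. exact: mxE. Qed.

Lemma mulmx4 m1 m2 (A : 'M[R]_(m1, 4)) (B : 'M[R]_(4, m2)) i j : (A *m B) i j =
  A i o0 * B o0 j + A i o1 * B o1 j + A i o2 * B o2 j + A i o3 * B o3 j.
Proof. by rewrite mxE sum4. Qed.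

Definition minor_fun (b : nat -> nat -> R) (j i k : nat) := b i.+1 (bump j k).

(** For matrices given by a function of two natural numbers the minors are
    again of this form, so that the expansion can be iterated by mere
    computation. *)
Lemma det_fun_rec n (b : nat -> nat -> R) :
  \det (\matrix_(i < n.+1, j < n.+1) b i j) = \sum_(j < n.+1)
    (-1) ^+ j * b 0 j * \det (\matrix_(i < n, k < n) minor_fun b j i k).
Proof.
rewrite (expand_det_row _ ord0); apply: eq_bigr => j _.
rewrite mxE /cofactor add0n mulrA (mulrC (b _ _)); congr (_ * \det _).
by apply/matrixP => i k; rewrite !mxE lift0.
Qed.

Lemma det3_fun (b : nat -> nat -> R) :
  \det (\matrix_(i < 3, j < 3) b i j) =
  b 0 0 * (b 1 1 * b 2 2 - b 1 2 * b 2 1)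
  - b 0 1 * (b 1 0 * b 2 2 - b 1 2 * b 2 0)
  + b 0 2 * (b 1 0 * b 2 1 - b 1 1 * b 2 0).
Proof.
rewrite det_fun_rec !big_ord_recl big_ord0 !det_fun_rec !big_ord_recl !big_ord0.
by rewrite !det_mx11 !mxE /= /minor_fun /bump /= ; ring.
Qed.

Lemma det4 (A : 'M[R]_4) : \det A =
  let a i j := A i j in
  let d3 x y z := a o1 x * (a o2 y * a o3 z - a o2 z * a o3 y)
    - a o1 y * (a o2 x * a o3 z - a o2 z * a o3 x)
    + a o1 z * (a o2 x * a o3 y - a o2 y * a o3 x) in
  a o0 o0 * d3 o1 o2 o3 - a o0 o1 * d3 o0 o2 o3 + a o0 o2 * d3 o0 o1 o3
  - a o0 o3 * d3 o0 o1 o2.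
Proof.
move=> /=; pose b (i j : nat) := A (inord i) (inord j).
have AE : A = \matrix_(i, j) b i j.
  by apply/matrixP => i j; rewrite mxE /b !inord_val.
rewrite [in LHS]AE det_fun_rec sum4 !det3_fun /= /minor_fun /bump /=.
have bE (i j : 'I_4) : b i j = A i j by rewrite /b !inord_val.
rewrite -!bE /=; ring.
Qed.

(** Twice the Euclidean Hodge dual of the skew part of the matrix; without the
    factor one half it makes sense over every ring. *)
Definition star (M : 'M[R]_4) : 'M[R]_4 :=
  let m a b := M a b - M b a in
  mx4 [:: [:: 0; m o2 o3; m o3 o1; m o1 o2];
          [:: m o3 o2; 0; m o0 o3; m o2 o0];
          [:: m o1 o3; m o3 o0; 0; m o0 o1];
          [:: m o2 o1; m o0 o2; m o1 o0; 0]].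

(** Left multiplication by the imaginary quaternion ai + bj + ck, in the basis
    (1, i, j, k). *)
Definition lmul (a b c : R) : 'M[R]_4 :=
  mx4 [:: [:: 0; - a; - b; - c];
          [:: a; 0; - c; b];
          [:: b; c; 0; - a];
          [:: c; - b; a; 0]].

Fact star_is_linear : linear star.
Proof.
move=> c A B; apply/matrixP; apply: ord4P; apply: ord4P.
all: by rewrite !mxE /= ?mxE; ring.
Qed.
HB.instance Definition _ := GRing.isLinear.Build R _ _ _ star star_is_linear.

Definition cols4 (a b x y : 'cV[R]_4) : 'M[R]_4 :=
  \matrix_(i, j) (nth 0 [:: a; b; x; y] j) i 0.

Lemma mulmx_cols4 (F : 'M[R]_4) a b x y :
  F *m cols4 a b x y = cols4 (F *m a) (F *m b) (F *m x) (F *m y).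
Proof.
by apply/matrixP => i; apply: ord4P; rewrite !mxE /=; apply: eq_bigr => k _;
   rewrite !mxE.
Qed.

(** The pairing is a volume, and a linear map F multiplies volumes by its
    determinant: this is the source of the covariance of the Hodge star. *)
Lemma star_rank1 (a b x y : 'cV[R]_4) :
  a^T *m star (x *m y^T) *m b = (\det (cols4 a b x y))%:M.
Proof.
apply/matrixP => i j; rewrite !ord1 {i j} [RHS]mxE eqxx mulr1n det4 /=.
rewrite !mulmx4 /star !mx4E /= !mxE !big_ord1 !mxE /=.
ring.
Qed.

(** By linearity it suffices to compare both sides on matrices of rank one. *)
Lemma star_cov (F M : 'M[R]_4) :
  F^T *m star (F *m M *m F^T) *m F = \det F *: star M.
Proof.
pose P M := F^T *m star (F *m M *m F^T) *m F = \det F *: star M.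
rewrite -/(P M) [M]matrix_sum_delta.
have P0 : P 0 by rewrite /P mulmx0 mul0mx linear0 mulmx0 mul0mx scaler0.
have PD A B : P A -> P B -> P (A + B).
  rewrite /P => PA PB; rewrite mulmxDr mulmxDl linearD /= mulmxDr mulmxDl PA PB.
  by rewrite linearD /= scalerDr.
apply: big_ind => // k _; apply: big_ind => // l _; rewrite /P.
rewrite -scalemxAr -scalemxAl ![star (_ *: _)]linearZ /= -scalemxAr -scalemxAl.
rewrite scalerA.
rewrite (mulrC (\det F)) -scalerA; congr (_ *: _).
pose e i : 'cV[R]_4 := delta_mx i 0.
have -> : delta_mx k l = e k *m (e l)^T by rewrite trmx_delta mul_delta_mx.
apply/matrixP => i j; rewrite [RHS]mxE.
have E (A : 'M[R]_4) : A i j = ((e i)^T *m A *m e j) 0 0.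
  by rewrite trmx_delta -rowE -colE !mxE.
rewrite [LHS]E [in RHS]E star_rank1.
have -> : F *m (e k *m (e l)^T) *m F^T = (F *m e k) *m (F *m e l)^T.
  by rewrite trmx_mul !mulmxA.
have shuffle (u v : 'cV[R]_4) S :
    u^T *m (F^T *m S *m F) *m v = (F *m u)^T *m S *m (F *m v).
  by rewrite trmx_mul !mulmxA.
by rewrite shuffle star_rank1 -mulmx_cols4 det_mulmx !mxE eqxx !mulr1n.
Qed.

End Explicit.

(** * Orthonormal frames and self-dual forms *)

Definition pos_def (R : realType) n (G : 'M[R]_n) :=
  G^T = G /\ forall x : 'cV[R]_n, x != 0 -> 0 < (x^T *m G *m x) 0 0.

(** Cholesky's recursion: normalize the first basis vector, and apply the
    induction hypothesis to the Schur complement [S] of the corner entry. *)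
Lemma orthonormal_frame (R : realType) n (G : 'M[R]_n) : pos_def G ->
  exists2 F : 'M[R]_n, F^T *m G *m F = 1%:M & 0 < \det F.
Proof.
elim: n G => [|n IH] G [Gs Gp].
  by exists 1%:M; [apply/matrixP => -[] | rewrite det1].
pose a := G 0 0; pose b : 'cV[R]_n := \col_i G (lift 0 i) 0.
pose C : 'M[R]_n := \matrix_(i, j) G (lift 0 i) (lift 0 j).
have GE : G = block_mx a%:M b^T b C :> 'M[R]_(1 + n).
  apply/matrixP => i j; rewrite -[G]/(G : 'M[R]_(1 + n)).
  case: (split_ordP i) => i' ->; case: (split_ordP j) => j' ->;
    rewrite ?(block_mxEul, block_mxEur, block_mxEdl, block_mxEdr) !mxE.
  - by rewrite !ord1 eqxx mulr1n; congr (G _ _); apply: val_inj.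
  - rewrite -[in LHS]Gs mxE; congr (G _ _); apply: val_inj => //.
    by rewrite /= ord1.
  - by congr (G _ _); apply: val_inj => //; rewrite /= ord1.
  - by congr (G _ _); apply: val_inj.
have Cs : C^T = C by apply/matrixP => i j; rewrite !mxE -[in RHS]Gs mxE.
have a0 : 0 < a.
  have /Gp : (delta_mx 0 0 : 'cV[R]_n.+1) != 0.
    by apply/eqP => /matrixP/(_ 0 0); rewrite !mxE/= => /eqP; rewrite oner_eq0.
  by rewrite trmx_delta -rowE -colE !mxE.
pose S := C - a^-1 *: (b *m b^T).
have Gp' (y : 'cV[R]_(1 + n)) : y != 0 ->
    0 < (y^T *m block_mx a%:M b^T b C *m y) 0 0 by rewrite -GE; exact: Gp.
have [F' F'1 F'0] : exists2 F : 'M[R]_n, F^T *m S *m F = 1%:M & 0 < \det F.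
  apply: IH; split.
    by rewrite /S linearB /= Cs linearZ /= trmx_mul trmxK.
  move=> x x0; pose t := b^T *m x.
  (* The Schur complement at x is the form G at the vector of the affine
      subspace over x that is G-orthogonal to the first basis vector. *)
  have /Gp' : col_mx (- a^-1 *: t) x != 0.
    apply: contra_neq x0 => y0.
    by rewrite -[x](col_mxKd (- a^-1 *: t)) y0 linear0.
  rewrite tr_col_mx mul_row_block mul_row_col !linearZ /=.
  have -> : a%:M = a *: 1%:M :> 'M[R]_1 by rewrite scalemx1.
  rewrite !(mulmxDl, mulmxDr) -!(scalemxAl, scalemxAr) mulmx1 !scalerA.
  rewrite -[_ *m b^T *m x]mulmxA -/t /S.
  rewrite mulmxN mulNmx -scalemxAr -scalemxAl -!mulmxA -/t.
  have -> : x^T *m (b *m t) = t^T *m t by rewrite mulmxA /t trmx_mul trmxK.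
  move: (t^T *m t) (x^T *m (C *m x)) => u v; rewrite !mxE.
  suff -> : - a^-1 * (- a^-1 * a * u 0 0 + u 0 0)
    + (- a^-1 * u 0 0 + v 0 0) = v 0 0 - a^-1 * u 0 0 by [].
  by field; rewrite lt0r_neq0.
pose r := Num.sqrt a; have r0 : 0 < r by rewrite sqrtr_gt0.
have ra : a = r * r by rewrite -expr2 sqr_sqrtr// ltW.
pose F : 'M[R]_(1 + n) :=
  block_mx (r^-1)%:M (- a^-1 *: (b^T *m F')) 0 F'.
have F0 : 0 < \det F by rewrite det_ublock det_scalar1 mulr_gt0 ?invr_gt0.
exists F => //.
suff : F^T *m block_mx a%:M b^T b C *m F = 1%:M by rewrite -GE.
have -> : F^T *m block_mx a%:M b^T b C *m F = F^T *m
    block_mx r%:M 0 (r^-1 *: b) (S *m F').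
  rewrite -mulmxA; congr (_ *m _); rewrite mulmx_block !mulmx0 !addr0.
  rewrite -scalar_mxM mul_mx_scalar mul_scalar_mx scalerA mulrN divff ?lt0r_neq0//.
  have -> : b *m (- a^-1 *: (b^T *m F')) + C *m F' = S *m F'.
    have -> : b *m (- a^-1 *: (b^T *m F')) = - a^-1 *: (b *m (b^T *m F')).
      by rewrite linearZ.
    by rewrite /S mulmxDl mulNmx -scalemxAl scaleNr addrC mulmxA.
  by rewrite scaleN1r addNr {1}ra mulfK// lt0r_neq0.
rewrite tr_block_mx mulmx_block !tr_scalar_mx trmx0 !mulmx0 !mul0mx !add0r !addr0.
rewrite mulmxA F'1 -scalar_mxM mulVf ?lt0r_neq0// mul_mx_scalar !linearZ /=.
rewrite trmx_mul trmxK scalerA -scalerDl.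
have -> : - a^-1 * r + r^-1 = 0 by rewrite ra; field; rewrite lt0r_neq0.
by rewrite scale0r -scalar_mx_block.
Qed.

Section Frames.
Variable (R : realType).
Implicit Types (G W F : 'M[R]_4).

(** This identifies the Hodge operator given by the Levi-Civita symbol with
    [star]. *)
Lemma epsilon4_star (a b c d : 'I_4) :
  epsilon4 R a b c d = star (delta_mx c d) a b.
Proof.
pose e i : 'cV[R]_4 := delta_mx i 0.
have -> : delta_mx c d = e c *m (e d)^T by rewrite trmx_delta mul_delta_mx.
transitivity (((e a)^T *m star (e c *m (e d)^T) *m e b) 0 0); last first.
  by rewrite [in LHS]trmx_delta -rowE -colE !mxE.
rewrite star_rank1 mxE eqxx mulr1n /epsilon4 -det_tr; congr (\det _).
apply/matrixP => i; apply: ord4P; rewrite !mxE /= (tnth_nth a) /=.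
all: by rewrite eq_sym andbT.
Qed.

Lemma hodgeE G W :
  hodge G W = (2^-1 * Num.sqrt (\det G)) *: star (invmx G *m W *m invmx G).
Proof.
apply/matrixP => a b; rewrite [LHS]mxE [RHS]mxE; congr (_ * _).
move: (invmx G *m W *m invmx G) => M.
rewrite [in RHS](matrix_sum_delta M) linear_sum summxE.
apply: eq_bigr => c _; rewrite linear_sum summxE.
by apply: eq_bigr => d _; rewrite linearZ /= [RHS]mxE epsilon4_star mulrC.
Qed.

Lemma invmx_mul n (A B : 'M[R]_n) : A \in unitmx -> B \in unitmx ->
  invmx (A *m B) = invmx B *m invmx A.
Proof.
move=> Au Bu; have ABu : A *m B \in unitmx by rewrite unitmx_mul Au.
by rewrite -[RHS](mulmxK ABu) mulmxA mulmxKV// mulVmx// mul1mx.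
Qed.

(** The volume factor of the metric is multiplied by the absolute value of the
    determinant of F, the Levi-Civita symbol by the determinant itself: the
    sign of the determinant matters. *)
Lemma hodge_cov F G W : G \in unitmx -> 0 < \det F ->
  hodge (F^T *m G *m F) (F^T *m W *m F) = F^T *m hodge G W *m F.
Proof.
move=> Gu F0; have Fu : F \in unitmx by rewrite unitmxE unitfE lt0r_neq0.
have FTu : F^T \in unitmx by rewrite unitmx_tr.
rewrite !hodgeE -scalemxAr -scalemxAl !det_mulmx det_tr.
have -> : \det F * \det G * \det F = \det F ^+ 2 * \det G by ring.
rewrite sqrtrM ?sqr_ge0// sqrtr_sqr gtr0_norm//.
set M := invmx G *m W *m invmx G.
set M' := _ *m (F^T *m W *m F) *m _.
have -> : M = F *m M' *m F^T.
  rewrite /M' !invmx_mul ?unitmx_mul ?FTu ?Gu ?Fu//.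
  by rewrite !mulmxA mulmxV// mul1mx mulmxKV// mulmxK// mulmxKV.
by rewrite star_cov scalerA; congr (_ *: _); ring.
Qed.

Lemma self_dual_cov F G W : G \in unitmx -> 0 < \det F ->
  self_dual (F^T *m G *m F) (F^T *m W *m F) <-> self_dual G W.
Proof.
move=> Gu F0; have Fu : F \in unitmx by rewrite unitmxE unitfE lt0r_neq0.
have FTu : F^T \in unitmx by rewrite unitmx_tr.
have inj A B : F^T *m A *m F = F^T *m B *m F <-> A = B.
  split=> [|->//] /(congr1 (fun X => invmx F^T *m X *m invmx F)).
  by rewrite !mulmxA mulVmx// !mul1mx !mulmxK.
rewrite /self_dual hodge_cov// inj -[X in _ <-> X /\ _]inj.
by rewrite !trmx_mul trmxK mulmxN mulNmx mulmxA.
Qed.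

(** The transpose comes from the convention that an endomorphism A stands for
    the 2-form with matrix A^T G. *)
Lemma self_dual1P W :
  self_dual 1%:M W <-> exists a b c, W = (lmul a b c)^T.
Proof.
rewrite /self_dual hodgeE det1 sqrtr1 mulr1 invmx1 mul1mx mulmx1; split.
  move=> [Ws Wd]; exists (W o0 o1), (W o0 o2), (W o0 o3).
  have s i j : W i j = - W j i by have /matrixP/(_ j i) := Ws; rewrite !mxE.
  have d i j : W i j = 2^-1 * star W i j by rewrite -[in LHS]Wd [LHS]mxE.
  have := d o2 o3; have := d o1 o3; have := d o1 o2.
  rewrite !mx4E /= => d12 d13 d23.
  have := s o0 o0; have := s o1 o1; have := s o2 o2; have := s o3 o3.
  have := s o1 o0; have := s o2 o0; have := s o3 o0; have := s o2 o1.
  have := s o3 o1; have := s o3 o2 => s1 s2 s3 s4 s5 s6 s7 s8 s9 s10.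
  by apply/matrixP; apply: ord4P; apply: ord4P; rewrite mxE mx4E /=; lra.
move=> [a [b [c ->]]]; rewrite /star /lmul; split.
  by apply/matrixP; apply: ord4P; apply: ord4P; rewrite !mxE /=; ring.
by apply/matrixP; apply: ord4P; apply: ord4P; rewrite mxE mx4E /= !mxE /=; field.
Qed.

End Frames.

(** * The fibre of the quaternionic structure *)

Section LeftMult.
Variable (R : comNzRingType).
Implicit Types (a b c x y z : R).

Lemma lmulM a b c x y z : lmul a b c *m lmul x y z =
  - (a * x + b * y + c * z)%:M
  + lmul (b * z - c * y) (c * x - a * z) (a * y - b * x).
Proof.
apply/matrixP; apply: ord4P; apply: ord4P.
all: by rewrite mulmx4 !mxE /=; ring.
Qed.

Lemma lmulD a b c x y z : lmul a b c + lmul x y z = lmul (a + x) (b + y) (c + z).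
Proof.
by apply/matrixP; apply: ord4P; apply: ord4P; rewrite !mxE /=; ring.
Qed.

Lemma lmulZ t a b c : t *: lmul a b c = lmul (t * a) (t * b) (t * c).
Proof.
by apply/matrixP; apply: ord4P; apply: ord4P; rewrite !mxE /=; ring.
Qed.

End LeftMult.

Lemma ord3P (P : 'I_3 -> Prop) : P 0 -> P 1 -> P 2%:R -> forall a, P a.
Proof.
move=> P0 P1 P2 [[|[|[|m]]] lti] //.
- by have -> : Ordinal lti = 0 by exact: val_inj.
- by have -> : Ordinal lti = 1 by exact: val_inj.
- by have -> : Ordinal lti = 2%:R by exact: val_inj.
Qed.

Lemma ord3_add : ((0 + 1 = 1 :> 'I_3)%R * (1 + 1 = 2%:R :> 'I_3)%R *
  (2%:R + 1 = 0 :> 'I_3)%R * (0 + 2%:R = 2%:R :> 'I_3)%R *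
  (1 + 2%:R = 0 :> 'I_3)%R * (2%:R + 2%:R = 1 :> 'I_3)%R)%type.
Proof. by do !split; exact: val_inj. Qed.

Lemma ord3_cases (a b : 'I_3) : [\/ b = a, b = a + 1 | b = a + 2%:R].
Proof.
elim/ord3P: a; elim/ord3P: b; rewrite !ord3_add;
  by [constructor 1 | constructor 2 | constructor 3].
Qed.

Section Quat.
Variable (R : realType).
Implicit Types (G A B J N F : 'M[R]_4).

Definition quaternionic_triple (J : 'I_3 -> 'M[R]_4) :=
  [/\ forall a, J a *m J a = - 1%:M, J 0 *m J 1 = J 2%:R
    & J 1 *m J 0 = - J 2%:R].

Lemma triple_mul (J : 'I_3 -> 'M[R]_4) a : quaternionic_triple J ->
  J a *m J (a + 1) = J (a + 2%:R) /\ J (a + 1) *m J a = - J (a + 2%:R).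
Proof.
move=> [sq J01 J10]; elim/ord3P: a; rewrite !ord3_add.
- by [].
- rewrite -{2}J01 -[X in J 1 *m X]opprK -J10 mulmxN mulmxA sq mulNmx mul1mx opprK.
  by rewrite -mulmxA sq mulmxN mulmx1.
- rewrite -{1}[J 2%:R]opprK -J10 mulNmx -mulmxA sq mulmxN mulmx1 opprK.
  by rewrite -J01 mulmxA sq mulNmx mul1mx.
Qed.

Lemma triple_table (J : 'I_3 -> 'M[R]_4) a : quaternionic_triple J ->
  [/\ J (a + 2%:R) *m J a = J (a + 1), J a *m J (a + 2%:R) = - J (a + 1),
      J (a + 1) *m J (a + 2%:R) = J a & J (a + 2%:R) *m J (a + 1) = - J a].
Proof.
move=> tJ; have [m2 m2'] := triple_mul (a + 2%:R) tJ;
  have [m1 m1'] := triple_mul (a + 1) tJ.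
move: m1 m1' m2 m2'.
have -> : a + 2%:R + 1 = a by elim/ord3P: a; exact: val_inj.
have -> : a + 2%:R + 2%:R = a + 1 by elim/ord3P: a; exact: val_inj.
have -> : a + 1 + 1 = a + 2%:R by elim/ord3P: a; exact: val_inj.
by have -> : a + 1 + 2%:R = a by elim/ord3P: a; exact: val_inj.
Qed.

Lemma triple_anti (J : 'I_3 -> 'M[R]_4) a b : quaternionic_triple J ->
  J a *m J b + J b *m J a = (- 2 * (a == b)%:R)%:M.
Proof.
move=> tJ; have [sq _ _] := tJ.
have neq c : J c *m J (c + 1) + J (c + 1) *m J c = 0.
  by have [-> ->] := triple_mul c tJ; rewrite addrN.
have [<-|ab] := eqVneq a b.
  by rewrite sq mulr1 -scaleN1r -scalerDl scalemx1; congr (_%:M); ring.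
rewrite mulr0 -scalemx1 scale0r.
have /orP[/eqP->|/eqP->] : (b == a + 1) || (a == b + 1).
- by move: ab; elim/ord3P: a; elim/ord3P: b; rewrite !ord3_add ?eqxx ?orbT.
- exact: neq.
- by rewrite addrC; exact: neq.
Qed.

Lemma tr_triple (J : 'I_3 -> 'M[R]_4) a b : quaternionic_triple J ->
  \tr (J a *m J b) = - 4 * (a == b)%:R.
Proof.
move=> tJ; have := congr1 mxtrace (triple_anti a b tJ).
rewrite mxtraceD [\tr (J b *m _)]mxtrace_mulC mxtrace_scalar.
by rewrite -mulr_natl; lra.
Qed.

(** The left multiplications by i, j and k. *)
Definition Kstd (a : 'I_3) : 'M[R]_4 :=
  if a == 0 then lmul 1 0 0 else if a == 1 then lmul 0 1 0 else lmul 0 0 1.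

Lemma skew4E (S : 'M[R]_4) : S^T = - S -> S = mx4
  [:: [:: 0; S o0 o1; S o0 o2; S o0 o3]; [:: - S o0 o1; 0; S o1 o2; S o1 o3];
      [:: - S o0 o2; - S o1 o2; 0; S o2 o3];
      [:: - S o0 o3; - S o1 o3; - S o2 o3; 0]].
Proof.
move=> Ss; have s i j : S i j = - S j i.
  by have /matrixP/(_ j i) := Ss; rewrite !mxE.
have d i : S i i = 0 by have := s i i; lra.
apply/matrixP; apply: ord4P; apply: ord4P; rewrite mx4E /= ?d //.
Qed.

(** A skew matrix is the sum of a left and of a right multiplication by
    imaginary quaternions. The right one, N, commutes with the unit quaternion
    q in question, hence contributes 2 q N to the anticommutator; this has
    trace zero, so that it is zero if the sum is scalar, and then N = 0. *)
Lemma skew_anticomm_lmul (S : 'M[R]_4) a b c (s : R) : S^T = - S ->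
  a * a + b * b + c * c = 1 ->
  S *m lmul a b c + lmul a b c *m S = s%:M ->
  exists x y z, S = lmul x y z.
Proof.
move=> /skew4E; set d := S o0 o1; set e := S o0 o2; set f := S o0 o3.
set h := S o1 o2; set k := S o1 o3; set l := S o2 o3.
move=> -> abc; move: d e f h k l => d e f h k l {S} /matrixP E.
have := E o0 o1; have := E o0 o2; have := E o0 o3; have := E o1 o2; have := E o1 o3.
have := E o2 o3; have := E o0 o0; have := E o1 o1; have := E o2 o2; have := E o3 o3.
have mE (A B : 'M[R]_4) i j : (A + B) i j = A i j + B i j by rewrite mxE.
clear E; rewrite !mE !mulmx4 !mx4E /= !mxE /= ?mulr0n ?mulr1n.
move=> E33 E22 E11 E00 E23 E13 E12 E03 E02 E01.
have unit_cancel u : u * a = 0 -> u * b = 0 -> u * c = 0 -> u = 0.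
  move=> ua ub uc; rewrite -[u]mulr1 -abc !mulrDr !mulrA ua ub uc; ring.
have p0 : d - l = 0 by apply: unit_cancel; lra.
have q0 : e + k = 0 by apply: unit_cancel; lra.
have r0 : f - h = 0 by apply: unit_cancel; lra.
clear E33 E22 E11 E00 E23 E13 E12 E03 E02 E01.
exists (- d), (- e), (- f).
by apply/matrixP; apply: ord4P; apply: ord4P; rewrite !mx4E /=; lra.
Qed.

(** Membership in the fibre of the quaternionic structure, for the metric with
    Gram matrix G. *)
Definition Qat G A := self_dual G (A^T *m G).

Section Frame.
Variables (F G : 'M[R]_4).
Hypotheses (FG : F^T *m G *m F = 1%:M) (F0 : 0 < \det F).

Let Fu : F \in unitmx. Proof. by rewrite unitmxE unitfE lt0r_neq0. Qed.

Lemma frame_unitG : G \in unitmx.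
Proof.
have : F^T *m G *m F \in unitmx by rewrite FG unitmx1.
by rewrite !unitmx_mul => /andP[/andP[]].
Qed.

(** All the algebra of the fibre is read off from this description by
    imaginary quaternions. *)
Lemma Qat_frame A :
  Qat G A <-> exists a b c, A = F *m lmul a b c *m invmx F.
Proof.
rewrite /Qat -(self_dual_cov _ frame_unitG F0) FG.
have -> : F^T *m (A^T *m G) *m F = (invmx F *m A *m F)^T.
  rewrite !trmx_mul -!mulmxA; congr (_ *m (_ *m _)).
  by rewrite -[(invmx F)^T]mulmx1 -FG !mulmxA -trmx_mul mulmxV// trmx1 mul1mx.
rewrite self_dual1P; split=> -[a [b [c E]]]; exists a, b, c.
  move/(congr1 trmx): E; rewrite !trmxK => <-.
  by rewrite !mulmxA mulmxV// mul1mx mulmxK.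
by rewrite E !mulmxA mulVmx// mul1mx mulmxKV.
Qed.

Lemma frame_mul A B : (F *m A *m invmx F) *m (F *m B *m invmx F) =
  F *m (A *m B) *m invmx F.
Proof. by rewrite !mulmxA mulmxKV. Qed.

Lemma frame_scalar (c : R) : F *m c%:M *m invmx F = c%:M.
Proof. by rewrite mul_mx_scalar -scalemxAl mulmxV// scalemx1. Qed.

Lemma frame_inj A B : F *m A *m invmx F = F *m B *m invmx F -> A = B.
Proof.
move=> /(congr1 (fun X => invmx F *m X *m F)).
by rewrite !mulmxA mulVmx// !mul1mx !mulmxKV.
Qed.

End Frame.

Lemma Qat_skew G A : G^T = G -> Qat G A -> A^T *m G = - (G *m A).
Proof. by move=> Gs [+ _]; rewrite trmx_mul trmxK Gs => ->; rewrite opprK. Qed.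

Section PosDef.
Variable (G : 'M[R]_4).
Hypothesis (Gp : pos_def G).

(** The scalar is the squared length of the imaginary quaternion. *)
Lemma Qat_sq A : Qat G A ->
  exists2 c : R, 0 <= c & A *m A = - c%:M /\ (c = 0 -> A = 0).
Proof.
have [F FG F0] := orthonormal_frame Gp; move=> /(Qat_frame FG F0)[a [b [c ->]]].
exists (a ^+ 2 + b ^+ 2 + c ^+ 2); first by rewrite !addr_ge0// sqr_ge0.
rewrite frame_mul// lmulM; split.
  rewrite -[in RHS](frame_scalar F0) -mulNmx -mulmxN; congr (_ *m _ *m _).
  apply/matrixP; apply: ord4P; apply: ord4P; rewrite !mxE /=; ring.
move=> /eqP; rewrite !paddr_eq0 ?addr_ge0 ?sqr_ge0// !sqrf_eq0.
move=> /andP[/andP[/eqP-> /eqP->] /eqP->].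
have -> : lmul 0 0 0 = 0 :> 'M[R]_4.
  by apply/matrixP; apply: ord4P; apply: ord4P; rewrite !mxE /= ?oppr0.
by rewrite mulmx0 mul0mx.
Qed.

Lemma QatD x y A B : Qat G A -> Qat G B -> Qat G (x *: A + y *: B).
Proof.
have [F FG F0] := orthonormal_frame Gp.
move=> /(Qat_frame FG F0)[a [b [c ->]]] /(Qat_frame FG F0)[a' [b' [c' ->]]].
apply/(Qat_frame FG F0); exists (x * a + y * a'), (x * b + y * b'), (x * c + y * c').
by rewrite -lmulD -!lmulZ mulmxDr mulmxDl -!scalemxAr -!scalemxAl.
Qed.

Lemma QatZ c A : Qat G A -> Qat G (c *: A).
Proof. by move=> QA; have := QatD c 0 QA QA; rewrite scale0r addr0. Qed.

Lemma QatB A B : Qat G A -> Qat G B -> Qat G (A - B).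
Proof.
by move=> QA QB; have := QatD 1 (- 1) QA QB; rewrite scale1r scaleN1r.
Qed.

Lemma Qat_anticomm A B : Qat G A -> Qat G B ->
  exists s : R, A *m B + B *m A = s%:M.
Proof.
have [F FG F0] := orthonormal_frame Gp.
move=> /(Qat_frame FG F0)[a [b [c ->]]] /(Qat_frame FG F0)[a' [b' [c' ->]]].
exists (- 2 * (a * a' + b * b' + c * c')).
rewrite !frame_mul// -mulmxDl -mulmxDr -[RHS](frame_scalar F0).
congr (_ *m _ *m _); rewrite !lmulM.
by apply/matrixP; apply: ord4P; apply: ord4P; rewrite !mxE /=; ring.
Qed.

(** Two imaginary quaternions that anticommute are orthogonal, and then their
    product is their vector product. *)
Lemma Qat_mul A B : Qat G A -> Qat G B -> A *m B + B *m A = 0 -> Qat G (A *m B).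
Proof.
have [F FG F0] := orthonormal_frame Gp.
move=> /(Qat_frame FG F0)[a [b [c ->]]] /(Qat_frame FG F0)[a' [b' [c' ->]]].
rewrite !frame_mul// -mulmxDl -mulmxDr => AB.
have {}AB : lmul a b c *m lmul a' b' c' + lmul a' b' c' *m lmul a b c = 0.
  by apply: (frame_inj F0); rewrite AB mulmx0 mul0mx.
apply/(Qat_frame FG F0); rewrite lmulM.
have -> : a * a' + b * b' + c * c' = 0.
  have /matrixP/(_ o0 o0) := AB; rewrite !lmulM !mxE /=; lra.
by rewrite raddf0 oppr0 add0r; eexists; eexists; eexists; reflexivity.
Qed.

(** A criterion for covariant derivatives of sections to stay in the fibre:
    the hypotheses are obtained by differentiating the skewness of a section
    and the fact that its anticommutator with J is a scalar. *)
Lemma Qat_of_anticomm N J (s : R) : N^T *m G + G *m N = 0 -> Qat G J ->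
  J *m J = - 1%:M -> N *m J + J *m N = s%:M -> Qat G N.
Proof.
have [F FG F0] := orthonormal_frame Gp; have Gu := frame_unitG FG.
have Fu : F \in unitmx by rewrite unitmxE unitfE lt0r_neq0.
move=> Ns /(Qat_frame FG F0)[a [b [c ->]]].
pose N' := invmx F *m N *m F.
have NE : N = F *m N' *m invmx F by rewrite !mulmxA mulmxV// mul1mx mulmxK.
have N's : N'^T = - N'.
  apply/eqP; rewrite -addr_eq0; apply/eqP.
  transitivity (F^T *m (N^T *m G + G *m N) *m F); last first.
    by rewrite Ns mulmx0 mul0mx.
  have -> : N' = F^T *m G *m F *m N' by rewrite FG mul1mx.
  rewrite [in X in X^T]FG mul1mx mulmxDr mulmxDl; congr (_ + _).
    rewrite -[LHS]mulmx1 -FG /N' !trmx_mul trmx_inv !mulmxA.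
    by rewrite mulmxKV ?unitmx_tr.
  by rewrite /N' !mulmxA mulmxK.
rewrite NE !frame_mul// -mulmxDl -mulmxDr -(frame_scalar F0 s).
rewrite -[X in - X](frame_scalar F0 1) -mulNmx -mulmxN => /(frame_inj F0) JJ.
move=> /(frame_inj F0) NJ.
have abc : a * a + b * b + c * c = 1.
  by have /matrixP/(_ o0 o0) := JJ; rewrite mulmx4 !mxE /=; lra.
have [x [y [z N'E]]] := skew_anticomm_lmul N's abc NJ.
by apply/(Qat_frame FG F0); exists x, y, z; rewrite N'E.
Qed.

End PosDef.
End Quat.
Arguments Kstd {R} a.

(** * Frames adapted to a quaternionic triple *)

Section Quat.
Variable (R : realType).
Implicit Types (G A B J N F : 'M[R]_4).

(** The remainder [B] anticommutes with the three members of the triple, but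
    it also commutes with the third one, which is the product of the other
    two. *)
Lemma Qat_span G (Gp : pos_def G) (J : 'I_3 -> 'M[R]_4) A : (forall a, Qat G (J a)) ->
  quaternionic_triple J -> Qat G A ->
  exists c : 'I_3 -> R, A = \sum_a c a *: J a.
Proof.
move=> QJ tJ QA.
have /choice[s sE] : forall a, exists s : R, A *m J a + J a *m A = s%:M.
  by move=> a; exact: (Qat_anticomm Gp).
exists (fun a => - 2^-1 * s a).
pose B := A - \sum_a (- 2^-1 * s a) *: J a.
apply/eqP; rewrite -subr_eq0; apply/eqP; rewrite -/B.
have anti a : B *m J a = - (J a *m B).
  apply/eqP; rewrite -addr_eq0 /B mulmxBl mulmxBr addrACA sE -opprD.
  rewrite mulmx_suml mulmx_sumr -big_split /=.
  rewrite (bigD1 a)//= big1 => [|b ba].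
    rewrite -scalemxAl -scalemxAr -scalerDr (triple_anti _ _ tJ) eqxx.
    rewrite scale_scalar_mx addr0 subr_eq0; apply/eqP; congr (_%:M).
    by rewrite /=; field.
  rewrite -scalemxAl -scalemxAr -scalerDr (triple_anti _ _ tJ) (negbTE ba).
  by rewrite mulr0 -scalemx1 scale0r scaler0.
have [sq J01 _] := tJ.
have comm : B *m J 2%:R = J 2%:R *m B.
  rewrite -J01 mulmxA anti mulNmx -(mulmxA (J 0) B) anti mulmxN opprK.
  by rewrite mulmxA.
have JB : J 2%:R *m B = 0.
  move: comm; rewrite anti => /eqP; rewrite eq_sym -addr_eq0 -mulr2n -scaler_nat.
  by rewrite scaler_eq0 pnatr_eq0 => /eqP.
apply/eqP; rewrite -oppr_eq0 -[B]mul1mx -mulNmx -(sq 2%:R) -mulmxA JB.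
by rewrite mulmx0.
Qed.

(** The hypotheses say that three imaginary quaternions are orthonormal and
    multiply like i, j, k, and [H] is the rotation that fixes 1 and sends i,
    j, k to them. *)
Lemma quaternion_basis_change (x0 y0 z0 x1 y1 z1 x2 y2 z2 : R) :
  [/\ x0 * x0 + y0 * y0 + z0 * z0 = 1, x1 * x1 + y1 * y1 + z1 * z1 = 1
    & x2 * x2 + y2 * y2 + z2 * z2 = 1] ->
  [/\ x0 * x1 + y0 * y1 + z0 * z1 = 0, x1 * x2 + y1 * y2 + z1 * z2 = 0
    & x2 * x0 + y2 * y0 + z2 * z0 = 0] ->
  [/\ y0 * z1 - z0 * y1 = x2, z0 * x1 - x0 * z1 = y2 & x0 * y1 - y0 * x1 = z2] ->
  [/\ y1 * z2 - z1 * y2 = x0, z1 * x2 - x1 * z2 = y0 & x1 * y2 - y1 * x2 = z0] ->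
  [/\ y2 * z0 - z2 * y0 = x1, z2 * x0 - x2 * z0 = y1 & x2 * y0 - y2 * x0 = z1] ->
  let H := mx4 [:: [:: 1; 0; 0; 0]; [:: 0; x0; x1; x2]; [:: 0; y0; y1; y2];
                   [:: 0; z0; z1; z2]] in
  [/\ lmul x0 y0 z0 *m H = H *m lmul 1 0 0, lmul x1 y1 z1 *m H = H *m lmul 0 1 0,
      lmul x2 y2 z2 *m H = H *m lmul 0 0 1, H^T *m H = 1%:M & \det H = 1].
Proof.
move=> [s0 s1 s2] [d01 d12 d20] [X2 Y2 Z2] [X0 Y0 Z0] [X1 Y1 Z1] H; split.
- clear s1 s2 d12 X0 Y0 Z0.
  by apply/matrixP; apply: ord4P; apply: ord4P; rewrite !mulmx4 !mx4E /=; lra.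
- clear s0 s2 d20 X1 Y1 Z1.
  by apply/matrixP; apply: ord4P; apply: ord4P; rewrite !mulmx4 !mx4E /=; lra.
- clear s0 s1 d01 X2 Y2 Z2.
  by apply/matrixP; apply: ord4P; apply: ord4P; rewrite !mulmx4 !mx4E /=; lra.
- clear X0 Y0 Z0 X1 Y1 Z1 X2 Y2 Z2.
  by apply/matrixP; apply: ord4P; apply: ord4P; rewrite mulmx4 !mxE /=; lra.
- rewrite det4 /= !mx4E /= -[RHS]s0 -[X in _ = x0 * X + _ + _]X0.
  rewrite -[X in _ = _ + y0 * X + _]Y0 -[X in _ = _ + _ + z0 * X]Z0; ring.
Qed.

(** An orthonormal frame makes the triple one of imaginary quaternions, which
    a rotation of the imaginary quaternions moves to i, j, k. *)
Lemma adapted_frame (G : 'M[R]_4) (J : 'I_3 -> 'M[R]_4) : pos_def G ->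
  (forall a, Qat G (J a)) -> quaternionic_triple J ->
  exists F : 'M[R]_4, [/\ F^T *m G *m F = 1%:M, 0 < \det F &
    forall a, J a = F *m Kstd a *m invmx F].
Proof.
move=> Gp QJ tJ; have [F FG F0] := orthonormal_frame Gp.
have Fu : F \in unitmx by rewrite unitmxE unitfE lt0r_neq0.
have /choice[x xE] a := (Qat_frame FG F0 (J a)).1 (QJ a).
have /choice[y yE] := xE; have /choice[z JE] := yE.
pose L a := lmul (x a) (y a) (z a).
have LE a : L a = invmx F *m J a *m F.
  by rewrite JE !mulmxA mulVmx// mul1mx mulmxKV.
have Lmul a b : L a *m L b = invmx F *m (J a *m J b) *m F.
  by rewrite !LE !mulmxA mulmxK.
have Lsq a : L a *m L a = - 1%:M.
  by have [sq _ _] := tJ; rewrite Lmul sq mulmxN mulmx1 mulNmx mulVmx.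
have {}Lmul a : L a *m L (a + 1) = L (a + 2%:R).
  by rewrite Lmul (triple_mul a tJ).1 -LE.
have sqE a : x a * x a + y a * y a + z a * z a = 1.
  by have /matrixP/(_ o0 o0) := Lsq a; rewrite mulmx4 !mxE /=; lra.
have mulE a : [/\ x a * x (a + 1) + y a * y (a + 1) + z a * z (a + 1) = 0,
    y a * z (a + 1) - z a * y (a + 1) = x (a + 2%:R),
    z a * x (a + 1) - x a * z (a + 1) = y (a + 2%:R) &
    x a * y (a + 1) - y a * x (a + 1) = z (a + 2%:R)].
  have := Lmul a; rewrite lmulM => /matrixP E; split.
  - by have := E o0 o0; rewrite !mxE /=; lra.
  - by have := E o1 o0; rewrite !mxE /=; lra.
  - by have := E o2 o0; rewrite !mxE /=; lra.
  - by have := E o3 o0; rewrite !mxE /=; lra.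
have := mulE 0; have := mulE 1; have := mulE 2%:R; rewrite !ord3_add.
have := sqE 0; have := sqE 1; have := sqE 2%:R.
pose H : 'M[R]_4 := mx4 [:: [:: 1; 0; 0; 0]; [:: 0; x 0; x 1; x 2%:R];
  [:: 0; y 0; y 1; y 2%:R]; [:: 0; z 0; z 1; z 2%:R]].
move=> s2 s1 s0 [d20 X1 Y1 Z1] [d12 X0 Y0 Z0] [d01 X2 Y2 Z2].
have [H0 H1 H2 HH dH] := quaternion_basis_change (And3 s0 s1 s2)
  (And3 d01 d12 d20) (And3 X2 Y2 Z2) (And3 X0 Y0 Z0) (And3 X1 Y1 Z1).
rewrite -/H in H0 H1 H2 HH dH.
have LH a : L a *m H = H *m Kstd a by elim/ord3P: a.
have Hu : H \in unitmx by rewrite unitmxE unitfE dH oner_eq0.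
exists (F *m H); split.
- by rewrite trmx_mul -!mulmxA (mulmxA G) (mulmxA F^T) (mulmxA F^T) FG mul1mx.
- by rewrite det_mulmx dH mulr1.
- by move=> a; rewrite JE invmx_mul// -(mulmxA F H) -LH !mulmxA mulmxK.
Qed.

End Quat.

(** * Curvature tensors under a change of frame *)

Section Weyl.
Variable (R : realType).
Implicit Types (G F W X P Q : 'M[R]_4) (r : 'I_4 -> 'I_4 -> 'M[R]_4).

Definition ric_of r : 'M[R]_4 := \matrix_(b, c) \sum_a r a b a c.

(** The Weyl tensor as an algebraic expression in the matrices [r a b] of the
    curvature operators R(e_a, e_b). *)
Definition weyl_of G r (a b c d : 'I_4) : R :=
  (G *m r a b) d c
  - 2^-1 * (G a d * (\sum_e r e b e c) + G b c * (\sum_e r e a e d)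
            - G a c * (\sum_e r e b e d) - G b d * (\sum_e r e a e c))
  + 6^-1 * (\sum_b \sum_c invmx G b c * (\sum_a r a b a c))
    * (G a d * G b c - G a c * G b d).

Definition weyl_op_of G r W : 'M[R]_4 :=
  \matrix_(a, b) (2^-1 * \sum_c \sum_d
    weyl_of G r a b c d * (invmx G *m W *m invmx G) c d).

Lemma mul_sumE (X M Y : 'M[R]_4) a b :
  \sum_c \sum_d X a c * Y b d * M c d = (X *m M *m Y^T) a b.
Proof.
rewrite mxE exchange_big /=; apply: eq_bigr => d _.
by rewrite !mxE mulr_suml; apply: eq_bigr => c _; rewrite mulrAC.
Qed.

Lemma mul_sumET (X M Y : 'M[R]_4) a b :
  \sum_c \sum_d X a d * Y b c * M c d = (X *m M^T *m Y^T) a b.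
Proof.
rewrite -mul_sumE exchange_big /=.
by apply: eq_bigr => c _; apply: eq_bigr => d _; rewrite !mxE.
Qed.

(** Without indices, covariance under a change of frame reduces to the
    cancellation of F against its inverse. *)
Lemma weyl_op_ofE G r W : G^T = G -> W^T = - W ->
  let M := invmx G *m W *m invmx G in
  weyl_op_of G r W = 2^-1 *: (\matrix_(a, b) \tr (G *m r a b *m M)
    + G *m M *m (ric_of r)^T + ric_of r *m M *m G
    - (3^-1 * \tr (invmx G *m (ric_of r)^T)) *: (G *m M *m G)).
Proof.
move=> Gs Ws M; apply/matrixP => a b; rewrite mxE [RHS]mxE; congr (_ * _).
have Ms : M^T = - M.
  by rewrite /M !trmx_mul trmx_inv Gs Ws mulNmx mulmxN mulmxA.
have sE : \sum_b \sum_c invmx G b c * (\sum_a r a b a c)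
    = \tr (invmx G *m (ric_of r)^T).
  apply: eq_bigr => b' _; rewrite !mxE; apply: eq_bigr => c _.
  by rewrite !mxE.
rewrite /weyl_of sE -/M; set s := \tr _.
have ricE i j : \sum_e r e i e j = ric_of r i j by rewrite mxE.
transitivity (\sum_c \sum_d ((G *m r a b) d c * M c d)
  - 2^-1 * (\sum_c \sum_d G a d * ric_of r b c * M c d
    + \sum_c \sum_d ric_of r a d * G b c * M c d
    - \sum_c \sum_d G a c * ric_of r b d * M c d
    - \sum_c \sum_d ric_of r a c * G b d * M c d)
  + 6^-1 * s * (\sum_c \sum_d G a d * G b c * M c d
    - \sum_c \sum_d G a c * G b d * M c d)).
  rewrite -!sumrB -!big_split /= -!sumrB !mulr_sumr -!sumrB -!big_split /=.
  apply: eq_bigr => c _.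
  rewrite -!sumrB -!big_split /= -!sumrB !mulr_sumr -!sumrB -!big_split /=.
  by apply: eq_bigr => d _; rewrite !ricE; ring.
rewrite !mul_sumE !mul_sumET Ms Gs !mulmxN !mulNmx.
have -> : \sum_c \sum_d (G *m r a b) d c * M c d = \tr (G *m r a b *m M).
  rewrite exchange_big; apply: eq_bigr => d _.
  by rewrite [RHS]mxE; apply: eq_bigr => c _.
move: (G *m M *m G) (G *m M *m (ric_of r)^T) (ric_of r *m M *m G) s.
by move=> A B C s; rewrite !mxE; field.
Qed.

(** The curvature operators of the frame formed by the columns of F. *)
Definition change_frame F r (a b : 'I_4) : 'M[R]_4 :=
  invmx F *m (\sum_k \sum_l (F k a * F l b) *: r k l) *m F.

Lemma sum_bilinear F (X : 'I_4 -> 'I_4 -> R) a b :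
  \sum_k \sum_l F k a * F l b * X k l = (F^T *m \matrix_(k, l) X k l *m F) a b.
Proof.
rewrite exchange_big !mxE; apply: eq_bigr => l _.
rewrite !mxE mulr_suml; apply: eq_bigr => k _.
by rewrite !mxE mulrAC.
Qed.

Lemma tr_change_frame F r X a b : F \in unitmx ->
  \tr (X *m change_frame F r a b) =
  (F^T *m (\matrix_(k, l) \tr (F *m X *m invmx F *m r k l)) *m F) a b.
Proof.
move=> Fu; rewrite -sum_bilinear /change_frame !mulmxA mxtrace_mulC !mulmxA.
rewrite mulmx_sumr linear_sum; apply: eq_bigr => k _.
rewrite mulmx_sumr linear_sum; apply: eq_bigr => l _.
by rewrite -scalemxAr linearZ.
Qed.

Lemma ric_change_frame F r : F \in unitmx ->
  ric_of (change_frame F r) = F^T *m ric_of r *m F.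
Proof.
move=> Fu; apply/matrixP => b c; rewrite mxE.
transitivity (\sum_l F l b * \sum_k (r k l *m F) k c); last first.
  rewrite -mulmxA mxE; apply: eq_bigr => l _; rewrite mxE; congr (_ * _).
  rewrite mxE; under [RHS]eq_bigr do rewrite mxE mulr_suml.
  by rewrite [RHS]exchange_big; apply: eq_bigr => k _; rewrite mxE.
transitivity (\sum_a \sum_l F l b * \sum_k F k a * (invmx F *m (r k l *m F)) a c).
  apply: eq_bigr => a _; rewrite /change_frame exchange_big.
  rewrite mulmx_sumr mulmx_suml summxE; apply: eq_bigr => l _.
  rewrite mulmx_sumr mulmx_suml summxE mulr_sumr; apply: eq_bigr => k _.
  by rewrite -scalemxAr -scalemxAl mxE mulmxA; ring.
rewrite exchange_big; apply: eq_bigr => l _; rewrite -mulr_sumr; congr (_ * _).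
rewrite exchange_big; apply: eq_bigr => k _.
by rewrite -{2}[r k l *m F](mulKVmx Fu) [RHS]mxE.
Qed.

Lemma weyl_op_change_frame F G r W : F \in unitmx -> G \in unitmx ->
  G^T = G -> W^T = - W ->
  weyl_op_of (F^T *m G *m F) (change_frame F r) (F^T *m W *m F)
    = F^T *m weyl_op_of G r W *m F.
Proof.
move=> Fu Gu Gs Ws; have FTu : F^T \in unitmx by rewrite unitmx_tr.
have G's : (F^T *m G *m F)^T = F^T *m G *m F.
  by rewrite !trmx_mul trmxK Gs mulmxA.
have W's : (F^T *m W *m F)^T = - (F^T *m W *m F).
  by rewrite !trmx_mul trmxK Ws mulmxA mulmxN mulNmx.
rewrite !weyl_op_ofE// ric_change_frame//; set M := invmx G *m W *m invmx G.
have -> : invmx (F^T *m G *m F) = invmx F *m invmx G *m invmx F^T.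
  by rewrite !invmx_mul ?unitmx_mul ?FTu ?Gu// mulmxA.
have -> : invmx F *m invmx G *m invmx F^T *m (F^T *m W *m F) *m
    (invmx F *m invmx G *m invmx F^T) = invmx F *m M *m invmx F^T.
  by rewrite /M !mulmxA mulmxKV// mulmxK.
move: M => M; rewrite -scalemxAr -scalemxAl; congr (_ *: _).
rewrite !(mulmxDr, mulmxDl) mulmxN mulNmx -scalemxAr -scalemxAl.
rewrite !trmx_mul !trmxK !mulmxA.
congr (_ + _ + _ - _).
- apply/matrixP => a b; rewrite mxE mxtrace_mulC mulmxA tr_change_frame//.
  congr ((_ *m _ *m _) a b); apply/matrixP => k l; rewrite !mxE.
  rewrite !mulmxA mulmxV// mul1mx mulmxKV// mulmxK//.
  by rewrite [RHS]mxtrace_mulC mulmxA.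
- by rewrite (mulmxK Fu) (mulmxKV FTu).
- by rewrite (mulmxK Fu) (mulmxKV FTu).
- rewrite (mulmxK Fu (F^T *m G)) (mulmxKV FTu (F^T *m G *m M)); congr ((_ * _) *: _).
  by rewrite mxtrace_mulC !mulmxA mulmxV// mul1mx (mulmxKV FTu).
Qed.

Definition ricci_mx r (J : 'M[R]_4) : 'M[R]_4 :=
  \matrix_(k, l) (- 2^-1 * \tr (J *m r k l)).

(** The matrix of the bilinear form on the left-hand side of the curvature
    condition. *)
Definition quat_bianchi r (J : 'I_3 -> 'M[R]_4) (a : 'I_3) : 'M[R]_4 :=
  let P := ricci_mx r (J a) in let Q := ricci_mx r (J (a + 1)) in
  let Jc := J (a + 2%:R) in
  Jc^T *m P *m Jc - P + Jc^T *m Q + Q *m Jc.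

Lemma ricci_mx_change_frame F r J : F \in unitmx ->
  ricci_mx (change_frame F r) (invmx F *m J *m F) = F^T *m ricci_mx r J *m F.
Proof.
move=> Fu; apply/matrixP => a b; rewrite mxE tr_change_frame//.
have -> : F *m (invmx F *m J *m F) *m invmx F = J.
  by rewrite !mulmxA mulmxV// mul1mx mulmxK.
have -> : ricci_mx r J = (- 2^-1) *: \matrix_(k, l) \tr (J *m r k l).
  by apply/matrixP => k l; rewrite !mxE.
by rewrite -scalemxAr -scalemxAl [RHS]mxE.
Qed.

Lemma quat_bianchi_change_frame F r (J : 'I_3 -> 'M[R]_4) a : F \in unitmx ->
  quat_bianchi (change_frame F r) (fun b => invmx F *m J b *m F) a
    = F^T *m quat_bianchi r J a *m F.
Proof.
move=> Fu; have FTu : F^T \in unitmx by rewrite unitmx_tr.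
rewrite /quat_bianchi !ricci_mx_change_frame// !(mulmxDr, mulmxDl) mulmxN mulNmx.
rewrite !trmx_mul trmx_inv !mulmxA.
by congr (_ - _ + _ + _); rewrite ?mulmxKV// ?mulmxK// mulmxKV// ?mulmxK.
Qed.

Definition curvature_like G r :=
  [/\ forall a b, r b a = - r a b,
      forall a b, (r a b)^T *m G = - (G *m r a b)
    & forall a b c i, r a b i c + r b c i a + r c a i b = 0].

Lemma sum3_rot (H : 'I_4 -> 'I_4 -> 'I_4 -> R) :
  \sum_k \sum_l \sum_m H k l m = \sum_k \sum_l \sum_m H l m k.
Proof.
rewrite [RHS]exchange_big; apply: eq_bigr => k _.
by rewrite [RHS]exchange_big.
Qed.

Lemma curvature_like_change_frame F G r : F \in unitmx -> curvature_like G r ->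
  curvature_like (F^T *m G *m F) (change_frame F r).
Proof.
move=> Fu [s1 s2 s3]; split.
- move=> a b; rewrite /change_frame -mulNmx -mulmxN; congr (_ *m _ *m _).
  rewrite exchange_big -sumrN; apply: eq_bigr => k _.
  rewrite -sumrN; apply: eq_bigr => l _.
  by rewrite s1 scalerN mulrC.
- move=> a b; rewrite /change_frame !trmx_mul !mulmxA trmx_inv mulmxKV ?unitmx_tr//.
  rewrite mulmxK// -mulNmx -mulmxN -!mulmxA; congr (_ *m _); rewrite !mulmxA.
  have trs (f : 'I_4 -> 'M[R]_4) : (\sum_k f k)^T = \sum_k (f k)^T.
    exact: linear_sum.
  congr (_ *m _); rewrite trs mulmx_suml mulmxN mulmx_sumr -sumrN.
  apply: eq_bigr => k _; rewrite trs mulmx_suml mulmx_sumr -sumrN.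
  apply: eq_bigr => l _; rewrite linearZ /= -scalemxAl s2.
  by rewrite [G *m (_ *: _)]linearZ /= scalerN.
(* The identity is checked on the tensor [T] obtained by changing the frame in
    the three lower indices only. *)
- pose T a b c j := \sum_k \sum_l \sum_m F k a * F l b * F m c * r k l j m.
  have T0 a b c j : T a b c j + T b c a j + T c a b j = 0.
    rewrite /T [X in _ + X + _]sum3_rot [X in _ + _ + X]sum3_rot.
    rewrite [X in _ + _ + X]sum3_rot -!big_split big1 //= => k _.
    rewrite -!big_split big1 //= => l _; rewrite -!big_split big1 //= => m _.
    have <- : F k a * F l b * F m c * (r k l j m + r l m j k + r m k j l) = 0.
      by rewrite s3 mulr0.
    by ring.
  have TE a b c i : change_frame F r a b i c = \sum_j invmx F i j * T a b c j.
    rewrite /change_frame -mulmxA mxE; apply: eq_bigr => j _; congr (_ * _).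
    rewrite /T mulmx_suml summxE; apply: eq_bigr => k _.
    rewrite mulmx_suml summxE; apply: eq_bigr => l _.
    rewrite -scalemxAl [LHS]mxE mxE mulr_sumr; apply: eq_bigr => m _; ring.
  move=> a b c i; rewrite !TE -!big_split big1 //= => j _.
  by rewrite -!mulrDr T0 mulr0.
Qed.

End Weyl.

(** * The standard quaternionic triple *)

Section Kstd.
Variable (R : realType).
Implicit Types (P Q X S : 'M[R]_4).
Local Notation K := (@Kstd R).

Lemma Kstd_triple : quaternionic_triple K.
Proof.
have K0 : K 0 = lmul 1 0 0 by [].
have K1 : K 1 = lmul 0 1 0 by [].
have K2 : K 2%:R = lmul 0 0 1 by [].
split; last 2 first.
- by rewrite K0 K1 K2 lmulM; apply/matrixP; apply: ord4P; apply: ord4P;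
    rewrite !mxE /=; ring.
- by rewrite K0 K1 K2 lmulM; apply/matrixP; apply: ord4P; apply: ord4P;
    rewrite !mxE /=; ring.
by elim/ord3P; rewrite ?K0 ?K1 ?K2 lmulM; apply/matrixP; apply: ord4P; apply: ord4P;
    rewrite !mxE /=; ring.
Qed.

Lemma Kstd_tr a : (K a)^T = - K a.
Proof.
elim/ord3P: a; rewrite /Kstd /=; apply/matrixP; apply: ord4P; apply: ord4P.
all: by rewrite !mxE /= ?oppr0 ?opprK.
Qed.

Lemma tr_Kstd S : S^T = - S ->
  [/\ \tr (K 0 *m S) = 2 * (S o0 o1 + S o2 o3),
      \tr (K 1 *m S) = 2 * (S o0 o2 - S o1 o3)
    & \tr (K 2%:R *m S) = 2 * (S o0 o3 + S o1 o2)].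
Proof.
move=> /skew4E; set p := S o0 o1; set q := S o0 o2; set u := S o0 o3.
set v := S o1 o2; set w := S o1 o3; set x := S o2 o3 => ->.
by split; rewrite /Kstd /= /mxtrace sum4 !mulmx4 !mx4E /=; ring.
Qed.

(** Only the components of P on i, j, k matter, the complementary part of a
    skew matrix being a right multiplication. *)
Lemma commutator_std P a : P^T = - P ->
  P *m K (a + 2%:R) - K (a + 2%:R) *m P =
  2^-1 *: (\tr (K a *m P) *: K (a + 1) - \tr (K (a + 1) *m P) *: K a).
Proof.
move=> Ps; have [] := tr_Kstd Ps; move/skew4E: Ps; set P1 := P o0 o1.
set P2 := P o0 o2; set P3 := P o0 o3; set P4 := P o1 o2; set P5 := P o1 o3.
set P6 := P o2 o3; move=> ->; move: P1 P2 P3 P4 P5 P6.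
have aE (A B : 'M[R]_4) i j : (A - B) i j = A i j - B i j by rewrite !mxE.
have zE t (A : 'M[R]_4) i j : (t *: A) i j = t * A i j by rewrite mxE.
elim/ord3P: a; rewrite !ord3_add => P1 P2 P3 P4 P5 P6 p0 p1 p2.
all: rewrite ?p0 ?p1 ?p2 /Kstd /=.
all: apply/matrixP; apply: ord4P; apply: ord4P.
all: by rewrite zE !aE !zE !mulmx4 !mx4E /=; field.
Qed.

(** As the transpose of K_c is its opposite and its inverse, the left-hand
    side is a combination of commutators of P and of Q with K_c. *)
Lemma quat_bianchi_std P Q a : P^T = - P -> Q^T = - Q ->
  let Kc := K (a + 2%:R) in
  Kc^T *m P *m Kc - P + Kc^T *m Q + Q *m Kc =
  2^-1 *: ((\tr (K a *m P) - \tr (K (a + 1) *m Q)) *: K a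
    + (\tr (K (a + 1) *m P) + \tr (K a *m Q)) *: K (a + 1)).
Proof.
move=> Ps Qs Kc; have [sq _ _] := Kstd_triple; rewrite Kstd_tr -/Kc.
have -> : - Kc *m P *m Kc - P + - Kc *m Q + Q *m Kc
    = - Kc *m (P *m Kc - Kc *m P) + (Q *m Kc - Kc *m Q).
  rewrite mulmxBr !mulNmx mulmxA !mulmxA sq mulNmx mul1mx.
  by rewrite opprK -!addrA (addrC (- _) (Q *m _)).
rewrite !commutator_std// -scalemxAr -scalerDr; congr (_ *: _).
have [Kca _ _ Kcb] := triple_table a Kstd_triple.
rewrite mulmxBr -!scalemxAr !mulNmx Kca Kcb.
by apply/matrixP => i j; rewrite !mxE; ring.
Qed.

Lemma sd_part_std X : X^T = - X ->
  2^-1 *: (X + hodge 1%:M X) = 0 <-> forall e, \tr (K e *m X) = 0.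
Proof.
move=> Xs; have [x0 x1 x2] := tr_Kstd Xs.
rewrite hodgeE det1 sqrtr1 mulr1 invmx1 mul1mx mulmx1.
move/skew4E: Xs x0 x1 x2; set X1 := X o0 o1.
set X2 := X o0 o2; set X3 := X o0 o3; set X4 := X o1 o2; set X5 := X o1 o3.
set X6 := X o2 o3; move=> -> x0 x1 x2.
split.
  move=> /matrixP E.
  have := E o0 o1; have := E o0 o2; have := E o0 o3; rewrite !mxE /= ?mxE /=.
  by move=> E3 E2 E1; elim/ord3P; rewrite ?x0 ?x1 ?x2; lra.
move=> E; have := E 2%:R; have := E 1; have := E 0; rewrite x0 x1 x2.
move=> e0 e1 e2; apply/matrixP; apply: ord4P; apply: ord4P.
all: by rewrite !mxE /= ?mxE /=; lra.
Qed.

End Kstd.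

(** * The Weyl tensor and the Ricci forms in an adapted frame *)

Section Kstd.
Variable (R : realType).
Local Notation K := (@Kstd R).

Section Std.
Variable r : 'I_4 -> 'I_4 -> 'M[R]_4.
Hypothesis rc : curvature_like 1%:M r.

Let s1 k l i j : r k l i j = - r l k i j.
Proof. by have [s _ _] := rc; rewrite (s l k) mxE. Qed.

Let s2 k l i j : r k l i j = - r k l j i.
Proof.
by have [_ /(_ k l) + _] := rc; rewrite mul1mx mulmx1 => /matrixP/(_ j i); rewrite !mxE.
Qed.

(** The sum of four instances of the Bianchi identity, one for each choice of
    the index kept fixed. *)
Lemma pair_symmetry k l i j : r k l i j = r i j k l.
Proof.
have [_ _ s3] := rc.
have := s3 k l i j; have := s3 l i j k; have := s3 i j k l; have := s3 j k l i.
have := s2 k l j i; have := s2 l i j k; have := s2 j l k i; have := s1 j l i k.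
have := s2 i j l k; have := s2 j k l i; have := s1 i k j l; have := s2 k i j l.
lra.
Qed.

Let Ric := ric_of r.
Let P e := ricci_mx r (K e).

(** The matrix of the curvature operator on self-dual forms, up to a factor:
    the entry is the component of the Ricci form of K_e on K_f. *)
Let m f e := \tr (K f *m P e).

Let Rics : Ric^T = Ric.
Proof.
apply/matrixP => b c; rewrite !mxE; apply: eq_bigr => a _.
by rewrite pair_symmetry.
Qed.

Let Ps e : (P e)^T = - P e.
Proof.
apply/matrixP => k l; rewrite !mxE; have [-> _ _] := rc.
by rewrite mulmxN raddfN mulrN.
Qed.

Let mC f e : m f e = m e f.
Proof.
have mE g h : m g h = - 2^-1 *
    \sum_k \sum_l \sum_i \sum_j K g k l * K h i j * r l k j i.
  rewrite /m /mxtrace mulr_sumr; apply: eq_bigr => k _.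
  rewrite mxE mulr_sumr; apply: eq_bigr => l _.
  rewrite mxE mulrCA /mxtrace; congr (_ * _); rewrite mulr_sumr.
  apply: eq_bigr => i _; rewrite mxE mulr_sumr; apply: eq_bigr => j _.
  by rewrite mulrA.
rewrite !mE; congr (_ * _).
transitivity (\sum_k \sum_i \sum_j \sum_l K f k l * K e i j * r l k j i).
  apply: eq_bigr => k _; rewrite exchange_big; apply: eq_bigr => i _.
  by rewrite exchange_big.
rewrite exchange_big; apply: eq_bigr => i _.
rewrite exchange_big; apply: eq_bigr => j _; apply: eq_bigr => k _.
by apply: eq_bigr => l _; rewrite pair_symmetry (mulrC (K f k l)).
Qed.

(** The sum of the three diagonal entries is turned into sectional curvatures
    by the Bianchi identity for four distinct indices. *)
Let mtr : m 0 0 + m 1 1 + m 2%:R 2%:R = - \tr Ric.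
Proof.
have sk k l : (r k l)^T = - r k l.
  by apply/matrixP => i j; rewrite !mxE s2.
rewrite /m; have PE e k l : P e k l = - 2^-1 * \tr (K e *m r k l) by rewrite mxE.
have [-> _ _] := tr_Kstd (Ps 0); have [_ -> _] := tr_Kstd (Ps 1).
have [_ _ ->] := tr_Kstd (Ps 2%:R); rewrite !PE.
have t0 k l : \tr (K 0 *m r k l) = 2 * (r k l o0 o1 + r k l o2 o3).
  by have [] := tr_Kstd (sk k l).
have t1 k l : \tr (K 1 *m r k l) = 2 * (r k l o0 o2 - r k l o1 o3).
  by have [] := tr_Kstd (sk k l).
have t2 k l : \tr (K 2%:R *m r k l) = 2 * (r k l o0 o3 + r k l o1 o2).
  by have [] := tr_Kstd (sk k l).
rewrite !t0 !t1 !t2 /mxtrace sum4 /Ric !mxE !sum4.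
have [_ _ /(_ o0 o1 o2 o3)] := rc.
rewrite (s2 o0 o1 o3 o2) (s2 o1 o2 o3 o0) (s1 o2 o0 o3 o1) (s2 o0 o2 o3 o1).
rewrite (pair_symmetry o2 o3 o0 o1) (pair_symmetry o1 o3 o0 o2).
rewrite (pair_symmetry o1 o2 o0 o3).
have dg i j : r i i i j = 0 by have := s1 i i i j; lra.
rewrite !dg (s1 o1 o0) (s1 o2 o0) (s1 o3 o0) (s1 o2 o1) (s1 o3 o1) (s1 o3 o2).
rewrite (s2 o0 o1 o1 o0) (s2 o0 o2 o2 o0) (s2 o0 o3 o3 o0) (s2 o1 o2 o2 o1).
rewrite (s2 o1 o3 o3 o1) (s2 o2 o3 o3 o2).
lra.
Qed.

Let X e := weyl_op_of 1%:M r (K e)^T.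

Let XE e : X e = P e - 2^-1 *: (K e *m Ric + Ric *m K e)
  + (6^-1 * \tr Ric) *: K e.
Proof.
have Ws : (- K e)^T = - - K e by rewrite linearN /= Kstd_tr.
rewrite /X Kstd_tr weyl_op_ofE ?trmx1//.
rewrite invmx1 !mul1mx !mulmx1 Rics.
have -> : \matrix_(a, b) \tr (1%:M *m r a b *m - K e) = 2 *: P e.
  apply/matrixP => a b; rewrite !mxE mul1mx mulmxN raddfN /= mxtrace_mulC.
  by field.
rewrite mulNmx mulmxN -/Ric; move: (K e *m Ric) (Ric *m K e) (\tr Ric) => A B t.
by apply/matrixP => a b; rewrite !mxE; field.
Qed.

(** The Ricci tensor enters through its traces with the products K_f K_e + K_e
    K_f, which are scalar matrices; so only the scalar curvature survives. *)
Let trKX f e : \tr (K f *m X e) = m f e + (3^-1 * - \tr Ric) * - (f == e)%:R.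
Proof.
transitivity (m f e - 2^-1 * \tr (K f *m (K e *m Ric + Ric *m K e))
    + (6^-1 * \tr Ric) * \tr (K f *m K e)).
  rewrite XE; move: (K e *m Ric + Ric *m K e) => A.
  by rewrite mulmxDr mulmxBr -!scalemxAr 2!mxtraceD raddfN /= !mxtraceZ.
have -> : \tr (K f *m (K e *m Ric + Ric *m K e)) = - 2 * (f == e)%:R * \tr Ric.
  rewrite mulmxDr linearD /= [\tr (K f *m (Ric *m _))]mxtrace_mulC -!mulmxA.
  rewrite [\tr (Ric *m _)]mxtrace_mulC -linearD /= mulmxA -mulmxDl.
  by rewrite (triple_anti _ _ (Kstd_triple R)) mul_scalar_mx linearZ.
rewrite (tr_triple _ _ (Kstd_triple R)); move: ((f == e)%:R) (\tr Ric) (m f e) => d t u.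
by field.
Qed.

Let Xs e : (X e)^T = - X e.
Proof.
have tD (A B : 'M[R]_4) : (A + B)^T = A^T + B^T by exact: linearD.
have tZ t (A : 'M[R]_4) : (t *: A)^T = t *: A^T by exact: linearZ.
rewrite XE -scaleNr !(tD, tZ) !trmx_mul Ps Rics !Kstd_tr mulmxN mulNmx.
move: (K e *m Ric) (Ric *m K e) => A B.
by apply/matrixP => a b; rewrite !mxE; ring.
Qed.

Let weyl_op_linear t A B : weyl_op_of 1%:M r (t *: A + B) =
  t *: weyl_op_of 1%:M r A + weyl_op_of 1%:M r B.
Proof.
apply/matrixP => a b; rewrite !mxE mulrCA -mulrDr; congr (_ * _).
rewrite mulr_sumr -big_split; apply: eq_bigr => c _.
rewrite mulr_sumr -big_split; apply: eq_bigr => d _ /=.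
rewrite invmx1 !mul1mx !mulmx1 !mxE; ring.
Qed.

(** Both sides say that [m] is a multiple of the identity; by [mtr] the
    multiple is then the one for which the self-dual part of the Weyl operator
    vanishes. *)
Lemma quat_bianchi_asd :
  (forall a, quat_bianchi r K a = 0) <->
  (forall W, self_dual 1%:M W ->
     2^-1 *: (weyl_op_of 1%:M r W + hodge 1%:M (weyl_op_of 1%:M r W)) = 0).
Proof.
have Kself e : self_dual 1%:M (K e)^T.
  apply/self_dual1P; elim/ord3P: e.
  - by exists 1, 0, 0.
  - by exists 0, 1, 0.
  - by exists 0, 0, 1.
have EE a : quat_bianchi r K a = 2^-1 *: ((m a a - m (a + 1) (a + 1)) *: K a
    + (m (a + 1) a + m a (a + 1)) *: K (a + 1)).
  by rewrite /quat_bianchi quat_bianchi_std//; exact: Ps.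
have mE : (forall a, quat_bianchi r K a = 0) <->
    (forall f e, m f e = (3^-1 * - \tr Ric) * (f == e)%:R).
  split=> [E0|mE a]; last first.
    have := EE a; rewrite !mE !eqxx subrr scale0r add0r.
    have -> : (a + 1 == a) = false by elim/ord3P: a.
    have -> : (a == a + 1) = false by elim/ord3P: a.
    by rewrite !mulr0 addr0 scale0r scaler0.
  have co a : m a a = m (a + 1) (a + 1) /\ m (a + 1) a = 0.
    have := EE a; rewrite E0 => /esym/eqP; rewrite scaler_eq0 invr_eq0 pnatr_eq0 /=.
    move=> /eqP E.
    have := congr1 (fun Y => \tr (K a *m Y)) E.
    have := congr1 (fun Y => \tr (K (a + 1) *m Y)) E.
    rewrite /= !mulmxDr -!scalemxAr !linearD !linearZ /= !(tr_triple _ _ (Kstd_triple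
      R)) !mulmx0 !linear0.
    have -> : (a + 1 == a) = false by elim/ord3P: a {E}.
    have -> : (a == a + 1) = false by elim/ord3P: a {E}.
    rewrite !eqxx (mC a (a + 1)) /=; split; lra.
  have [d0 o10] := co 0; have [d1 o21] := co 1; have [d2 o02] := co 2%:R.
  rewrite !ord3_add in d0 o10 d1 o21 d2 o02.
  have o01 := mC 1 0; have o12 := mC 2%:R 1; have o20 := mC 0 2%:R.
  have n01 : ((0 : 'I_3) == 1) = false by [].
  have n02 : ((0 : 'I_3) == 2%:R) = false by [].
  have n12 : ((1 : 'I_3) == 2%:R) = false by [].
  have n10 : ((1 : 'I_3) == 0) = false by [].
  have n20 : ((2%:R : 'I_3) == 0) = false by [].
  have n21 : ((2%:R : 'I_3) == 1) = false by [].
  have t := mtr; move=> f e.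
  elim/ord3P: f; elim/ord3P: e; rewrite ?eqxx ?n01 ?n02 ?n12 ?n10 ?n20 ?n21 /=;
    move: d0 d1 d2 o10 o21 o02 o01 o12 o20 t;
    move: (m 0 0) (m 0 1) (m 0 2%:R) (m 1 0) (m 1 1) (m 1 2%:R) (m 2%:R 0)
      (m 2%:R 1) (m 2%:R 2%:R) (\tr Ric) => m00 m01 m02 m10 m11 m12 m20 m21 m22 t;
    by clear; move=> *; lra.
rewrite mE; split=> [{}mE W /self_dual1P[a [b [c WE]]]|asd f e].
  have -> : W = a *: (K 0)^T + (b *: (K 1)^T + (c *: (K 2%:R)^T + 0)).
    rewrite WE addr0 -!linearZ -!linearD /=; congr trmx; rewrite /Kstd /=.
    by rewrite !lmulZ !lmulD; congr lmul; ring.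
  have w0 : weyl_op_of 1%:M r 0 = 0.
    have := weyl_op_linear 1 0 0; rewrite !scale1r addr0 => /eqP.
    by rewrite -subr_eq0 opprD addNKr oppr_eq0 => /eqP.
  rewrite !weyl_op_linear w0 addr0 -!/(X _); apply/sd_part_std.
    have tD (A B : 'M[R]_4) : (A + B)^T = A^T + B^T by exact: linearD.
    have tZ t (A : 'M[R]_4) : (t *: A)^T = t *: A^T by exact: linearZ.
    by rewrite !(tD, tZ, Xs) !scalerN !opprD.
  move=> e; rewrite !mulmxDr -!scalemxAr !mxtraceD !mxtraceZ !trKX !mE.
  ring.
have := sd_part_std (Xs e); rewrite asd// => -[/(_ erefl) /(_ f) + _].
rewrite trKX; lra.
Qed.

End Std.
End Kstd.

(** * The Weyl tensor and the Ricci forms in an arbitrary frame *)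

Lemma star_star (R : comNzRingType) (M : 'M[R]_4) :
  star (star M) = 2 *: (M - M^T).
Proof.
have skE (A : 'M[R]_4) i j : (2 *: (A - A^T)) i j = 2 * (A i j - A j i) by rewrite !mxE.
apply/matrixP; apply: ord4P; apply: ord4P; rewrite skE {1}/star mx4E /= ?mx4E /=.
all: ring.
Qed.

Section Pointwise.
Variable (R : realType) (G : 'M[R]_4).
Hypothesis Gp : pos_def G.

Lemma pos_def_unit : G \in unitmx.
Proof. by have [F /frame_unitG] := orthonormal_frame Gp. Qed.

Lemma pos_def_det : 0 < \det G.
Proof.
have [F FG F0] := orthonormal_frame Gp.
have := congr1 determinant FG; rewrite !det_mulmx det_tr det1 => E.
have : 0 < \det F * \det G * \det F by rewrite E.
by rewrite (pmulr_lgt0 _ F0) (pmulr_rgt0 _ F0).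
Qed.

(** Both sides are covariant under changes of oriented frame, so that an
    adapted frame reduces this to the standard triple. *)
Lemma quat_bianchi_asd_at (r : 'I_4 -> 'I_4 -> 'M[R]_4)
    (J : 'I_3 -> 'M[R]_4) :
  (forall a, Qat G (J a)) -> quaternionic_triple J -> curvature_like G r ->
  (forall a, quat_bianchi r J a = 0) <->
  (forall W, self_dual G W ->
     2^-1 *: (weyl_op_of G r W + hodge G (weyl_op_of G r W)) = 0).
Proof.
move=> QJ tJ rc; have [F [FG F0 JE]] := adapted_frame Gp QJ tJ.
have Fu : F \in unitmx by rewrite unitmxE unitfE lt0r_neq0.
have FTu : F^T \in unitmx by rewrite unitmx_tr.
have Gu := pos_def_unit; have [Gs _] := Gp.
have inj (A : 'M[R]_4) : F^T *m A *m F = 0 <-> A = 0.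
  split=> [|->]; last by rewrite mulmx0 mul0mx.
  move=> /(congr1 (fun X => invmx F^T *m X *m invmx F)).
  by rewrite !mulmxA mulVmx// mul1mx mulmxK// mulmx0 mul0mx.
have r'c := curvature_like_change_frame Fu rc; rewrite FG in r'c.
have KE : (fun b => invmx F *m J b *m F) = Kstd.
  apply/funext => b; rewrite JE !mulmxA mulVmx// mul1mx.
  by rewrite mulmxKV.
have E1 : (forall a, quat_bianchi r J a = 0) <->
    (forall a, quat_bianchi (change_frame F r) Kstd a = 0).
  by split=> E a; apply/inj; have := E a; rewrite -KE quat_bianchi_change_frame//;
    move=> /inj // ->; rewrite mulmx0 mul0mx.
rewrite E1 (quat_bianchi_asd r'c).
have E2 W : self_dual G W ->
    F^T *m (2^-1 *: (weyl_op_of G r W + hodge G (weyl_op_of G r W))) *m F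
    = 2^-1 *: (weyl_op_of 1%:M (change_frame F r) (F^T *m W *m F) +
       hodge 1%:M (weyl_op_of 1%:M (change_frame F r) (F^T *m W *m F))).
  move=> [Ws _]; rewrite -FG weyl_op_change_frame// hodge_cov//.
  by rewrite -scalemxAr -scalemxAl mulmxDr mulmxDl.
split=> asd W Wd.
  by apply/inj; rewrite E2//; apply: asd; rewrite -FG; apply/self_dual_cov.
have WE : W = F^T *m (invmx F^T *m W *m invmx F) *m F.
  by rewrite !mulmxA mulmxV// mul1mx mulmxKV.
have Wd' : self_dual G (invmx F^T *m W *m invmx F).
  by apply/(self_dual_cov _ Gu F0); rewrite -WE FG.
by rewrite WE -E2//; apply/inj; exact: asd.
Qed.

(** * Self-dual parts of two-forms *)

Lemma hodge_skew W : (hodge G W)^T = - hodge G W.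
Proof.
rewrite hodgeE; set c := _ * _; set M := _ *m _; apply/matrixP => i j.
rewrite !mxE -mulrN; congr (_ * _).
elim/ord4P: i; elim/ord4P: j => /=; ring.
Qed.

Lemma hodge_hodge W : W^T = - W -> hodge G (hodge G W) = W.
Proof.
move=> Ws; have [F FG F0] := orthonormal_frame Gp; have Gu := pos_def_unit.
have Fu : F \in unitmx by rewrite unitmxE unitfE lt0r_neq0.
have FTu : F^T \in unitmx by rewrite unitmx_tr.
have W's : (F^T *m W *m F)^T = - (F^T *m W *m F).
  by rewrite !trmx_mul trmxK Ws mulmxA mulmxN mulNmx.
have : F^T *m hodge G (hodge G W) *m F = F^T *m W *m F.
  rewrite -!hodge_cov// FG; rewrite !hodgeE det1 sqrtr1 mulr1 invmx1 !mul1mx !mulmx1.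
  have starZ c (A : 'M[R]_4) : star (c *: A) = c *: star A by exact: linearZ.
  rewrite starZ star_star W's; move: (F^T *m W *m F) => V.
  by apply/matrixP => i j; rewrite !mxE; field.
move=> /(congr1 (fun X => invmx F^T *m X *m invmx F)).
by rewrite !mulmxA !mulVmx// !mul1mx !mulmxK.
Qed.

Lemma hodgeD (A B : 'M[R]_4) : hodge G (A + B) = hodge G A + hodge G B.
Proof. by rewrite !hodgeE mulmxDr mulmxDl linearD scalerDr. Qed.

Lemma hodgeZ t (A : 'M[R]_4) : hodge G (t *: A) = t *: hodge G A.
Proof.
by rewrite !hodgeE -scalemxAr -scalemxAl linearZ /= !scalerA mulrC.
Qed.

(** Twice the self-dual part. *)
Definition sd_proj W := W + hodge G W.

(** The endomorphism A with A^T G = [sd_proj W], the sign coming from the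
    skewness of the form. *)
Definition sd_endo W := - (invmx G *m sd_proj W).

Lemma sd_proj_self_dual W : W^T = - W -> self_dual G (sd_proj W).
Proof.
move=> Ws; split; last by rewrite /sd_proj hodgeD hodge_hodge// addrC.
by rewrite /sd_proj linearD /= hodge_skew Ws opprD.
Qed.

Lemma sd_endo_Qat W : W^T = - W -> Qat G (sd_endo W).
Proof.
move=> Ws; have [Ps Pd] := sd_proj_self_dual Ws.
rewrite /Qat /sd_endo linearN /= trmx_mul trmx_inv Gp.1 Ps !mulNmx opprK.
by rewrite mulmxKV// pos_def_unit.
Qed.

Lemma sd_endo_eq0 W : sd_endo W = 0 -> sd_proj W = 0.
Proof.
rewrite /sd_endo => /eqP; rewrite oppr_eq0 => /eqP /(congr1 (mulmx G)).
by rewrite mulmx0 mulKVmx// pos_def_unit.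
Qed.

Lemma sd_endoD A B t : sd_endo (A + t *: B) = sd_endo A + t *: sd_endo B.
Proof.
rewrite /sd_endo /sd_proj hodgeD hodgeZ addrACA -scalerDr mulmxDr opprD.
by rewrite -scalemxAr scalerN.
Qed.

(** The exterior square of an anti-self-dual form w is -|w|^2 times the volume
    form, while that of a decomposable one is zero. *)
Lemma sd_proj_decomposable (u v : 'cV[R]_4) :
  let W := u *m v^T - v *m u^T in sd_proj W = 0 -> W = 0.
Proof.
move=> W; have [F FG F0] := orthonormal_frame Gp; have Gu := pos_def_unit.
have Fu : F \in unitmx by rewrite unitmxE unitfE lt0r_neq0.
have FTu : F^T \in unitmx by rewrite unitmx_tr.
have W'E : F^T *m W *m F = (F^T *m u) *m (F^T *m v)^T - (F^T *m v) *m (F^T *m u)^T.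
  by rewrite !trmx_mul !trmxK mulmxBr mulmxBl !mulmxA.
move=> W0; suff : F^T *m W *m F = 0.
  move=> /(congr1 (fun X => invmx F^T *m X *m invmx F)).
  by rewrite !mulmxA mulVmx// mul1mx mulmxK// mulmx0 mul0mx.
have : F^T *m W *m F + hodge 1%:M (F^T *m W *m F) = 0.
  by rewrite -FG hodge_cov// -mulmxDl -mulmxDr -/(sd_proj W) W0 mulmx0 mul0mx.
rewrite W'E hodgeE det1 sqrtr1 mulr1 invmx1 mul1mx mulmx1.
move: (F^T *m u) (F^T *m v) => x y {W W'E W0}.
pose z i j := x i 0 * y j 0 - y i 0 * x j 0.
have -> : x *m y^T - y *m x^T = \matrix_(i, j) z i j.
  by apply/matrixP => i j; rewrite !mxE !big_ord1 !mxE.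
move=> /matrixP E.
have e1 : z o0 o1 + z o2 o3 = 0.
  by have := E o0 o1; rewrite !mxE /= ?mxE /z; lra.
have e2 : z o0 o2 - z o1 o3 = 0.
  by have := E o0 o2; rewrite !mxE /= ?mxE /z; lra.
have e3 : z o0 o3 + z o1 o2 = 0.
  by have := E o0 o3; rewrite !mxE /= ?mxE /z; lra.
(* The Plucker relation. *)
have pf : z o0 o1 * z o2 o3 - z o0 o2 * z o1 o3 + z o0 o3 * z o1 o2 = 0.
  by rewrite /z; ring.
have : z o0 o1 ^+ 2 + z o0 o2 ^+ 2 + z o0 o3 ^+ 2 = 0.
  have -> : z o0 o1 = - z o2 o3 by lra.
  have -> : z o0 o2 = z o1 o3 by lra.
  have -> : z o0 o3 = - z o1 o2 by lra.
  move: pf; have -> : z o0 o1 = - z o2 o3 by lra.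
  have -> : z o0 o2 = z o1 o3 by lra.
  have -> : z o0 o3 = - z o1 o2 by lra.
  by move=> pf; lra.
move=> /eqP; rewrite !paddr_eq0 ?addr_ge0 ?sqr_ge0// !sqrf_eq0.
move=> /andP[/andP[/eqP z1 /eqP z2] /eqP z3].
have sk i j : z i j = - z j i by rewrite /z; ring.
have dg i : z i i = 0 by rewrite /z; ring.
apply/matrixP; apply: ord4P; apply: ord4P; rewrite !mxE ?dg//.
all: by rewrite ?(sk o1 o0) ?(sk o2 o0) ?(sk o3 o0) ?(sk o2 o1) ?(sk o3 o1) ?(sk o3
  o2); lra.
Qed.

End Pointwise.

Import numFieldNormedType.Exports.
Local Open Scope classical_set_scope.
Local Open Scope ring_scope.

(** * Differential calculus for functions of class C^1 *)

Section Calculus.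
Variables (R : realType) (n : nat).
Implicit Types (f : 'cV[R]_n -> R) (x y v : 'cV[R]_n).

Lemma is_derive_line f x v (s : R) :
  derivable f (x + s *: v) v ->
  is_derive s 1 (fun t : R => f (x + t *: v)) ('D_v f (x + s *: v)).
Proof.
move=> df.
have E : (fun h : R => h^-1 *: (f (x + (h *: 1 + s) *: v) - f (x + s *: v)))
       = (fun h : R => h^-1 *: (f (h *: v + (x + s *: v)) - f (x + s *: v))).
  apply/funext => h; congr (_ *: (f _ - _)).
  by rewrite scalerDl [_%:A]mulr1 addrCA.
by apply: DeriveDef; rewrite /derivable /derive /= E.
Qed.

Lemma line_mvt_itv f x v (a b : R) : a <= b ->
  (forall s : R, a <= s <= b -> derivable f (x + s *: v) v) ->
  exists2 s : R, a <= s <= b &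
    f (x + b *: v) - f (x + a *: v) = (b - a) * 'D_v f (x + s *: v).
Proof.
move=> ab df; pose F := fun t : R => f (x + t *: v).
pose F' := fun t : R => 'D_v f (x + t *: v).
have dl (s : R) : a <= s <= b -> is_derive s 1 F (F' s).
  by move=> /df; exact: is_derive_line.
have Fc : {within `[a, b], continuous F}.
  apply: derivable_within_continuous => s; rewrite in_itv /= => sab.
  by have [] := dl s sab.
have F'E (s : R) : s \in `]a, b[ -> is_derive s 1 F (F' s).
  by rewrite in_itv /= => /andP[? ?]; apply: dl; rewrite !ltW.
have [s sab E] := MVT_segment ab F'E Fc.
by exists s; [move: sab; rewrite in_itv | rewrite mulrC -E].
Qed.

Lemma line_mvt f x v (t : R) :
  (forall s : R, `|s| <= `|t| -> derivable f (x + s *: v) v) ->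
  exists2 s : R, `|s| <= `|t| &
    f (x + t *: v) - f x = t * 'D_v f (x + s *: v).
Proof.
move=> df; have [t0|t0] := leP 0 t.
  have [|s /andP[s0 st]] := @line_mvt_itv f x v 0 t t0.
    by move=> s /andP[s0 st]; apply: df; rewrite !ger0_norm.
  by rewrite scale0r addr0 subr0 => E; exists s; rewrite ?ger0_norm.
have [|s /andP[s0 st]] := @line_mvt_itv f x v t 0 (ltW t0).
  by move=> s /andP[s0 st]; apply: df; rewrite !ler0_norm ?lerN2// ltW.
rewrite scale0r addr0 sub0r mulNr => E; exists s.
  by rewrite !ler0_norm ?lerN2// ltW.
by rewrite -opprB E opprK.
Qed.

Lemma norm_delta_le1 (k : 'I_n) : `|delta_mx k 0 : 'cV[R]_n| <= 1.
Proof.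
rewrite /Num.Def.normr/= mx_normrE; apply: bigmax_le => // -[i j] _ /=.
by rewrite mxE; case: (_ && _); rewrite ?normr1 ?normr0.
Qed.

(** Go from x to x + v one coordinate at a time, and use the mean value
    theorem on each of these segments. *)
Lemma C1_increment f x (e : R) : 0 < e ->
  (forall k, \forall y \near x, derivable f y (delta_mx k 0)) ->
  (forall k, {for x, continuous (partial k f)}) ->
  exists2 d : R, 0 < d & forall v, \sum_k `|v k 0| < d ->
    `|f (x + v) - f x - \sum_k v k 0 * partial k f x|
      <= e * \sum_k `|v k 0|.
Proof.
move=> e0 df cf.
have : \forall y \near x, forall k, derivable f y (delta_mx k 0) /\
    `|partial k f x - partial k f y| < e.
  apply: (@filter_forall _ _ (fun k y => derivable f y (delta_mx k 0) /\
    `|partial k f x - partial k f y| < e) (nbhs x)) => k.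
  by apply: filterI; [exact: df | have /cvgrPdist_lt := cf k; exact].
move=> /nbhs_ballP[d /= d0 dB]; exists d => // v vd.
have dB' (w : 'cV[R]_n) : `|w| < d -> forall k,
    derivable f (x + w) (delta_mx k 0) /\
    `|partial k f x - partial k f (x + w)| < e.
  by move=> wd k; apply: dB; rewrite -ball_normE /= opprD addNKr normrN.
have vE : v = \sum_k v k 0 *: delta_mx k 0.
  by apply/matrixP => i j; rewrite {1}[v]matrix_sum_delta; rewrite !summxE;
     apply: eq_bigr => k _; rewrite big_ord1.
rewrite {1}vE; move: vd.
elim: (index_enum _) => [|k s IH].
  by rewrite !big_nil addr0 !subrr normr0 mulr0.
rewrite !big_cons => vd.
have vds : \sum_(j <- s) `|v j 0| < d.
  by apply: le_lt_trans vd; rewrite lerDr.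
set w := \sum_(j <- s) _ *: _.
have wle : `|w| <= \sum_(j <- s) `|v j 0|.
  apply: le_trans (ler_norm_sum _ _ _) _; apply: ler_sum => j _.
  by rewrite normrZ ler_piMr// norm_delta_le1.
have wd (t : R) : `|t| <= `|v k 0| -> `|w + t *: delta_mx k 0| < d.
  move=> tv; apply: le_lt_trans vd; rewrite addrC.
  apply: le_trans (ler_normD _ _) _; apply: lerD => //.
  by rewrite normrZ (le_trans _ tv)// ler_piMr// norm_delta_le1.
have [t tv|t tv E] := @line_mvt f (x + w) (delta_mx k 0) (v k 0).
  by rewrite -addrA; apply: (dB' _ (wd t tv) k).1.
have -> : f (x + (v k 0 *: delta_mx k 0 + w)) - f x
    - (v k 0 * partial k f x + \sum_(j <- s) v j 0 * partial j f x)
  = v k 0 * (partial k f (x + (w + t *: delta_mx k 0)) - partial k f x)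
    + (f (x + w) - f x - \sum_(j <- s) v j 0 * partial j f x).
  have PE : v k 0 * partial k f (x + (w + t *: delta_mx k 0)) =
      f (x + (v k 0 *: delta_mx k 0 + w)) - f (x + w).
    by rewrite (addrC (_ *: _) w) !addrA E.
  by rewrite mulrBr PE; ring.
apply: le_trans (ler_normD _ _) _; rewrite [leRHS]mulrDr; apply: lerD; last exact: IH.
rewrite normrM mulrC ler_wpM2r// distrC ltW//.
by have [] := dB' _ (wd t tv) k.
Qed.

Lemma is_derive_translate f x c v :
  derivable f (x + c) v -> is_derive x v (fun y => f (y + c)) ('D_v f (x + c)).
Proof.
move=> df.
have E : (fun h : R => h^-1 *: (f (h *: v + x + c) - f (x + c)))
       = (fun h : R => h^-1 *: (f (h *: v + (x + c)) - f (x + c))).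
  by apply/funext => h; rewrite addrA.
by apply: DeriveDef; rewrite /derivable /derive /= E.
Qed.

(** The mean value theorem in one direction for the increment in the other,
    and then once more. *)
Lemma second_difference f x (k l : 'I_n) (h : R) :
  let y s t := x + s *: delta_mx k 0 + t *: delta_mx l 0 in
  (forall s t, `|s| <= `|h| -> `|t| <= `|h| ->
     derivable f (y s t) (delta_mx k 0) /\
     derivable (partial k f) (y s t) (delta_mx l 0)) ->
  exists s t, [/\ `|s| <= `|h|, `|t| <= `|h| &
    f (y h h) - f (y h 0) - (f (y 0 h) - f (y 0 0))
      = h * (h * partial l (partial k f) (y s t))].
Proof.
move=> y df; pose f2 := (fun z => f (z + h *: delta_mx l 0)) \- f.
have h0 : `|0 : R| <= `|h| by rewrite normr0.
have y0 s : y s 0 = x + s *: delta_mx k 0 by rewrite /y scale0r addr0.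
have df2 s : `|s| <= `|h| -> is_derive (x + s *: delta_mx k 0) (delta_mx k 0)
    f2 (partial k f (y s h) - partial k f (y s 0)).
  move=> sh; have [d1 _] := df s h sh (lexx _).
  have := df s 0 sh h0; rewrite y0 => -[d2 _].
  exact: is_deriveB (is_derive_translate d1) (derivableP d2).
have [s /df2 []//|s sh E] := @line_mvt f2 x (delta_mx k 0) h.
have [t th|t th E'] := @line_mvt (partial k f) (y s 0) (delta_mx l 0) h.
  by have [_] := df s t sh th; rewrite y0.
exists s, t; split => //.
have [_ D2] := df2 s sh; move: E; rewrite D2.
by move: E'; rewrite !y0 => ->; rewrite /f2/= /y !scale0r !addr0 => ->.
Qed.

(** The second difference of f on a small square of side h is h^2 times a
    value of either iterated derivative; by continuity both values are close
    to those at x. *)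
Lemma partial_comm f x (k l : 'I_n) :
  (\forall y \near x, derivable f y (delta_mx k 0)) ->
  (\forall y \near x, derivable f y (delta_mx l 0)) ->
  (\forall y \near x, derivable (partial k f) y (delta_mx l 0)) ->
  (\forall y \near x, derivable (partial l f) y (delta_mx k 0)) ->
  {for x, continuous (partial l (partial k f))} ->
  {for x, continuous (partial k (partial l f))} ->
  partial l (partial k f) x = partial k (partial l f) x.
Proof.
move=> dk dl dlk dkl clk ckl.
apply/eqP; rewrite -subr_eq0 -normr_eq0; apply/eqP/le_anti.
rewrite normr_ge0 andbT; apply/ler_addgt0Pl => e e0; rewrite addr0.
have e20 : 0 < e / 2 by rewrite divr_gt0.
move/cvgrPdist_lt/(_ _ e20) : clk => clk.
move/cvgrPdist_lt/(_ _ e20) : ckl => ckl.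
have [d /= d0 dB] := (@nbhs_ballP _ _ x _).1
  (filterI (filterI (filterI dk dl) (filterI dlk dkl)) (filterI clk ckl)).
pose h := d / 3.
have h0 : 0 < h by rewrite divr_gt0.
have yd s t (i j : 'I_n) : `|s| <= `|h| -> `|t| <= `|h| ->
    ball x d (x + s *: delta_mx i 0 + t *: delta_mx j 0).
  move=> sh th; rewrite -ball_normE /= -addrA opprD addNKr normrN.
  apply: le_lt_trans (ler_normD _ _) _; rewrite !normrZ.
  apply: (@le_lt_trans _ _ (`|h| + `|h|)).
    by apply: lerD; rewrite (le_trans (ler_piMr _ (norm_delta_le1 _)))//.
  by rewrite gtr0_norm// /h; lra.
have [s [t [sh th E1]]] := @second_difference f x k l h (fun s t sh th =>
  let: conj (conj (conj a b) (conj c d)) _ := dB _ (yd s t k l sh th)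
  in conj a c).
have [t' [s' [th' sh' E2]]] := @second_difference f x l k h (fun s t sh th =>
  let: conj (conj (conj a b) (conj c d)) _ := dB _ (yd s t l k sh th)
  in conj b d).
have [_ [/= A1 _]] := dB _ (yd s t k l sh th).
have [_ [_ /= A2]] := dB _ (yd t' s' l k th' sh').
have E : partial l (partial k f) (x + s *: delta_mx k 0 + t *: delta_mx l 0) =
  partial k (partial l f) (x + t' *: delta_mx l 0 + s' *: delta_mx k 0).
  apply: (mulfI (lt0r_neq0 h0)); apply: (mulfI (lt0r_neq0 h0)).
  apply: etrans (esym E1) _; apply: etrans E2; rewrite !scale0r !addr0.
  by rewrite (addrAC x (h *: delta_mx l 0)); ring.
move: A1 A2; rewrite E; move: (partial l (partial k f) x)
  (partial k (partial l f) x) (partial k (partial l f) (_ + _ + _)).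
move=> a b c ac bc; apply: ltW; rewrite [e]splitr.
by apply: le_lt_trans (ler_distD c a b) (ltrD ac _); rewrite distrC.
Qed.

Lemma cvg_sumr (T : Type) (F : set_system T) (I : Type) (r : seq I)
    (u : I -> T -> R) (l : I -> R) : Filter F ->
  (forall i, u i t @[t --> F] --> l i) ->
  \sum_(i <- r) u i t @[t --> F] --> \sum_(i <- r) l i.
Proof.
move=> FF ul; elim: r => [|i r IH].
  by under eq_fun do rewrite big_nil; rewrite big_nil; exact: cvg_cst.
under eq_fun do rewrite big_cons; rewrite big_cons.
by apply: cvgD; [exact: ul | exact: IH].
Qed.

(** The increment of f is estimated by [C1_increment]; as the difference
    quotients [q] of phi are bounded, the error is negligible with respect to
    h. *)
Lemma is_derive_comp_C1 (m : nat) (f : 'cV[R]_n -> R)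
    (phi : 'cV[R]_m -> 'cV[R]_n) (z u : 'cV[R]_m) (dphi : 'cV[R]_n) :
  (forall k, \forall y \near phi z, derivable f y (delta_mx k 0)) ->
  (forall k, {for phi z, continuous (partial k f)}) ->
  (forall k, is_derive z u (fun p => phi p k 0) (dphi k 0)) ->
  is_derive z u (f \o phi) (\sum_k dphi k 0 * partial k f (phi z)).
Proof.
move=> df cf dphiP.
pose q (h : R) k := h^-1 * (phi (h *: u + z) k 0 - phi z k 0).
have qcvg k : q^~ k @ 0^' --> dphi k 0.
  by have [cv <-] := dphiP k.
have qscvg : (fun h => \sum_k q h k * partial k f (phi z)) @ 0^' -->
    \sum_k dphi k 0 * partial k f (phi z).
  apply: (@cvg_sumr _ _ _ _ (fun k h => q h k * partial k f (phi z))) => k.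
  by apply: cvgMl; exact: qcvg.
have main : (fun h => h^-1 *: (f (phi (h *: u + z)) - f (phi z)) -
    \sum_k q h k * partial k f (phi z)) @ 0^' --> 0.
  apply/cvgr0Pnorm_le => e e0.
  pose C := \sum_k `|dphi k 0| + 1.
  have C0 : 0 < C by rewrite ltr_wpDl// sumr_ge0.
  have [d d0 dP] := C1_increment (divr_gt0 e0 C0) df cf.
  have Cq : \forall h \near (0 : R)^', \sum_k `|q h k| < C.
    have : (fun h => \sum_k `|q h k|) @ 0^' --> \sum_k `|dphi k 0|.
      apply: (@cvg_sumr _ _ _ _ (fun k h => `|q h k|)) => k.
      by apply: cvg_norm; exact: qcvg.
    by move=> /cvgr_lt; apply; rewrite ltrDl.
  have hd : \forall h \near (0 : R)^', `|h| < d / C.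
    apply/nbhs_dnbhs/nbhs_ballP; exists (d / C); first exact: divr_gt0.
    by move=> h; rewrite -ball_normE /= sub0r normrN.
  near=> h.
  have h0 : h != 0 by near: h; exact: nbhs_dnbhs_neq.
  have Ch : \sum_k `|q h k| < C by near: h.
  have hdC : `|h| < d / C by near: h.
  pose w := phi (h *: u + z) - phi z.
  have wE k : w k 0 = h * q h k by rewrite /q mulVKf// /w !mxE.
  have wS : \sum_k `|w k 0| = `|h| * \sum_k `|q h k|.
    by rewrite mulr_sumr; apply: eq_bigr => k _; rewrite wE normrM.
  have wd : \sum_k `|w k 0| < d.
    rewrite wS; apply: le_lt_trans (ler_wpM2l _ (ltW Ch)) _ => //.
    by rewrite -ltr_pdivlMr.
  have -> : h^-1 *: (f (phi (h *: u + z)) - f (phi z)) -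
      \sum_k q h k * partial k f (phi z) =
    h^-1 * (f (phi z + w) - f (phi z) - \sum_k w k 0 * partial k f (phi z)).
    rewrite [phi z + w]addrC subrK mulrBr; congr (_ - _).
    rewrite mulr_sumr; apply: eq_bigr => k _.
    by rewrite wE !mulrA mulVf// mul1r.
  rewrite normrM normfV; apply: le_trans (ler_wpM2l _ (dP _ wd)) _.
    by rewrite invr_ge0.
  rewrite wS mulrCA mulKf ?normr_eq0//.
  by rewrite -ler_pdivlMl ?divr_gt0// invf_div -mulrA mulVf ?lt0r_neq0// mulr1 ltW.
have lim : (fun h => h^-1 *: (f (phi (h *: u + z)) - f (phi z))) @ 0^' -->
    \sum_k dphi k 0 * partial k f (phi z).
  set S := fun h : R => _.
  rewrite (_ : S = fun h => (S h - \sum_k q h k * partial k f (phi z)) +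
    \sum_k q h k * partial k f (phi z)); last first.
    by apply/funext => h; rewrite subrK.
  by rewrite -[X in _ --> X]add0r; apply: cvgD.
apply: DeriveDef; last exact: (cvg_lim (@norm_hausdorff _ R^o) lim).
by apply/cvg_ex; exists (\sum_k dphi k 0 * partial k f (phi z)).
Unshelve. all: by end_near. Qed.

End Calculus.

(** * The algebra of smooth functions *)

Section SmoothAlgebra.
Variables (R : realType) (n : nat).
Implicit Types (f g : 'cV[R]_n -> R) (A : set 'cV[R]_n).

(** Differentiability up to order N, in a form suited to inductions on N: the
    first derivatives of a product, an inverse or a square root are sums and
    products of functions to which the induction hypothesis applies. *)
Fixpoint smooth_ord (N : nat) A f : Prop :=
  (forall x, A x -> {for x, continuous f}) /\
  if N is N'.+1 then forall k,
    (forall x, A x -> derivable f x (delta_mx k 0)) /\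
    smooth_ord N' A (partial k f)
  else True.

Lemma smooth_on_partial A f k : smooth_on A f -> smooth_on A (partial k f).
Proof. by move=> fs s x Ax; rewrite -foldr_rcons; exact: fs. Qed.

Lemma smooth_on_ordP A f : smooth_on A f <-> forall N, smooth_ord N A f.
Proof.
split=> [+ N|].
  elim: N f => [|N IH] f fs; split.
  - by move=> x Ax; have [] := fs [::] x Ax.
  - by [].
  - by move=> x Ax; have [] := fs [::] x Ax.
  - move=> k; split; last exact/IH/smooth_on_partial.
    by move=> x Ax; have [_] := fs [::] x Ax; exact.
move=> + s; elim/last_ind: s f => [|s k IH] f fs x Ax.
  have [fc fd] := fs 1%N; split; first exact: fc.
  by move=> k; have [fdk _] := fd k; exact: fdk.
rewrite foldr_rcons; apply: IH => // N.
by have [_ /(_ k) []] := fs N.+1.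
Qed.

Lemma smooth_ordW N A f : smooth_ord N.+1 A f -> smooth_ord N A f.
Proof.
elim: N f => [|N IH] f [fc fd]; split=> // k.
by have [fdk /IH] := fd k.
Qed.

Lemma open_near A f g x : open A -> A x -> {in A, f =1 g} ->
  \forall y \near x, f y = g y.
Proof.
move=> oA Ax fg; near=> y; apply: fg; rewrite inE; near: y.
exact: open_nbhs_nbhs.
Unshelve. all: by end_near. Qed.

Lemma near_eq_continuous f g x : (\forall y \near x, f y = g y) ->
  {for x, continuous f} -> {for x, continuous g}.
Proof.
move=> fg; rewrite /prop_for /continuous_at -(nbhs_singleton fg) => fc.
by move=> P /fc; apply: filterS2 fg => y /= ->.
Qed.

Lemma smooth_ord_eq N A f g : open A -> {in A, f =1 g} ->
  smooth_ord N A f -> smooth_ord N A g.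
Proof.
move=> oA; elim: N f g => [|N IH] f g fg [fc fd]; split=> //.
- by move=> x Ax; exact: near_eq_continuous (open_near oA Ax fg) (fc x Ax).
- by move=> x Ax; exact: near_eq_continuous (open_near oA Ax fg) (fc x Ax).
- move=> k; have [fdk fdp] := fd k; split.
    by move=> x Ax; apply: near_eq_derivable (open_near oA Ax fg) (fdk x Ax).
  apply: IH fdp => x /[!inE] Ax.
  exact: near_eq_derive (open_near oA Ax fg).
Qed.

Lemma smooth_ord_cst N A (c : R) : open A -> smooth_ord N A (fun=> c).
Proof.
move=> oA; elim: N c => [|N IH] c; split=> //.
- by move=> x _; exact: cst_continuous.
- by move=> x _; exact: cst_continuous.
- move=> k; split; first by move=> x _; exact: derivable_cst.
  by apply: smooth_ord_eq (IH 0) => // x _; rewrite /partial derive_cst.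
Qed.

Lemma smooth_ordD N A f g : open A -> smooth_ord N A f -> smooth_ord N A g ->
  smooth_ord N A (fun x => f x + g x).
Proof.
move=> oA; elim: N f g => [|N IH] f g [fc fd] [gc gd]; split=> //.
- by move=> x Ax; apply: continuousD; [exact: fc | exact: gc].
- by move=> x Ax; apply: continuousD; [exact: fc | exact: gc].
- move=> k; have [fdk fdp] := fd k; have [gdk gdp] := gd k; split.
    by move=> x Ax; apply: derivableD; [exact: fdk | exact: gdk].
  apply: smooth_ord_eq (IH _ _ fdp gdp) => // x /[!inE] Ax.
  by apply/esym; apply: deriveD; [exact: fdk | exact: gdk].
Qed.

Lemma smooth_ordM N A f g : open A -> smooth_ord N A f -> smooth_ord N A g ->
  smooth_ord N A (fun x => f x * g x).
Proof.
move=> oA; elim: N f g => [|N IH] f g.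
  move=> [fc fd] [gc gd]; split=> // x Ax.
  by apply: continuousM; [exact: fc | exact: gc].
move=> /[dup] /smooth_ordW fN [fc fd] /[dup] /smooth_ordW gN [gc gd]; split=> //.
  by move=> x Ax; apply: continuousM; [exact: fc | exact: gc].
move=> k; have [fdk fdp] := fd k; have [gdk gdp] := gd k; split.
  by move=> x Ax; apply: derivableM; [exact: fdk | exact: gdk].
apply: smooth_ord_eq (smooth_ordD oA (IH _ _ fN gdp) (IH _ _ gN fdp)) => //.
move=> x /[!inE] Ax; apply/esym.
by apply: deriveM; [exact: fdk | exact: gdk].
Qed.

Lemma smooth_ordV N A f : open A -> {in A, forall x, f x != 0} ->
  smooth_ord N A f -> smooth_ord N A (fun x => (f x)^-1).
Proof.
move=> oA f0; have {}f0 x : A x -> f x != 0 by move=> Ax; apply: f0; rewrite inE.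
elim: N => [|N IH].
  move=> [fc fd]; split=> // x Ax.
  by apply: continuousV; [exact: f0 | exact: fc].
move=> /[dup] /smooth_ordW fN [fc fd]; split=> //.
  by move=> x Ax; apply: continuousV; [exact: f0 | exact: fc].
move=> k; have [fdk fdp] := fd k; split.
  by move=> x Ax; apply: derivableV; [exact: f0 | exact: fdk].
have fV := IH fN.
apply: smooth_ord_eq (smooth_ordM oA (smooth_ord_cst N (-1) oA)
  (smooth_ordM oA (smooth_ordM oA fV fV) fdp)) => //.
move=> x /[!inE] Ax; apply/esym; apply: etrans (deriveV (f0 _ Ax) (fdk x Ax)) _.
by rewrite -[_ *: _]/(_ * _) expr2 invfM mulNr mulN1r.
Qed.

Lemma derive_lineE f x v : 'D_v f x = 'D_1 (fun h : R => f (h *: v + x)) 0.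
Proof.
rewrite /derive; set g1 := fun h => h^-1 *: _; set g2 := fun h => h^-1 *: _.
suff -> : g1 = g2 by []; apply/funext => h; rewrite /g1 /g2 /=.
by rewrite addr0 scale0r add0r [_%:A]mulr1.
Qed.

Lemma is_derive_sqrt f x (k : 'I_n) : 0 < f x -> derivable f x (delta_mx k 0) ->
  is_derive x (delta_mx k 0) (fun y => Num.sqrt (f y))
    (2^-1 * ((Num.sqrt (f x))^-1 * partial k f x)).
Proof.
move=> f0 /derivable1P fd.
have fd' := derivableP fd.
have sd : is_derive (f (0 *: delta_mx k 0 + x)) 1 (@Num.sqrt R)
    (2 * Num.sqrt (f (0 *: delta_mx k 0 + x)))^-1.
  by apply: is_derive1_sqrt; rewrite scale0r add0r.
have cd := @is_derive1_comp R (@Num.sqrt R) (fun h : R => f (h *: delta_mx k 0 + x))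
  0 _ _ sd fd'.
have [cd1 cd2] := cd.
apply: DeriveDef; first by apply/derivable1P.
rewrite derive_lineE; apply: etrans cd2 _.
by rewrite /partial derive_lineE scale0r add0r invfM -mulrA.
Qed.

Lemma smooth_ord_sqrt N A f : open A -> {in A, forall x, 0 < f x} ->
  smooth_ord N A f -> smooth_ord N A (fun x => Num.sqrt (f x)).
Proof.
move=> oA f0; have {}f0 x : A x -> 0 < f x by move=> Ax; apply: f0; rewrite inE.
have c0 : (forall x, A x -> {for x, continuous f}) ->
    forall x, A x -> {for x, continuous (fun x => Num.sqrt (f x))}.
  move=> fc x Ax; apply: continuous_comp; first exact: fc.
  exact: sqrt_continuous.
elim: N => [|N IH].
  by move=> [fc fd]; split=> //; exact: c0.
move=> /[dup] /smooth_ordW fN [fc fd]; split=> //; first exact: c0.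
move=> k; have [fdk fdp] := fd k.
have dS x (Ax : A x) := is_derive_sqrt (f0 x Ax) (fdk x Ax).
split; first by move=> x /dS [].
have sV : smooth_ord N A (fun x => (Num.sqrt (f x))^-1).
  apply: smooth_ordV => //; last exact: IH.
  by move=> x /[!inE] Ax; rewrite lt0r_neq0// sqrtr_gt0 f0.
apply: smooth_ord_eq (smooth_ordM oA (smooth_ord_cst N (2^-1) oA)
  (smooth_ordM oA sV fdp)) => //.
by move=> x /[!inE] /dS [_ +]; rewrite /partial => ->.
Qed.

End SmoothAlgebra.

(** * Calculus in a chart *)

Section ChartCalculus.
Variables (R : realType) (n : nat) (M : manifold R n) (i : chart M).
Implicit Types (U : set M) (f g : M -> R) (p q : M) (k l : 'I_n).

Lemma near_chart U p : open U -> U p -> cdom i p ->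
  \forall x \near cmap i p, U (cinv i x).
Proof.
move=> oU Up ip; have := cinv_continuous ip.
by rewrite /prop_for /continuous_at cmapK//; apply; exact: open_nbhs_nbhs.
Qed.

Lemma near_cmapK p : cdom i p -> \forall x \near cmap i p, cmap i (cinv i x) = x.
Proof.
move=> ip; have : nbhs (cmap i p) (cmap i @` cdom i).
  by apply: open_nbhs_nbhs; split; [exact: cimage_open | exists p].
by apply: filterS => _ [q iq <-]; rewrite cmapK.
Qed.

(** The image is locally the preimage of U under the continuous inverse of the
    chart. *)
Lemma chart_image_open U : open U -> open (cmap i @` (U `&` cdom i)).
Proof.
move=> oU; rewrite openE => _ [p [Up ip] <-]; rewrite /interior.
have oi := @cdom_open _ _ M i.
apply: filterS (filterI (near_cmapK ip) (filterI (near_chart oU Up ip)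
  (near_chart oi ip ip))) => x [xK [Ux ix]].
by exists (cinv i x).
Qed.

Definition derivable_at p f :=
  forall k, derivable (f \o cinv i) (cmap i p) (delta_mx k 0).

Lemma smooth_derivable_at U f p : smooth_in_chart i U f -> U p -> cdom i p ->
  derivable_at p f.
Proof.
move=> fs Up ip k; have [|_ d] := fs [::] (cmap i p); last exact: d.
by exists p.
Qed.

Lemma smooth_in_chart_sub U V f : V `<=` U -> smooth_in_chart i U f ->
  smooth_in_chart i V f.
Proof.
move=> VU fs s _ [q [Vq iq] <-]; apply: fs; exists q => //; split=> //.
exact: VU.
Qed.

Section SmoothOn.
Variable (U : set M).
Hypothesis oU : open U.
Let A := cmap i @` (U `&` cdom i).
Let oA : open A. Proof. exact: chart_image_open. Qed.

Lemma smooth_in_chart_eq f g : (forall q, U q -> cdom i q -> f q = g q) ->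
  smooth_in_chart i U f -> smooth_in_chart i U g.
Proof.
move=> fg /smooth_on_ordP fs; apply/smooth_on_ordP => N.
apply: smooth_ord_eq (fs N) => // x /[!inE] -[q [Uq iq] <-] /=.
by rewrite cmapK// fg.
Qed.

Lemma smooth_in_chart_cst (c : R) : smooth_in_chart i U (fun=> c).
Proof. by apply/smooth_on_ordP => N; exact: smooth_ord_cst. Qed.

Lemma smooth_in_chartD f g : smooth_in_chart i U f -> smooth_in_chart i U g ->
  smooth_in_chart i U (fun q => f q + g q).
Proof.
move=> /smooth_on_ordP fs /smooth_on_ordP gs; apply/smooth_on_ordP => N.
exact: smooth_ordD (fs N) (gs N).
Qed.

Lemma smooth_in_chartM f g : smooth_in_chart i U f -> smooth_in_chart i U g ->
  smooth_in_chart i U (fun q => f q * g q).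
Proof.
move=> /smooth_on_ordP fs /smooth_on_ordP gs; apply/smooth_on_ordP => N.
exact: smooth_ordM (fs N) (gs N).
Qed.

Lemma smooth_in_chartV f : (forall q, U q -> cdom i q -> f q != 0) ->
  smooth_in_chart i U f -> smooth_in_chart i U (fun q => (f q)^-1).
Proof.
move=> f0 /smooth_on_ordP fs; apply/smooth_on_ordP => N.
apply: smooth_ordV (fs N) => // x /[!inE] -[q [Uq iq] <-] /=.
by rewrite cmapK// f0.
Qed.

Lemma smooth_in_chart_sqrt f : (forall q, U q -> cdom i q -> 0 < f q) ->
  smooth_in_chart i U f -> smooth_in_chart i U (fun q => Num.sqrt (f q)).
Proof.
move=> f0 /smooth_on_ordP fs; apply/smooth_on_ordP => N.
apply: smooth_ord_sqrt (fs N) => // x /[!inE] -[q [Uq iq] <-] /=.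
by rewrite cmapK// f0.
Qed.

Lemma smooth_in_chart_sum (I : Type) (r : seq I) (P : pred I) (f : I -> M -> R) :
  (forall a, smooth_in_chart i U (f a)) ->
  smooth_in_chart i U (fun q => \sum_(a <- r | P a) f a q).
Proof.
move=> fs; elim: r => [|a r IH].
  by under eq_fun do rewrite big_nil; exact: smooth_in_chart_cst.
under eq_fun do rewrite big_cons; case: (P a); last exact: IH.
exact: (smooth_in_chartD (fs a) IH).
Qed.

Lemma smooth_in_chart_prod (I : Type) (r : seq I) (P : pred I) (f : I -> M -> R) :
  (forall a, smooth_in_chart i U (f a)) ->
  smooth_in_chart i U (fun q => \prod_(a <- r | P a) f a q).
Proof.
move=> fs; elim: r => [|a r IH].
  by under eq_fun do rewrite big_nil; exact: smooth_in_chart_cst.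
under eq_fun do rewrite big_cons; case: (P a); last exact: IH.
exact: (smooth_in_chartM (fs a) IH).
Qed.

Lemma smooth_in_chart_dcoord f k : smooth_in_chart i U f ->
  smooth_in_chart i U (dcoord i k f).
Proof.
move=> /(@smooth_on_partial _ _ _ _ k) /smooth_on_ordP fs.
apply/smooth_on_ordP => N; apply: smooth_ord_eq (fs N) => //.
by move=> x /[!inE] -[q [Uq iq] <-] /=; rewrite cmapK.
Qed.

Lemma smooth_mx_eq m1 m2 (F G : M -> 'M[R]_(m1, m2)) :
  (forall q, U q -> cdom i q -> F q = G q) ->
  smooth_mx_in_chart i U F -> smooth_mx_in_chart i U G.
Proof.
by move=> FG Fs a b; apply: smooth_in_chart_eq (Fs a b) => q Uq iq; rewrite FG.
Qed.

Lemma smooth_mx_cst m1 m2 (C : 'M[R]_(m1, m2)) : smooth_mx_in_chart i U (fun=> C).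
Proof. by move=> a b; exact: smooth_in_chart_cst. Qed.

Lemma smooth_mxD m1 m2 (F G : M -> 'M[R]_(m1, m2)) :
  smooth_mx_in_chart i U F -> smooth_mx_in_chart i U G ->
  smooth_mx_in_chart i U (fun q => F q + G q).
Proof.
move=> Fs Gs a b; under eq_fun do rewrite mxE.
exact: smooth_in_chartD (Fs a b) (Gs a b).
Qed.

Lemma smooth_mxM m1 m2 m3 (F : M -> 'M[R]_(m1, m2)) (G : M -> 'M[R]_(m2, m3)) :
  smooth_mx_in_chart i U F -> smooth_mx_in_chart i U G ->
  smooth_mx_in_chart i U (fun q => F q *m G q).
Proof.
move=> Fs Gs a b; under eq_fun do rewrite mxE.
apply: smooth_in_chart_sum => c.
exact: smooth_in_chartM (Fs a c) (Gs c b).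
Qed.

Lemma smooth_mxZ m1 m2 f (F : M -> 'M[R]_(m1, m2)) :
  smooth_in_chart i U f -> smooth_mx_in_chart i U F ->
  smooth_mx_in_chart i U (fun q => f q *: F q).
Proof.
move=> fs Fs a b; under eq_fun do rewrite mxE.
exact: smooth_in_chartM fs (Fs a b).
Qed.

Lemma smooth_mxN m1 m2 (F : M -> 'M[R]_(m1, m2)) :
  smooth_mx_in_chart i U F -> smooth_mx_in_chart i U (fun q => - F q).
Proof.
move=> Fs; under eq_fun do rewrite -scaleN1r.
exact: smooth_mxZ (smooth_in_chart_cst _) Fs.
Qed.

Lemma smooth_mxT m1 m2 (F : M -> 'M[R]_(m1, m2)) :
  smooth_mx_in_chart i U F -> smooth_mx_in_chart i U (fun q => (F q)^T).
Proof. by move=> Fs a b; under eq_fun do rewrite mxE; exact: Fs. Qed.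

Lemma smooth_mxtrace m (F : M -> 'M[R]_m) :
  smooth_mx_in_chart i U F -> smooth_in_chart i U (fun q => \tr (F q)).
Proof. by move=> Fs; apply: smooth_in_chart_sum => a; exact: Fs. Qed.

Lemma smooth_det m (F : M -> 'M[R]_m) :
  smooth_mx_in_chart i U F -> smooth_in_chart i U (fun q => \det (F q)).
Proof.
move=> Fs; apply: smooth_in_chart_sum => s; apply: smooth_in_chartM.
  exact: smooth_in_chart_cst.
by apply: smooth_in_chart_prod => a; exact: Fs.
Qed.

Lemma smooth_invmx m (F : M -> 'M[R]_m) :
  (forall q, U q -> cdom i q -> \det (F q) != 0) ->
  smooth_mx_in_chart i U F -> smooth_mx_in_chart i U (fun q => invmx (F q)).
Proof.
move=> F0 Fs; apply: (@smooth_mx_eq _ _ (fun q => (\det (F q))^-1 *: \adj (F q))).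
  by move=> q Uq iq; rewrite /invmx unitmxE unitfE F0.
apply: smooth_mxZ; first by apply: smooth_in_chartV => //; exact: smooth_det.
move=> a b; under eq_fun do rewrite mxE /cofactor.
apply: smooth_in_chartM; first exact: smooth_in_chart_cst.
apply: smooth_det => c d; under eq_fun do rewrite !mxE.
exact: Fs.
Qed.

End SmoothOn.

Section AtPoint.
Variable (p : M).
Hypothesis ip : cdom i p.

Lemma near_comp_chart U f g : open U -> U p ->
  (forall q, U q -> cdom i q -> f q = g q) ->
  \forall x \near cmap i p, (f \o cinv i) x = (g \o cinv i) x.
Proof.
move=> oU Up fg; have oi := @cdom_open _ _ M i.
apply: filterS (filterI (near_chart oU Up ip) (near_chart oi ip ip)) => x [Ux ix].
exact: fg.
Qed.

Lemma dcoord_eq U k f g : open U -> U p ->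
  (forall q, U q -> cdom i q -> f q = g q) -> dcoord i k f p = dcoord i k g p.
Proof. by move=> oU Up fg; exact: near_eq_derive (near_comp_chart oU Up fg). Qed.

Lemma dcoord_cst k (c : R) : dcoord i k (fun=> c) p = 0.
Proof. exact: derive_cst. Qed.

Lemma dcoordD k f g : derivable_at p f -> derivable_at p g ->
  dcoord i k (fun q => f q + g q) p = dcoord i k f p + dcoord i k g p.
Proof. by move=> fd gd; exact: deriveD (fd k) (gd k). Qed.

Lemma dcoordM k f g : derivable_at p f -> derivable_at p g ->
  dcoord i k (fun q => f q * g q) p = dcoord i k f p * g p + f p * dcoord i k g p.
Proof.
move=> fd gd; refine (etrans (deriveM (fd k) (gd k)) _); rewrite /= cmapK//.
by rewrite addrC; congr (_ + _); exact: mulrC.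
Qed.

Lemma derivable_at_cst (c : R) : derivable_at p (fun=> c).
Proof. by move=> k; exact: derivable_cst. Qed.

Lemma derivable_atD f g : derivable_at p f -> derivable_at p g ->
  derivable_at p (fun q => f q + g q).
Proof. by move=> fd gd k; exact: derivableD (fd k) (gd k). Qed.

Lemma derivable_atM f g : derivable_at p f -> derivable_at p g ->
  derivable_at p (fun q => f q * g q).
Proof. by move=> fd gd k; exact: derivableM (fd k) (gd k). Qed.

Lemma derivable_at_sum (I : Type) (r : seq I) (f : I -> M -> R) :
  (forall a, derivable_at p (f a)) ->
  derivable_at p (fun q => \sum_(a <- r) f a q).
Proof.
move=> fd; elim: r => [|a r IH].
  by under eq_fun do rewrite big_nil; exact: derivable_at_cst.
under eq_fun do rewrite big_cons; exact: (derivable_atD (fd a) IH).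
Qed.

Lemma dcoord_sum k (I : Type) (r : seq I) (f : I -> M -> R) :
  (forall a, derivable_at p (f a)) ->
  dcoord i k (fun q => \sum_(a <- r) f a q) p = \sum_(a <- r) dcoord i k (f a) p.
Proof.
move=> fd; elim: r => [|a r IH].
  by under eq_fun do rewrite big_nil; rewrite big_nil; exact: dcoord_cst.
under eq_fun do rewrite big_cons; rewrite big_cons -IH; apply: dcoordD => //.
exact: derivable_at_sum.
Qed.

Definition derivable_mx_at m1 m2 (F : M -> 'M[R]_(m1, m2)) :=
  forall a b, derivable_at p (fun q => F q a b).

Lemma smooth_derivable_mx_at U m1 m2 (F : M -> 'M[R]_(m1, m2)) :
  smooth_mx_in_chart i U F -> U p -> derivable_mx_at F.
Proof. by move=> Fs Up a b; exact: smooth_derivable_at (Fs a b) Up ip. Qed.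

Lemma dcoord_mx_eq U k m1 m2 (F G : M -> 'M[R]_(m1, m2)) : open U -> U p ->
  (forall q, U q -> cdom i q -> F q = G q) -> dcoord_mx i k F p = dcoord_mx i k G p.
Proof.
move=> oU Up FG; apply/matrixP => a b; rewrite !mxE.
by apply: dcoord_eq oU Up _ => q Uq iq; rewrite FG.
Qed.

Lemma dcoord_mx_cst k m1 m2 (C : 'M[R]_(m1, m2)) : dcoord_mx i k (fun=> C) p = 0.
Proof. by apply/matrixP => a b; rewrite !mxE dcoord_cst. Qed.

Lemma dcoord_mxD k m1 m2 (F G : M -> 'M[R]_(m1, m2)) :
  derivable_mx_at F -> derivable_mx_at G ->
  dcoord_mx i k (fun q => F q + G q) p = dcoord_mx i k F p + dcoord_mx i k G p.
Proof.
move=> Fd Gd; apply/matrixP => a b; rewrite !mxE -(dcoordD k (Fd a b) (Gd a b)).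
by congr (dcoord i k _ p); apply/funext => q; rewrite mxE.
Qed.

Lemma dcoord_mxM k m1 m2 m3 (F : M -> 'M[R]_(m1, m2)) (G : M -> 'M[R]_(m2, m3)) :
  derivable_mx_at F -> derivable_mx_at G ->
  dcoord_mx i k (fun q => F q *m G q) p =
    dcoord_mx i k F p *m G p + F p *m dcoord_mx i k G p.
Proof.
move=> Fd Gd; apply/matrixP => a b; rewrite !mxE -big_split /=.
under eq_fun do rewrite mxE; rewrite dcoord_sum => [|c]; last first.
  by apply: derivable_atM; [exact: Fd | exact: Gd].
by apply: eq_bigr => c _; rewrite !mxE dcoordM.
Qed.

Lemma dcoord_mxT k m1 m2 (F : M -> 'M[R]_(m1, m2)) :
  dcoord_mx i k (fun q => (F q)^T) p = (dcoord_mx i k F p)^T.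
Proof.
by apply/matrixP => a b; rewrite !mxE; under eq_fun do rewrite mxE.
Qed.

Lemma dcoord_trace k m (F : M -> 'M[R]_m) : derivable_mx_at F ->
  dcoord i k (fun q => \tr (F q)) p = \tr (dcoord_mx i k F p).
Proof.
move=> Fd; rewrite /mxtrace dcoord_sum => [|a]; last exact: Fd.
by apply: eq_bigr => a _; rewrite mxE.
Qed.

Lemma derivable_mx_atM m1 m2 m3 (F : M -> 'M[R]_(m1, m2)) (G : M -> 'M[R]_(m2, m3)) :
  derivable_mx_at F -> derivable_mx_at G -> derivable_mx_at (fun q => F q *m G q).
Proof.
move=> Fd Gd a b; under eq_fun do rewrite mxE.
by apply: derivable_at_sum => c; apply: derivable_atM; [exact: Fd | exact: Gd].
Qed.

Lemma derivable_mx_atT m1 m2 (F : M -> 'M[R]_(m1, m2)) :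
  derivable_mx_at F -> derivable_mx_at (fun q => (F q)^T).
Proof. by move=> Fd a b; under eq_fun do rewrite mxE; exact: Fd. Qed.

Lemma dcoord_comm U f k l : open U -> U p -> smooth_in_chart i U f ->
  dcoord i k (dcoord i l f) p = dcoord i l (dcoord i k f) p.
Proof.
move=> oU Up fs.
have E a b : dcoord i a (dcoord i b f) p =
    partial a (partial b (f \o cinv i)) (cmap i p).
  apply: near_eq_derive.
  by apply: filterS (near_cmapK ip) => x; rewrite /dcoord/= => ->.
rewrite !E; have Ap : (cmap i @` (U `&` cdom i)) (cmap i p) by exists p.
have nA : nbhs (cmap i p) (cmap i @` (U `&` cdom i)).
  by apply: open_nbhs_nbhs; split => //; exact: chart_image_open.
have D s a : \forall y \near cmap i p,
    derivable (foldr (@partial R n) (f \o cinv i) s) y (delta_mx a 0).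
  by apply: filterS nA => y Ay; exact: (fs s y Ay).2.
apply: partial_comm; [exact: D [::] _|exact: D [::] _|exact: D [:: l] _
  |exact: D [:: k] _|exact: (fs [:: k; l] _ Ap).1|exact: (fs [:: l; k] _ Ap).1].
Qed.

End AtPoint.
End ChartCalculus.

(** The chain rule for the transition maps. *)
Lemma jac_cocycle (R : realType) (n : nat) (M : manifold R n) (i j k : chart M)
    (p : M) : cdom i p -> cdom j p -> cdom k p ->
  jac j k p *m jac i j p = jac i k p.
Proof.
move=> ip jp kp; apply/matrixP => l m; rewrite !mxE.
have oj := @cdom_open _ _ M j; have ok := @cdom_open _ _ M k.
have Ap : (cmap j @` (cdom j `&` cdom k)) (cmap j p) by exists p.
have oA : open (cmap j @` (cdom j `&` cdom k)).
  by rewrite setIC; exact: chart_image_open.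
have nA := open_nbhs_nbhs (conj oA Ap).
have fs := @transition_smooth _ _ M j k l.
pose f y := cmap k (cinv j y) l 0; pose phi x := cmap j (cinv i x).
have phip : phi (cmap i p) = cmap j p by rewrite /phi cmapK.
have [] := @is_derive_comp_C1 R n n f phi (cmap i p) (delta_mx m 0)
  (\col_s dcoord i m (fun q => cmap j q s 0) p).
- by move=> s; rewrite phip; apply: filterS nA => y Ay; exact: (fs [::] y Ay).2.
- by move=> s; rewrite phip; exact: (fs [:: s] _ Ap).1.
- move=> s; rewrite mxE; apply: derivableP.
  have Bp : (cmap i @` (cdom i `&` cdom j)) (cmap i p) by exists p.
  exact: (@transition_smooth _ _ M i j s [::] _ Bp).2.
move=> _ E; apply: esym; apply: etrans (etrans E _).
  apply: near_eq_derive; apply: filterS (near_chart oj jp ip) => x jx.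
  by rewrite /f /phi /= cmapK.
by apply: eq_bigr => s _; rewrite !mxE phip mulrC.
Qed.

(** * Local admissible bases *)

Section Sections.
Variables (R : realType) (n : nat) (M : manifold R n) (U : set M).
Hypothesis oU : open U.
Implicit Types (S T : chart M -> M -> 'M[R]_n) (f : chart M -> M -> R).

Definition scalar_section f :=
  (forall i, smooth_in_chart i U (f i)) /\
  (forall i j p, U p -> cdom i p -> cdom j p -> f i p = f j p).

Lemma endo_sectionM S T : endo_section U S -> endo_section U T ->
  endo_section U (fun i p => S i p *m T i p).
Proof.
move=> [Ss Sc] [Ts Tc]; split=> [i|i j p Up ip jp]; first exact: smooth_mxM.
by rewrite mulmxA Sc// -mulmxA Tc// mulmxA.
Qed.

Lemma endo_sectionD S T : endo_section U S -> endo_section U T ->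
  endo_section U (fun i p => S i p + T i p).
Proof.
move=> [Ss Sc] [Ts Tc]; split=> [i|i j p Up ip jp]; first exact: smooth_mxD.
by rewrite mulmxDr Sc// Tc// mulmxDl.
Qed.

Lemma endo_sectionZ f S : scalar_section f -> endo_section U S ->
  endo_section U (fun i p => f i p *: S i p).
Proof.
move=> [fs fc] [Ss Sc]; split=> [i|i j p Up ip jp]; first exact: smooth_mxZ.
by rewrite -scalemxAr -scalemxAl Sc// (fc i j).
Qed.

Lemma scalar_section_cst (c : R) : scalar_section (fun _ _ => c).
Proof. by split=> // i; exact: smooth_in_chart_cst. Qed.

Lemma scalar_sectionM f g : scalar_section f -> scalar_section g ->
  scalar_section (fun i p => f i p * g i p).
Proof.
move=> [fs fc] [gs gc]; split=> [i|i j p Up ip jp]; first exact: smooth_in_chartM.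
by rewrite (fc i j)// (gc i j).
Qed.

Lemma scalar_sectionV_sqrt f : scalar_section f ->
  (forall i p, U p -> cdom i p -> 0 < f i p) ->
  scalar_section (fun i p => (Num.sqrt (f i p))^-1).
Proof.
move=> [fs fc] f0; split=> [i|i j p Up ip jp]; last by rewrite (fc i j).
apply: smooth_in_chartV => //.
  by move=> q Uq iq; rewrite lt0r_neq0// sqrtr_gt0 f0.
by apply: smooth_in_chart_sqrt => // q Uq iq; exact: f0.
Qed.

Lemma scalar_section_tr S : oriented_atlas M -> endo_section U S ->
  scalar_section (fun i p => \tr (S i p)).
Proof.
move=> oM [Ss Sc]; split=> [i|i j p Up ip jp]; first exact: smooth_mxtrace.
have ju : jac i j p \in unitmx by rewrite unitmxE unitfE lt0r_neq0// oM.
rewrite -[S i p](mulKmx ju) mxtrace_mulC Sc// -mulmxA mulmxV// mulmx1 //.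
Qed.

End Sections.

Section LocalBasis.
Variables (R : realType) (M : manifold R 4) (g : metric M).
Hypothesis oM : oriented_atlas M.

Lemma metric_pos_def i p : cdom i p -> pos_def (g i p).
Proof.
move=> ip; split; first exact: (Defs.metric_sym g ip).
by move=> x x0; exact: (metric_pos g ip x0).
Qed.

Variable i0 : chart M.
Let U := cdom i0.
Let oU : open U. Proof. exact: cdom_open. Qed.

(** The 2-form with constant matrix [w] in the chart [i0], read in the chart
    [j]. *)
Definition const_form (w : 'M[R]_4) (j : chart M) (q : M) : 'M[R]_4 :=
  (jac j i0 q)^T *m w *m jac j i0 q.

Lemma const_form_smooth w j : smooth_mx_in_chart j U (const_form w j).
Proof.
have js : smooth_mx_in_chart j U (jac j i0).
  move=> l k; under eq_fun do rewrite mxE.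
  apply: smooth_in_chart_dcoord => //.
  have := @transition_smooth _ _ M j i0 l.
  by rewrite /smooth_in_chart setIC.
exact: (smooth_mxM oU (smooth_mxM oU (smooth_mxT js) (smooth_mx_cst (i:=j) oU w)) js).
Qed.

Lemma const_form_skew w j q : w^T = - w -> (const_form w j q)^T = - const_form w j q.
Proof. by move=> ws; rewrite !trmx_mul trmxK ws mulmxA mulmxN mulNmx. Qed.

Lemma const_form_change w j k q : U q -> cdom j q -> cdom k q ->
  const_form w j q = (jac j k q)^T *m const_form w k q *m jac j k q.
Proof.
by move=> Uq jq kq; rewrite /const_form -(jac_cocycle jq kq Uq) !trmx_mul !mulmxA.
Qed.

Definition sd_section w (j : chart M) (q : M) := sd_endo (g j q) (const_form w j q).

Lemma metric_smooth_on j : smooth_mx_in_chart j U (g j).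
Proof.
move=> a b; apply: (@smooth_in_chart_sub _ _ _ _ setT) => //.
exact: (@metric_smooth _ _ _ g j).
Qed.

Lemma hodge_smooth j (W : M -> 'M[R]_4) : smooth_mx_in_chart j U W ->
  smooth_mx_in_chart j U (fun q => hodge (g j q) (W q)).
Proof.
move=> Ws; have gs : smooth_mx_in_chart j U (g j).
  exact: metric_smooth_on.
have gI : smooth_mx_in_chart j U (fun q => invmx (g j q)).
  apply: (smooth_invmx oU _ gs) => q Uq jq.
  by rewrite lt0r_neq0// pos_def_det//; exact: metric_pos_def.
have Ms : smooth_mx_in_chart j U (fun q => invmx (g j q) *m W q *m invmx (g j q)).
  exact: (smooth_mxM oU (smooth_mxM oU gI Ws) gI).
move=> a b; under eq_fun do rewrite mxE.
apply: (smooth_in_chartM oU).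
  apply: (smooth_in_chartM oU (smooth_in_chart_cst oU _)).
  apply: (smooth_in_chart_sqrt oU _ (smooth_det oU gs)) => q Uq jq.
  by apply: pos_def_det; exact: metric_pos_def.
apply: (smooth_in_chart_sum oU) => c; apply: (smooth_in_chart_sum oU) => d.
exact: (smooth_in_chartM oU (smooth_in_chart_cst oU _) (Ms c d)).
Qed.

(** The Hodge operator commutes with the Jacobians of the changes of charts
    because these have positive determinants. *)
Lemma sd_section_endo w : endo_section U (sd_section w).
Proof.
split=> [j|j k q Uq jq kq].
  have gs : smooth_mx_in_chart j U (g j).
    exact: metric_smooth_on.
  have ws : smooth_mx_in_chart j U (const_form w j) by exact: const_form_smooth.
  apply: (smooth_mxN oU); apply: (smooth_mxM oU _ (smooth_mxD oU ws (hodge_smooth ws))).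
  apply: (smooth_invmx oU _ gs) => q Uq jq.
  by rewrite lt0r_neq0// pos_def_det//; exact: metric_pos_def.
have A0 := oM jq kq; set A := jac j k q in A0.
have Au : A \in unitmx by rewrite unitmxE unitfE lt0r_neq0.
have ATu : A^T \in unitmx by rewrite unitmx_tr.
have Gu := pos_def_unit (metric_pos_def kq).
rewrite /sd_section /sd_endo /sd_proj (const_form_change w Uq jq kq).
rewrite (metric_change g jq kq) -/A hodge_cov// -mulmxDl -mulmxDr.
rewrite !invmx_mul ?unitmx_mul ?ATu// mulmxN mulNmx; congr (- _).
by rewrite !mulmxA mulmxV// mul1mx mulmxKV.
Qed.

(** The self-dual parts of dx_0 ^ dx_1 and dx_0 ^ dx_2 are linearly
    independent everywhere in a chart. On the fibre, -1/4 times the trace of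
    the product is the scalar product of imaginary quaternions;
    orthonormalizing the two sections with respect to it gives J_1 and J_2,
    whose product is J_3. *)
Lemma local_admissible_basis : exists J, admissible_basis g U J.
Proof.
pose e a : 'cV[R]_4 := delta_mx a 0.
pose w a := e o0 *m (e a)^T - e a *m (e o0)^T.
have ws a : (w a)^T = - w a by rewrite /w linearB /= !trmx_mul !trmxK opprB.
pose s1 := sd_section (w o1); pose s2 := sd_section (w o2).
have s1s : endo_section U s1 := sd_section_endo _.
have s2s : endo_section U s2 := sd_section_endo _.
have Qs a j q : U q -> cdom j q -> Qat (g j q) (sd_section (w a) j q).
  move=> Uq jq; apply: sd_endo_Qat; first exact: metric_pos_def.
  exact: const_form_skew.
(* A nontrivial combination of dx_0 ^ dx_1 and dx_0 ^ dx_2 is decomposable. *)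
have ind t j q : U q -> cdom j q -> s1 j q <> 0 /\ s2 j q + t *: s1 j q <> 0.
  move=> Uq jq; have Gp := metric_pos_def jq.
  have Bu : jac j i0 q \in unitmx by rewrite unitmxE unitfE lt0r_neq0// oM.
  have BTu : (jac j i0 q)^T \in unitmx by rewrite unitmx_tr.
  have dec (v : 'cV[R]_4) : const_form (e o0 *m v^T - v *m (e o0)^T) j q =
      ((jac j i0 q)^T *m e o0) *m ((jac j i0 q)^T *m v)^T
      - ((jac j i0 q)^T *m v) *m ((jac j i0 q)^T *m e o0)^T.
    by rewrite /const_form !trmx_mul !trmxK mulmxBr mulmxBl !mulmxA.
  have nz (v : 'cV[R]_4) : sd_endo (g j q)
      (const_form (e o0 *m v^T - v *m (e o0)^T) j q) = 0 ->
      e o0 *m v^T - v *m (e o0)^T = 0.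
    rewrite dec => /(sd_endo_eq0 Gp)/(sd_proj_decomposable Gp); rewrite -dec.
    move=> /(congr1 (fun X => invmx (jac j i0 q)^T *m X *m invmx (jac j i0 q))).
    by rewrite /const_form !mulmxA mulVmx// mul1mx mulmxK// mulmx0 mul0mx.
  split.
    move=> /nz /matrixP/(_ o0 o1).
    rewrite !mxE !big_ord1 !mxE /= => /eqP.
    by rewrite mulr1 mulr0 subr0 oner_eq0.
  rewrite /s1 /s2 /sd_section -sd_endoD.
  have -> : const_form (w o2) j q + t *: const_form (w o1) j q =
      const_form (e o0 *m (e o2 + t *: e o1)^T - (e o2 + t *: e o1) *m (e o0)^T) j q.
    have -> : e o0 *m (e o2 + t *: e o1)^T - (e o2 + t *: e o1) *m (e o0)^T
        = w o2 + t *: w o1.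
      by apply/matrixP => a b; rewrite !mxE !big_ord1 !mxE; ring.
    by rewrite /const_form mulmxDr mulmxDl -scalemxAr -scalemxAl.
  move=> /nz /matrixP/(_ o0 o2); rewrite !mxE !big_ord1 !mxE /= => E.
  have /eqP : 1 = 0 :> R by rewrite -[RHS]E; ring.
  by rewrite oner_eq0.
pose n1 i q := - 4^-1 * \tr (s1 i q *m s1 i q).
pose J0 i q := (Num.sqrt (n1 i q))^-1 *: s1 i q.
pose s2' i q := s2 i q + (4^-1 * \tr (s2 i q *m J0 i q)) *: J0 i q.
pose n2 i q := - 4^-1 * \tr (s2' i q *m s2' i q).
pose J1 i q := (Num.sqrt (n2 i q))^-1 *: s2' i q.
pose J (a : 'I_3) i q :=
  if a == 0 then J0 i q else if a == 1 then J1 i q else J0 i q *m J1 i q.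
have sq i q S : U q -> cdom i q -> Qat (g i q) S -> S <> 0 ->
    let n := - 4^-1 * \tr (S *m S) in 0 < n /\
    (Num.sqrt n)^-1 *: S *m ((Num.sqrt n)^-1 *: S) = - 1%:M.
  move=> Uq iq QS S0 n.
  have [c c0 [SS cS]] := Qat_sq (metric_pos_def iq) QS.
  have nc : n = c.
    by rewrite /n SS raddfN /= mxtrace_scalar -mulr_natl; field.
  have cp : 0 < c by rewrite lt0r c0 andbT; apply/eqP => /cS.
  rewrite nc; split=> //; rewrite -scalemxAl -scalemxAr scalerA SS.
  rewrite -invfM -expr2 sqr_sqrtr// scalerN scale_scalar_mx mulVf//.
  by rewrite lt0r_neq0.
have n1P i q : U q -> cdom i q -> 0 < n1 i q /\ J0 i q *m J0 i q = - 1%:M.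
  move=> Uq iq; exact: (sq i q _ Uq iq (Qs o1 i q Uq iq) (ind 0 i q Uq iq).1).
have QJ0 i q : U q -> cdom i q -> Qat (g i q) (J0 i q).
  move=> Uq iq; have := QatD (metric_pos_def iq) (Num.sqrt (n1 i q))^-1 0
    (Qs o1 i q Uq iq) (Qs o1 i q Uq iq).
  by rewrite scale0r addr0.
have Qs2' i q : U q -> cdom i q -> Qat (g i q) (s2' i q).
  move=> Uq iq; have := QatD (metric_pos_def iq) 1 (4^-1 * \tr (s2 i q *m J0 i q))
    (Qs o2 i q Uq iq) (QJ0 i q Uq iq).
  by rewrite scale1r.
have n2P i q : U q -> cdom i q -> 0 < n2 i q /\ J1 i q *m J1 i q = - 1%:M.
  move=> Uq iq; apply: (sq i q _ Uq iq (Qs2' i q Uq iq)).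
  by rewrite /s2' /J0 scalerA; exact: (ind _ i q Uq iq).2.
have QJ1 i q : U q -> cdom i q -> Qat (g i q) (J1 i q).
  move=> Uq iq; have := QatD (metric_pos_def iq) (Num.sqrt (n2 i q))^-1 0
    (Qs2' i q Uq iq) (Qs2' i q Uq iq).
  by rewrite scale0r addr0.
have anti i q : U q -> cdom i q -> J0 i q *m J1 i q + J1 i q *m J0 i q = 0.
  move=> Uq iq; have Gp := metric_pos_def iq.
  have [s E] := Qat_anticomm Gp (QJ0 i q Uq iq) (QJ1 i q Uq iq).
  suff s0 : s = 0 by rewrite E s0 -scalemx1 scale0r.
  have tJ : \tr (s2' i q *m J0 i q) = 0.
    have [_ JJ] := n1P i q Uq iq.
    rewrite /s2' mulmxDl -scalemxAl JJ mxtraceD mxtraceZ raddfN /= mxtrace1.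
    by field.
  have := congr1 mxtrace E.
  rewrite mxtraceD [\tr (J0 i q *m _)]mxtrace_mulC -mulr2n /J1 -scalemxAl.
  rewrite mxtraceZ tJ mulr0 mul0rn mxtrace_scalar => /esym/eqP.
  by rewrite mulrn_eq0 => /eqP.
have QJ a i q : U q -> cdom i q -> Qat (g i q) (J a i q).
  move=> Uq iq; rewrite /J; case: (a == 0); first exact: QJ0.
  case: (a == 1); first exact: QJ1.
  exact: (Qat_mul (metric_pos_def iq) (QJ0 i q Uq iq) (QJ1 i q Uq iq) (anti i q Uq iq)).
have tJ i q : U q -> cdom i q -> quaternionic_triple (fun a => J a i q).
  move=> Uq iq; have [_ JJ0] := n1P i q Uq iq; have [_ JJ1] := n2P i q Uq iq.
  have J10 : J1 i q *m J0 i q = - (J0 i q *m J1 i q).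
    by apply/eqP; rewrite -addr_eq0 addrC anti.
  split=> //; elim/ord3P => //; rewrite /J /=.
  rewrite mulmxA -(mulmxA (J0 i q)) J10 mulmxN mulNmx !mulmxA JJ0 mulNmx mul1mx.
  by rewrite mulNmx opprK JJ1.
exists J; split=> [a|i q Uq iq].
  have trs S : endo_section U S -> scalar_section U (fun i p => \tr (S i p)).
    exact: scalar_section_tr.
  have n1s : scalar_section U n1.
    exact: (scalar_sectionM oU (scalar_section_cst oU _)
      (trs _ (endo_sectionM oU s1s s1s))).
  have J0s : endo_section U J0.
    apply: (endo_sectionZ oU _ s1s); apply: (scalar_sectionV_sqrt oU n1s).
    by move=> i p Up ip; have [] := n1P i p Up ip.
  have s2's : endo_section U s2'.
    apply: (endo_sectionD oU s2s); apply: (endo_sectionZ oU _ J0s).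
    exact: (scalar_sectionM oU (scalar_section_cst oU _)
      (trs _ (endo_sectionM oU s2s J0s))).
  have n2s : scalar_section U n2.
    exact: (scalar_sectionM oU (scalar_section_cst oU _)
      (trs _ (endo_sectionM oU s2's s2's))).
  have J1s : endo_section U J1.
    apply: (endo_sectionZ oU _ s2's); apply: (scalar_sectionV_sqrt oU n2s).
    by move=> i p Up ip; have [] := n2P i p Up ip.
  rewrite /J; case: (a == 0); first exact: J0s.
  by case: (a == 1); [exact: J1s | exact: (endo_sectionM oU J0s J1s)].
have [sqJ J01 J10] := tJ i q Uq iq; split=> // A; split.
  by apply: (Qat_span (metric_pos_def iq) _ (tJ i q Uq iq)) => a; exact: QJ.
move=> [c ->]; apply: (big_ind (fun A => Qat (g i q) A)).
- have := QatD (metric_pos_def iq) 0 0 (QJ 0 i q Uq iq) (QJ 0 i q Uq iq).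
  by rewrite !scale0r addr0.
- move=> A' B' QA QB; have := QatD (metric_pos_def iq) 1 1 QA QB.
  by rewrite !scale1r.
- move=> a _; have := QatD (metric_pos_def iq) (c a) 0 (QJ a i q Uq iq) (QJ a i q Uq
  iq).
  by rewrite scale0r addr0.
Qed.

End LocalBasis.

(** * Connections in a chart *)

Section Directional.
Variables (R : realType) (n : nat) (M : manifold R n) (i : chart M).
Implicit Types (p q : M) (x y : 'cV[R]_n).

Definition dir_deriv m1 m2 (F : M -> 'M[R]_(m1, m2)) p x : 'M[R]_(m1, m2) :=
  \sum_k x k 0 *: dcoord_mx i k F p.

Section AtPoint.
Variable p : M.
Hypothesis ip : cdom i p.

Lemma dir_deriv_eq U m1 m2 (F G : M -> 'M[R]_(m1, m2)) x : open U -> U p ->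
  (forall q, U q -> cdom i q -> F q = G q) -> dir_deriv F p x = dir_deriv G p x.
Proof.
move=> oU Up FG; apply: eq_bigr => k _; congr (_ *: _).
exact: (dcoord_mx_eq ip k oU Up FG).
Qed.

Lemma dir_deriv_cst m1 m2 (C : 'M[R]_(m1, m2)) x : dir_deriv (fun=> C) p x = 0.
Proof. by rewrite /dir_deriv big1// => k _; rewrite dcoord_mx_cst scaler0. Qed.

Lemma dir_derivD m1 m2 (F G : M -> 'M[R]_(m1, m2)) x :
  derivable_mx_at i p F -> derivable_mx_at i p G ->
  dir_deriv (fun q => F q + G q) p x = dir_deriv F p x + dir_deriv G p x.
Proof.
move=> Fd Gd; rewrite -big_split; apply: eq_bigr => k _.
by rewrite (dcoord_mxD k Fd Gd) scalerDr.
Qed.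

Lemma dir_derivM m1 m2 m3 (F : M -> 'M[R]_(m1, m2)) (G : M -> 'M[R]_(m2, m3)) x :
  derivable_mx_at i p F -> derivable_mx_at i p G ->
  dir_deriv (fun q => F q *m G q) p x = dir_deriv F p x *m G p + F p *m dir_deriv G p x.
Proof.
move=> Fd Gd; rewrite /dir_deriv mulmx_suml mulmx_sumr -big_split.
apply: eq_bigr => k _.
by rewrite (dcoord_mxM ip k Fd Gd) scalerDr scalemxAl scalemxAr.
Qed.

Lemma dir_derivT m1 m2 (F : M -> 'M[R]_(m1, m2)) x :
  dir_deriv (fun q => (F q)^T) p x = (dir_deriv F p x)^T.
Proof.
rewrite [RHS]linear_sum; apply: eq_bigr => k _.
by rewrite dcoord_mxT linearZ.
Qed.

Lemma dir_deriv_tr m (F : M -> 'M[R]_m) x : derivable_mx_at i p F ->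
  dir_deriv (fun q => (\tr (F q))%:M : 'M[R]_1) p x = (\tr (dir_deriv F p x))%:M.
Proof.
move=> Fd; apply/matrixP => a b; rewrite !ord1 [RHS]mxE eqxx mulr1n.
rewrite [\tr _]linear_sum summxE; apply: eq_bigr => k _; rewrite !mxE linearZ /=.
congr (_ * _); rewrite -(dcoord_trace k Fd).
by congr dcoord; apply/funext => q; rewrite mxE eqxx mulr1n.
Qed.

Lemma dir_deriv_comm U (F : M -> 'M[R]_n) x y : open U -> U p ->
  smooth_mx_in_chart i U F ->
  dir_deriv (fun q => dir_deriv F q y) p x = dir_deriv (fun q => dir_deriv F q x) p y.
Proof.
move=> oU Up Fs; apply/matrixP => a b.
have ds k : smooth_in_chart i U (dcoord i k (fun q => F q a b)).
  exact: (smooth_in_chart_dcoord oU _ (Fs a b)).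
have E z w : dir_deriv (fun q => dir_deriv F q z) p w a b = \sum_k \sum_l w k 0 * z l
  0 *
    dcoord i k (dcoord i l (fun q => F q a b)) p.
  have FE : (fun q => dir_deriv F q z a b) =
      (fun q => \sum_l z l 0 * dcoord i l (fun q => F q a b) q).
    apply/funext => q; rewrite summxE.
    by apply: eq_bigr => l _; rewrite !mxE.
  rewrite summxE; apply: eq_bigr => k _; rewrite !mxE FE.
  have dl l := smooth_derivable_at (ds l) Up ip.
  rewrite dcoord_sum => [|l]; last first.
    by apply: derivable_atM; [exact: derivable_at_cst | exact: dl].
  rewrite mulr_sumr; apply: eq_bigr => l _.
  have cd : derivable_at i p (fun=> z l 0) by exact: derivable_at_cst.
  rewrite (dcoordM ip k cd (dl l)) dcoord_cst.
  by rewrite mul0r add0r mulrA.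
rewrite !E exchange_big; apply: eq_bigr => l _; apply: eq_bigr => k _.
by rewrite (dcoord_comm ip _ _ oU Up (Fs a b)) (mulrC (x _ _)).
Qed.

End AtPoint.
End Directional.

Section Connection.
Variables (R : realType) (n : nat) (M : manifold R n) (D : connection M).
Variable (i : chart M).
Implicit Types (p q : M) (x y z : 'cV[R]_n).

(** The connection matrix: the derivative of Y in the direction x is d_x Y +
    [christoffel x] Y. *)
Definition christoffel q x : 'M[R]_n := \sum_k x k 0 *: D i q k.

(** The covariant derivative of an endomorphism field that is given in one
    chart only. *)
Definition cov_mx (F : M -> 'M[R]_n) p x : 'M[R]_n :=
  dir_deriv i F p x + christoffel p x *m F p - F p *m christoffel p x.

Lemma cov_endoE S p x : cov_endo D i S p x = cov_mx (S i) p x.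
Proof.
rewrite /cov_mx /dir_deriv /christoffel mulmx_suml mulmx_sumr -big_split -sumrB.
by apply: eq_bigr => k _; rewrite scalerBr scalerDr scalemxAl scalemxAr.
Qed.

Lemma derivable_christoffel p x : cdom i p -> derivable_mx_at i p (christoffel^~ x).
Proof.
move=> ip a b; rewrite /christoffel.
have -> : (fun q => (\sum_k x k 0 *: D i q k) a b) =
    (fun q => \sum_k x k 0 * D i q k a b).
  by apply/funext => q; rewrite summxE; apply: eq_bigr => k _; rewrite mxE.
apply: derivable_at_sum => k; apply: derivable_atM; first exact: derivable_at_cst.
exact: (smooth_derivable_at (@connection_smooth _ _ _ D i k a b)).
Qed.

Section AtPoint.
Variable p : M.
Hypothesis ip : cdom i p.

Lemma cov_mxM F G x : derivable_mx_at i p F -> derivable_mx_at i p G ->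
  cov_mx (fun q => F q *m G q) p x = cov_mx F p x *m G p + F p *m cov_mx G p x.
Proof.
move=> Fd Gd; rewrite /cov_mx (dir_derivM ip x Fd Gd) !mulmxBl !mulmxBr !mulmxDl
  !mulmxDr.
rewrite !mulmxA; move: (dir_deriv i F p x *m G p) (F p *m dir_deriv i G p x).
move: (christoffel p x *m F p *m G p) (F p *m christoffel p x *m G p) (F p *m G p *m
  christoffel p x).
by move=> a b c d e; apply/matrixP => s t; rewrite !mxE; ring.
Qed.

Lemma cov_mxD F G x : derivable_mx_at i p F -> derivable_mx_at i p G ->
  cov_mx (fun q => F q + G q) p x = cov_mx F p x + cov_mx G p x.
Proof.
move=> Fd Gd; rewrite /cov_mx (dir_derivD x Fd Gd) mulmxDl mulmxDr.
by apply/matrixP => s t; rewrite !mxE; ring.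
Qed.

(** Homotheties commute with the connection matrix, so that only the
    derivative of the factor remains. *)
Lemma cov_mx_scalar U F (f : M -> R) x : open U -> U p ->
  (forall q, U q -> cdom i q -> F q = (f q)%:M) -> exists s : R, cov_mx F p x = s%:M.
Proof.
move=> oU Up Ff; rewrite /cov_mx (dir_deriv_eq ip x oU Up Ff) (Ff p)//.
rewrite mul_mx_scalar mul_scalar_mx addrK.
exists (\sum_k x k 0 * dcoord i k f p); rewrite -scalemx1 scaler_suml.
apply: eq_bigr => k _; rewrite -scalerA; congr (_ *: _).
apply/matrixP => a b; rewrite !mxE; have [<-|ab] := eqVneq a b.
  by rewrite mulr1; congr dcoord; apply/funext => q; rewrite mxE eqxx mulr1n.
rewrite mulr0 -[RHS](dcoord_cst i p k 0); congr dcoord.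
by apply/funext => q; rewrite mxE (negbTE ab).
Qed.

Lemma torsionE x y : torsion D i p x y = christoffel p x *m y - christoffel p y *m x.
Proof.
have covc z w : cov D i (fun=> z) (fun=> w) p = christoffel p z *m w.
  rewrite /cov /christoffel mulmx_suml; apply: eq_bigr => k _.
  by rewrite dcoord_mx_cst add0r scalemxAl.
rewrite /torsion /torsion_field !covc /bracket big1 ?subr0// => k _.
by rewrite !dcoord_mx_cst !scaler0 subr0.
Qed.

Lemma curvatureE x y : curvature D i p x y =
  dir_deriv i (christoffel^~ y) p x - dir_deriv i (christoffel^~ x) p y
  + (christoffel p x *m christoffel p y - christoffel p y *m christoffel p x).
Proof.
have covc z w : cov D i (fun=> z) (fun=> w) = fun q => christoffel q z *m w.
  apply/funext => q; rewrite /cov /christoffel mulmx_suml; apply: eq_bigr => k _.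
  by rewrite dcoord_mx_cst add0r scalemxAl.
have covcc u z w : cov D i (fun=> u) (cov D i (fun=> z) (fun=> w)) p =
    (dir_deriv i (christoffel^~ z) p u + christoffel p u *m christoffel p z) *m w.
  rewrite covc; transitivity (dir_deriv i (fun q => christoffel q z *m w) p u
      + christoffel p u *m (christoffel p z *m w)).
    have gu (v : 'cV[R]_n) : christoffel p u *m v = \sum_k u k 0 *: (D i p k *m v).
      by rewrite /christoffel mulmx_suml; apply: eq_bigr => k _; rewrite scalemxAl.
    rewrite gu /cov /dir_deriv -big_split; apply: eq_bigr => k _.
    by rewrite scalerDr.
  have dw : derivable_mx_at i p (fun=> w) by move=> a b; exact: derivable_at_cst.
  by rewrite (dir_derivM ip u (@derivable_christoffel p z ip) dw) dir_deriv_cst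
    mulmx0 addr0 mulmxDl mulmxA.
have br : bracket i (fun=> x) (fun=> y) = fun=> 0.
  apply/funext => q; rewrite /bracket big1// => k _.
  by rewrite !dcoord_mx_cst !scaler0 subr0.
apply/matrixP => l m; rewrite mxE /curvature_field !covcc br.
have -> : cov D i (fun=> 0) (fun=> delta_mx m 0) p = 0.
  by rewrite /cov big1// => k _; rewrite mxE scale0r.
rewrite subr0 -mulmxBl -colE [LHS]mxE.
move: (christoffel p x *m christoffel p y) (christoffel p y *m christoffel p x) => a b.
by rewrite !mxE; ring.
Qed.

End AtPoint.

Lemma curvature_bilinear p x y : cdom i p -> curvature D i p x y =
  \sum_k \sum_l (x k 0 * y l 0) *: curvature D i p (delta_mx k 0) (delta_mx l 0).
Proof.
move=> ip.
pose C k l := dcoord_mx i k (fun q => D i q l) p + D i p k *m D i p l.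
have d m1 m2 (F : M -> 'M[R]_(m1, m2)) k : dir_deriv i F p (delta_mx k 0) = dcoord_mx
  i k F p.
  rewrite /dir_deriv (bigD1 k)//= mxE !eqxx scale1r big1 ?addr0// => l lk.
  by rewrite mxE (negbTE lk) scale0r.
have ge q k : christoffel q (delta_mx k 0) = D i q k.
  rewrite /christoffel (bigD1 k)//= mxE !eqxx scale1r big1 ?addr0// => l lk.
  by rewrite mxE (negbTE lk) scale0r.
have dg z k : dcoord_mx i k (christoffel^~ z) p =
    \sum_l z l 0 *: dcoord_mx i k (fun q => D i q l) p.
  apply/matrixP => a b; rewrite summxE !mxE.
  have -> : (fun q => christoffel q z a b) = (fun q => \sum_l z l 0 * D i q l a b).
    by apply/funext => q; rewrite summxE; apply: eq_bigr => l _; rewrite mxE.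
  have dD l : derivable_at i p (fun q => D i q l a b).
    exact: (smooth_derivable_at (@connection_smooth _ _ _ D i l a b)).
  rewrite dcoord_sum => [|l]; last first.
    by apply: derivable_atM; [exact: derivable_at_cst | exact: dD].
  apply: eq_bigr => l _; rewrite !mxE.
  have cd : derivable_at i p (fun=> z l 0) by exact: derivable_at_cst.
  by rewrite (dcoordM ip k cd (dD l)) dcoord_cst mul0r add0r.
have CE z w : dir_deriv i (christoffel^~ w) p z + christoffel p z *m christoffel p w =
    \sum_k \sum_l (z k 0 * w l 0) *: C k l.
  rewrite [in X in _ + X]/christoffel mulmx_suml /dir_deriv -big_split;
    apply: eq_bigr => k _.
  rewrite dg mulmx_sumr scaler_sumr -big_split; apply: eq_bigr => l _.
  by rewrite /= -scalemxAl -scalemxAr !scalerA -scalerDr.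
have RE z w : curvature D i p z w =
    \sum_k \sum_l (z k 0 * w l 0) *: C k l - \sum_k \sum_l (w k 0 * z l 0) *: C k l.
  by rewrite curvatureE// -!CE; apply/matrixP => a b; rewrite !mxE; ring.
have REe k l : curvature D i p (delta_mx k 0) (delta_mx l 0) = C k l - C l k.
  rewrite curvatureE// !d !ge /C.
  have ee m : (fun q => christoffel q (delta_mx m 0)) = (fun q => D i q m).
    by apply/funext => q; rewrite ge.
  by rewrite !ee opprD addrACA.
rewrite RE [X in _ - X]exchange_big -sumrB; apply: eq_bigr => k _.
rewrite -sumrB; apply: eq_bigr => l _.
by rewrite REe scalerBr (mulrC (y l 0)).
Qed.

End Connection.

(** * The Levi-Civita connection *)

Section LeviCivita.
Variables (R : realType) (M : manifold R 4) (g : metric M) (D : connection M).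
Hypothesis lc : levi_civita g D.
Variable (i : chart M).
Implicit Types (p q : M) (x y z : 'cV[R]_4).
Local Notation Gam := (christoffel D i).

Let oi : open (cdom i). Proof. exact: cdom_open. Qed.

Lemma metric_derivable q : cdom i q -> derivable_mx_at i q (g i).
Proof. by move=> iq a b; exact: (smooth_derivable_at (@metric_smooth _ _ _ g i a b)).
  Qed.

Lemma lc_christoffel_sym q x y : cdom i q -> Gam q x *m y = Gam q y *m x.
Proof.
move=> iq; have [tor _] := lc iq.
by apply/eqP; rewrite -subr_eq0 -torsionE// tor.
Qed.

Lemma lc_dir_deriv_metric q x : cdom i q ->
  dir_deriv i (g i) q x = (Gam q x)^T *m g i q + g i q *m Gam q x.
Proof.
move=> iq; have [_ met] := lc iq.
rewrite /christoffel linear_sum mulmx_suml mulmx_sumr -big_split; apply: eq_bigr => k _.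
rewrite linearZ /= -scalemxAl -scalemxAr -scalerDr; congr (_ *: _).
by apply/eqP; rewrite -subr_eq0 opprD addrA met.
Qed.

(** The second derivatives of g commute; replacing the first ones by their
    expressions in terms of the connection matrix turns this into the claim.
    *)
Lemma curvature_skew p x y : cdom i p ->
  (curvature D i p x y)^T *m g i p = - (g i p *m curvature D i p x y).
Proof.
move=> ip; have [gs _] := metric_pos_def g ip.
have dG u w : dir_deriv i (fun q => dir_deriv i (g i) q w) p u =
    (dir_deriv i (Gam^~ w) p u)^T *m g i p + (Gam p w)^T *m dir_deriv i (g i) p u
    + (dir_deriv i (g i) p u *m Gam p w + g i p *m dir_deriv i (Gam^~ w) p u).
  have dg := @derivable_christoffel _ _ _ D i p w ip; have dm := metric_derivable ip.
  rewrite (@dir_deriv_eq _ _ _ _ _ ip (cdom i) _ _ _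
    (fun q => (Gam q w)^T *m g i q + g i q *m Gam q w) _ oi ip); last first.
    by move=> q _ iq; exact: lc_dir_deriv_metric.
  have dgT := derivable_mx_atT dg.
  rewrite (dir_derivD u (derivable_mx_atM dgT dm) (derivable_mx_atM dm dg)).
  by rewrite (dir_derivM ip u dgT dm) (dir_derivM ip u dm dg) dir_derivT.
have smo : smooth_mx_in_chart i setT (g i) by exact: (@metric_smooth _ _ _ g i).
have := @dir_deriv_comm _ _ _ i p ip setT (g i) x y openT I smo.
rewrite !dG (lc_dir_deriv_metric x ip) (lc_dir_deriv_metric y ip) (curvatureE D ip x y).
move: (dir_deriv i (Gam^~ y) p x) (dir_deriv i (Gam^~ x) p y) (Gam p x) (Gam p y) =>
  A B X Y.
have tD (P Q : 'M[R]_4) : (P + Q)^T = P^T + Q^T by exact: linearD.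
have tN (P : 'M[R]_4) : (- P)^T = - P^T by exact: linearN.
rewrite !(tD, tN, trmx_mul) !(mulmxDl, mulmxDr, mulNmx, mulmxN) !mulmxA.
move: (A^T *m _) (B^T *m _) (Y^T *m X^T *m _) (X^T *m Y^T *m _) (Y^T *m _ *m X)
  (X^T *m _ *m Y) (_ *m X *m Y) (_ *m Y *m X) (_ *m A) (_ *m B).
move=> a1 b1 a2 b2 a3 a4 a5 b5 a6 b6 /matrixP E.
by apply/matrixP => k l; have := E k l; rewrite !mxE; lra.
Qed.

(** The derivatives of the connection matrix cancel in pairs by its symmetry,
    and so do the products. *)
Lemma first_bianchi p x y z : cdom i p ->
  curvature D i p x y *m z + curvature D i p y z *m x + curvature D i p z x *m y = 0.
Proof.
move=> ip.
have dsym u v w : dir_deriv i (Gam^~ v) p u *m w = dir_deriv i (Gam^~ w) p u *m v.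
  have E v' w' : dir_deriv i (Gam^~ v') p u *m w' = dir_deriv i (fun q => Gam q v' *m
    w') p u.
    have dw : derivable_mx_at i p (fun=> w') by move=> a b; exact: derivable_at_cst.
    by rewrite (dir_derivM ip u (@derivable_christoffel _ _ _ D i p v' ip) dw)
      dir_deriv_cst mulmx0 addr0.
  rewrite !E; apply: (dir_deriv_eq ip u oi ip) => q _ iq.
  exact: lc_christoffel_sym.
rewrite !(curvatureE D ip) !mulmxDl !mulNmx.
rewrite (dsym x z y) (dsym y x z) (dsym z y x) -!mulmxA.
rewrite (lc_christoffel_sym y z ip) (lc_christoffel_sym z x ip) (lc_christoffel_sym x
  y ip).
by apply/matrixP => a b; rewrite !mxE; ring.
Qed.

Definition coord_curvature p (a b : 'I_4) :=
  curvature D i p (delta_mx a 0) (delta_mx b 0).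

Lemma lc_curvature_like p : cdom i p -> curvature_like (g i p) (coord_curvature p).
Proof.
move=> ip; split=> [a b|a b|a b c k].
- rewrite /coord_curvature !(curvatureE D ip).
  by rewrite opprD !opprB.
- exact: curvature_skew.
- have E (A : 'M[R]_4) s : (A *m delta_mx s (0 : 'I_1)) k 0 = A k s.
    by rewrite -colE mxE.
  have aE (A B : 'cV[R]_4) : (A + B) k 0 = A k 0 + B k 0 by rewrite mxE.
  have := congr1 (fun X : 'cV[R]_4 => X k 0) (first_bianchi (delta_mx a 0)
    (delta_mx b 0) (delta_mx c 0) ip).
  by rewrite !aE !E [RHS]mxE.
Qed.

End LeviCivita.

Section RicciForm.
Variables (R : realType) (M : manifold R 4) (D : connection M) (i : chart M).

Lemma ricci_formE p J x y : cdom i p ->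
  ricci_form D i p J x y = (x^T *m ricci_mx (coord_curvature D i p) J *m y) 0 0.
Proof.
move=> ip; rewrite /ricci_form (curvature_bilinear D x y ip).
rewrite mulmx_sumr linear_sum mulr_sumr mxE.
under [RHS]eq_bigr do rewrite mxE mulr_suml.
rewrite [RHS]exchange_big; apply: eq_bigr => k _.
rewrite mulmx_sumr linear_sum mulr_sumr; apply: eq_bigr => l _.
by rewrite !mxE -scalemxAr linearZ /= /coord_curvature; ring.
Qed.

Lemma curvature_condition_at p (J : 'I_3 -> 'M[R]_4) : cdom i p ->
  (forall (a : 'I_3) (x y : 'cV[R]_4),
      let rho_a := ricci_form D i p (J a) in
      let rho_b := ricci_form D i p (J (a + 1)) in
      let Jc := J (a + 2%:R) in
      rho_a (Jc *m x) (Jc *m y) - rho_a x y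
      + rho_b (Jc *m x) y + rho_b x (Jc *m y) = 0) <->
  (forall a, quat_bianchi (coord_curvature D i p) J a = 0).
Proof.
move=> ip.
have E a x y : let rho_a := ricci_form D i p (J a) in
      let rho_b := ricci_form D i p (J (a + 1)) in
      let Jc := J (a + 2%:R) in
      rho_a (Jc *m x) (Jc *m y) - rho_a x y
      + rho_b (Jc *m x) y + rho_b x (Jc *m y)
    = (x^T *m quat_bianchi (coord_curvature D i p) J a *m y) 0 0.
  rewrite /= !ricci_formE// /quat_bianchi !(mulmxDr, mulmxDl) mulmxN mulNmx.
  have aE (A B : 'M[R]_1) : (A + B) 0 0 = A 0 0 + B 0 0 by rewrite mxE.
  have nE (A : 'M[R]_1) : (- A) 0 0 = - A 0 0 by rewrite mxE.
  by rewrite !trmx_mul !mulmxA !(aE, nE).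
split=> H a => [|x y].
  apply/matrixP => k l.
  have en (A : 'M[R]_4) :
      ((delta_mx k (0 : 'I_1))^T *m A *m delta_mx l (0 : 'I_1)) 0 0 = A k l.
    by rewrite trmx_delta -rowE -colE !mxE.
  have := etrans (esym (E a (delta_mx k 0) (delta_mx l 0))) (H a _ _).
  by rewrite en => ->; rewrite mxE.
by apply: etrans (E a x y) _; rewrite H mulmx0 mul0mx mxE.
Qed.

End RicciForm.

Section LCQuaternionic.
Variables (R : realType) (M : manifold R 4) (g : metric M) (D : connection M).
Hypotheses (oM : oriented_atlas M) (lc : levi_civita g D).

(** This is the derivative of the equation expressing the skewness, by the
    compatibility of the metric with the connection. *)
Lemma lc_cov_mx_skew i p U (S : M -> 'M[R]_4) x : open U -> U p -> cdom i p ->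
  smooth_mx_in_chart i U S ->
  (forall q, U q -> cdom i q -> (S q)^T *m g i q = - (g i q *m S q)) ->
  (cov_mx D i S p x)^T *m g i p + g i p *m cov_mx D i S p x = 0.
Proof.
move=> oU Up ip Ss Sk.
have dS := smooth_derivable_mx_at ip Ss Up; have dST := derivable_mx_atT dS.
have dG := @metric_derivable _ M g i p ip.
have E : dir_deriv i (fun q => (S q)^T *m g i q + g i q *m S q) p x = 0.
  rewrite -(dir_deriv_cst i p (0 : 'M[R]_4) x);
    apply: (dir_deriv_eq ip x oU Up) => q Uq iq.
  by rewrite Sk// addNr.
move: E; rewrite (dir_derivD x (derivable_mx_atM dST dG) (derivable_mx_atM dG dS)).
rewrite (dir_derivM ip x dST dG) (dir_derivM ip x dG dS) dir_derivT
  (lc_dir_deriv_metric lc x ip).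
have := Sk p Up ip; rewrite /cov_mx.
move: (dir_deriv i S p x) (christoffel D i p x) (S p) (g i p) => N X P G SG.
have tD (A B : 'M[R]_4) : (A + B)^T = A^T + B^T by exact: linearD.
have tN (A : 'M[R]_4) : (- A)^T = - A^T by exact: linearN.
have e1 : P^T *m G *m X = - (G *m P *m X) by rewrite SG mulNmx.
have e2 : X^T *m P^T *m G = - (X^T *m G *m P).
  by rewrite -mulmxA SG mulmxN mulmxA.
rewrite !(tD, tN, trmx_mul) !(mulmxDl, mulmxDr, mulNmx, mulmxN) !mulmxA e1 e2.
move: (N^T *m _) (P^T *m X^T *m _) (G *m P *m X) (X^T *m _ *m P) (G *m X *m P)
  (G *m N) => n1 a b c d n2 /matrixP E.
by apply/matrixP => k l; have := E k l; rewrite !mxE; lra.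
Qed.

(** Let J be a local section with J^2 = -1. Its derivative is skew and
    anticommutes with J, hence lies in the fibre. For any section S the field
    S J + J S is scalar, and so is its derivative; removing the terms where J
    is differentiated, which are scalar too, shows that the derivative of S
    has a scalar anticommutator with J. *)
Lemma lc_quaternionic : quaternionic_connection g D.
Proof.
move=> U S oU [Ss Sc] QS i p x Up ip.
rewrite cov_endoE.
have Gp := metric_pos_def g ip; have [Gs _] := Gp.
have [J [Js JP]] := local_admissible_basis g oM i.
have oi := @cdom_open _ _ M i.
have QJ0 q : cdom i q -> Qat (g i q) (J 0 i q).
  move=> iq; have [_ _ _ sp] := JP i q iq iq; apply/sp.
  exists (fun a => (a == 0)%:R); rewrite (bigD1 0)//= scale1r big1 ?addr0// => a.
  by move=> /negbTE ->; rewrite scale0r.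
have sq q : cdom i q -> J 0 i q *m J 0 i q = - 1%:M.
  by move=> iq; have [s _ _ _] := JP i q iq iq.
have dJ := smooth_derivable_mx_at ip ((Js 0).1 i) ip.
have dS := smooth_derivable_mx_at ip (Ss i) Up.
have skJ : (cov_mx D i (J 0 i) p x)^T *m g i p + g i p *m cov_mx D i (J 0 i) p x = 0.
  apply: (lc_cov_mx_skew x oi ip ip ((Js 0).1 i)) => q _ iq.
  by apply: Qat_skew; [exact: (Defs.metric_sym g iq) | exact: QJ0].
have QNJ : Qat (g i p) (cov_mx D i (J 0 i) p x).
  apply: (Qat_of_anticomm Gp skJ (QJ0 p ip) (sq p ip) (s := 0)).
  rewrite -(cov_mxM D ip x dJ dJ) /cov_mx.
  rewrite (@dir_deriv_eq _ _ _ _ _ ip _ _ _ _ (fun=> - 1%:M) x oi ip); last first.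
    by move=> q _ iq; exact: sq.
  by rewrite dir_deriv_cst add0r sq// mulmxN mulNmx mulmx1 mul1mx subrr -scalemx1
    scale0r.
have skS : (cov_mx D i (S i) p x)^T *m g i p + g i p *m cov_mx D i (S i) p x = 0.
  apply: (lc_cov_mx_skew x oU Up ip (Ss i)) => q Uq iq.
  by apply: Qat_skew; [exact: (Defs.metric_sym g iq) | exact: QS].
pose V := U `&` cdom i; have oV : open V by exact: openI.
have [s sE] : exists s : R, cov_mx D i (fun q => S i q *m J 0 i q + J 0 i q *m S i q)
  p x = s%:M.
  have Vs q : V q -> exists s : R, S i q *m J 0 i q + J 0 i q *m S i q = s%:M.
    move=> [Uq iq]; apply: (Qat_anticomm (metric_pos_def g iq));
      [exact: QS | exact: QJ0].
  have /choice[f fE] q : exists s : R, V q ->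
    S i q *m J 0 i q + J 0 i q *m S i q = s%:M.
    have [/Vs [s E]|nV] := pselect (V q); first by exists s.
    by exists 0.
  by apply: (cov_mx_scalar D ip x oV (conj Up ip) (f := f)) => q Vq _; exact: fE.
have [t tE] := Qat_anticomm Gp QNJ (QS i p Up ip).
apply: (Qat_of_anticomm Gp skS (QJ0 p ip) (sq p ip) (s := s - t)).
have E : cov_mx D i (fun q => S i q *m J 0 i q + J 0 i q *m S i q) p x =
    cov_mx D i (S i) p x *m J 0 i p + J 0 i p *m cov_mx D i (S i) p x
    + (cov_mx D i (J 0 i) p x *m S i p + S i p *m cov_mx D i (J 0 i) p x).
  rewrite (cov_mxD D x (derivable_mx_atM dS dJ) (derivable_mx_atM dJ dS)).
  rewrite (cov_mxM D ip x dS dJ) (cov_mxM D ip x dJ dS).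
  by rewrite addrACA [RHS]addrACA; congr (_ + _); rewrite addrC.
have -> : (s - t)%:M = s%:M - t%:M :> 'M[R]_4 by exact: raddfB.
by rewrite -sE E tE addrK.
Qed.

End LCQuaternionic.

(** * Endomorphisms normalizing the quaternionic structure *)

Section TripleAlgebra.
Variables (R : realType) (G : 'M[R]_4) (J : 'I_3 -> 'M[R]_4).
Hypotheses (Gp : pos_def G) (QJ : forall a, Qat G (J a)).
Hypothesis (tJ : quaternionic_triple J).

Lemma Qat_tr_eq0 N : Qat G N -> (forall a, \tr (J a *m N) = 0) -> N = 0.
Proof.
move=> QN tN; have [c NE] := Qat_span Gp QJ tJ QN.
rewrite NE big1// => a _; have := tN a.
rewrite NE mulmx_sumr linear_sum (bigD1 a)//= big1 => [|b ba].
  rewrite -scalemxAr linearZ /= (tr_triple _ _ tJ) eqxx mulr1 addr0 => E.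
  have -> : c a = 0 by lra.
  by rewrite scale0r.
by rewrite -scalemxAr linearZ /= (tr_triple _ _ tJ) eq_sym (negbTE ba) !mulr0.
Qed.

(** If A normalizes the span of the triple, it is the sum of the alpha_a J_a
    and of an endomorphism commuting with the triple. *)
Definition alpha (A : 'M[R]_4) a : R := - 4^-1 * \tr (J a *m A).

(** Both sides lie in the fibre, where an element is determined by its traces
    with the J_b. *)
Lemma triple_normalizer A a :
  (forall b, Qat G (A *m J b - J b *m A)) ->
  J a *m A - A *m J a =
    2 *: (alpha A (a + 1) *: J (a + 2%:R) - alpha A (a + 2%:R) *: J (a + 1)).
Proof.
move=> nA; apply/eqP; rewrite -subr_eq0; apply/eqP.
apply: Qat_tr_eq0 => [|b].
  apply: (QatB Gp); first by rewrite -opprB -scaleN1r; exact: (QatZ Gp).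
  by apply: (QatZ Gp); apply: (QatB Gp); exact: (QatZ Gp).
have [Jab Jba] := triple_mul a tJ.
rewrite mulmxBr mulmxBr raddfB /= raddfB /= -scalemxAr mulmxBr -!scalemxAr.
rewrite mxtraceZ raddfB /= !mxtraceZ !(tr_triple _ _ tJ).
rewrite !mulmxA [\tr (J b *m A *m J a)]mxtrace_mulC mulmxA -raddfB -mulmxBl /=.
have n1 : (a + 1 == a) = false by elim/ord3P: a {nA Jab Jba}.
have n2 : (a + 2%:R == a) = false by elim/ord3P: a {nA Jab Jba n1}.
have n3 : (a + 2%:R == a + 1) = false by elim/ord3P: a {nA Jab Jba n1 n2}.
have [->|->|->] := ord3_cases a b.
- rewrite subrr mul0mx linear0 (eq_sym a (a + 1)) (eq_sym a (a + 2%:R)) n1 n2.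
  by rewrite /=; ring.
- rewrite Jab Jba -opprD mulNmx raddfN /= mulmxDl mxtraceD eqxx.
  rewrite (eq_sym (a + 1) (a + 2%:R)) n3 /alpha /=.
  by field.
- have [-> -> _ _] := triple_table a tJ.
  rewrite opprK addrC mulmxDl mxtraceD eqxx n3 /alpha /=.
  by field.
Qed.

Lemma Qat_isotropic N (x : 'cV[R]_4) : Qat G N -> (x^T *m G *m (N *m x)) 0 0 = 0.
Proof.
move=> QN; have [Gs _] := Gp; have sk := Qat_skew Gs QN.
have E : (x^T *m G *m (N *m x))^T = - (x^T *m G *m (N *m x)).
  by rewrite !trmx_mul trmxK Gs !mulmxA -(mulmxA x^T N^T G) sk mulmxN mulNmx !mulmxA.
by have /matrixP/(_ 0 0) := E; rewrite mxE [RHS]mxE; lra.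
Qed.

(** With C_z = [J_a, A_z], the vanishing of the (0,2)-part says that C(J_a z)
    y + C(z) (J_a y) is symmetric in z and y. Take z = x and y = J_b x, and
    the scalar product with x: as x is orthogonal to every J x, only the two
    coefficients of x survive. *)
Lemma torsion_alpha (A : 'cV[R]_4 -> 'M[R]_4) a : A 0 = 0 ->
  (forall x b, Qat G (A x *m J b - J b *m A x)) ->
  (forall x y, part02 (J a) (fun x y => A x *m y - A y *m x) x y = 0) ->
  forall x, alpha (A x) (a + 1) = alpha (A (J a *m x)) (a + 2%:R).
Proof.
move=> A0 nA tor x; set b := a + 1; set c := a + 2%:R.
have [sq _ _] := tJ.
have [x0|x0] := eqVneq x 0.
  by rewrite x0 mulmx0 A0 /alpha !mulmx0 linear0 !mulr0.
pose C z := J a *m A z - A z *m J a.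
have CE z : C z = 2 *: (alpha (A z) b *: J c - alpha (A z) c *: J b).
  exact: triple_normalizer.
have sym z y : C (J a *m z) *m y + C z *m (J a *m y)
    = C (J a *m y) *m z + C y *m (J a *m z).
  have := tor z y; rewrite /part02 => /eqP; rewrite scaler_eq0 invr_eq0 pnatr_eq0 /=.
  move=> /eqP E; apply/eqP; rewrite -subr_eq0 -oppr_eq0 -[X in _ == X]E /C.
  rewrite !(mulmxBl, mulmxBr) !mulmxA -!(mulmxA _ (J a) (J a)) !sq.
  rewrite !(mulmxN, mulNmx) !mulmx1.
  by apply/eqP/matrixP => s t; rewrite !mxE; ring.
have [Jca Jac Jbc Jcb] := triple_table a tJ; have [Jab Jba] := triple_mul a tJ.
have comb p q (N1 N2 N : 'M[R]_4) (v : 'cV[R]_4) :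
    2 *: (p *: N1 - q *: N2) *m N *m v = 2 *: (p *: (N1 *m N *m v) - q *: (N2 *m N *m
      v)).
  by rewrite -!scalemxAl !mulmxBl -!scalemxAl.
have := sym x (J b *m x).
have -> : C (J a *m x) *m (J b *m x) = 2 *: (alpha (A (J a *m x)) c *: x
    - alpha (A (J a *m x)) b *: (J a *m x)).
  by rewrite mulmxA CE comb Jcb sq !mulNmx mul1mx !scalerN opprK addrC.
have -> : C x *m (J a *m (J b *m x)) = - 2 *: (alpha (A x) b *: x
    + alpha (A x) c *: (J a *m x)).
  rewrite !mulmxA -(mulmxA (C x)) Jab CE comb sq Jbc mulNmx mul1mx.
  by rewrite scaleNr scalerN -opprD scalerN.
have -> : C (J a *m (J b *m x)) *m x = 2 *: (alpha (A (J c *m x)) b *: (J c *m x)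
    - alpha (A (J c *m x)) c *: (J b *m x)).
  by rewrite mulmxA Jab CE -scalemxAl mulmxBl -!scalemxAl.
have -> : C (J b *m x) *m (J a *m x) = 2 *: (alpha (A (J b *m x)) b *: (J b *m x)
    + alpha (A (J b *m x)) c *: (J c *m x)).
  by rewrite mulmxA CE comb Jca Jba mulNmx scalerN opprK.
move=> /(congr1 (fun v : 'cV[R]_4 => (x^T *m G *m v) 0 0)).
have fD (v w : 'cV[R]_4) : (x^T *m G *m (v + w)) 0 0
    = (x^T *m G *m v) 0 0 + (x^T *m G *m w) 0 0 by rewrite mulmxDr mxE.
have fZ t (v : 'cV[R]_4) : (x^T *m G *m (t *: v)) 0 0
    = t * (x^T *m G *m v) 0 0 by rewrite -scalemxAr mxE.
have fN (v : 'cV[R]_4) : (x^T *m G *m (- v)) 0 0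
    = - (x^T *m G *m v) 0 0 by rewrite mulmxN mxE.
rewrite !(fD, fZ, fN) !(Qat_isotropic x (QJ _)) !mulr0 !(oppr0, addr0, mulr0).
have xx := Gp.2 x x0.
move: ((x^T *m G *m x) 0 0) xx => n n0 E.
apply: (mulIf (lt0r_neq0 n0)); lra.
Qed.

End TripleAlgebra.

(** * The Ricci forms of two quaternionic connections *)

(** Expanding by the multiplication table of the triple, each added term meets
    its opposite. *)
Lemma condition_change_invariant (R : realType) (J : 'I_3 -> 'M[R]_4)
    (rho rho0 : 'I_3 -> 'cV[R]_4 -> 'cV[R]_4 -> R)
    (P : 'cV[R]_4 -> 'rV[R]_4) (t : 'rV[R]_4) (a : 'I_3) :
  quaternionic_triple J ->
  (forall a x y, rho a x y = rho0 a x y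
     + 2 * ((P x *m (J a *m y)) 0 0 - (P y *m (J a *m x)) 0 0)
     + 4 * ((t *m (J (a + 1) *m x)) 0 0 * (t *m (J (a + 2%:R) *m y)) 0 0
          - (t *m (J (a + 2%:R) *m x)) 0 0 * (t *m (J (a + 1) *m y)) 0 0)) ->
  forall x y : 'cV[R]_4, let Jc := J (a + 2%:R) in
  rho a (Jc *m x) (Jc *m y) - rho a x y + rho (a + 1) (Jc *m x) y
    + rho (a + 1) x (Jc *m y) = 
  rho0 a (Jc *m x) (Jc *m y) - rho0 a x y + rho0 (a + 1) (Jc *m x) y
    + rho0 (a + 1) x (Jc *m y).
Proof.
move=> tJ rhoE x y Jc; have [sq _ _] := tJ.
have [Jca Jac Jbc Jcb] := triple_table a tJ; have [Jab Jba] := triple_mul a tJ.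
have a11 : a + 1 + 1 = a + 2%:R by elim/ord3P: a {rhoE Jc Jca Jac Jbc Jcb Jab Jba};
  exact: val_inj.
have a12 : a + 1 + 2%:R = a by elim/ord3P: a {rhoE Jc Jca Jac Jbc Jcb Jab Jba a11};
  exact: val_inj.
rewrite !rhoE a11 a12 /Jc !(mulmxA (J _)) ?sq ?Jca ?Jac ?Jbc ?Jcb ?Jab ?Jba.
have mN (v : 'rV[R]_4) (A : 'M[R]_4) (w : 'cV[R]_4) :
  (v *m (- A *m w)) 0 0 = - (v *m (A *m w)) 0 0 by rewrite mulNmx mulmxN mxE.
rewrite !mN !mul1mx; ring.
Qed.

Section Compare.
Variables (R : realType) (M : manifold R 4) (g : metric M).
Variables (D0 D : connection M).
Hypotheses (lc : levi_civita g D0) (q0 : quaternionic_connection g D0).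
Hypotheses (qD : quaternionic_connection g D) (tD : torsion_condition g D).
Variables (U : set M) (J : 'I_3 -> chart M -> M -> 'M[R]_4).
Hypotheses (oU : open U) (JU : admissible_basis g U J).
Variable i : chart M.
Implicit Types (p q : M) (x y : 'cV[R]_4).

Let V := U `&` cdom i.
Let oV : open V. Proof. by apply: openI => //; exact: cdom_open. Qed.

Lemma admissible_Qat q a : V q -> Qat (g i q) (J a i q).
Proof.
move=> [Uq iq]; have [_ /(_ i q Uq iq) [_ _ _ sp]] := JU; apply/sp.
exists (fun b => (b == a)%:R); rewrite (bigD1 a)//= eqxx scale1r big1 ?addr0// => b.
by move=> /negbTE ->; rewrite scale0r.
Qed.

Lemma admissible_triple q : V q -> quaternionic_triple (fun a => J a i q).
Proof. by move=> [Uq iq]; have [_ /(_ i q Uq iq) []] := JU. Qed.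

Definition diff_tensor q x : 'M[R]_4 := christoffel D i q x - christoffel D0 i q x.

Lemma admissible_cov_mx (E : connection M) q a x : quaternionic_connection g E ->
  V q -> Qat (g i q) (cov_mx E i (J a i) q x).
Proof.
move=> qE [Uq iq]; rewrite -cov_endoE; apply: (qE U (J a)) => //.
  by have [] := JU.
by move=> j r Ur jr; have [_ /(_ j r Ur jr) [_ _ _ sp]] := JU; apply/sp;
  exists (fun b => (b == a)%:R); rewrite (bigD1 a)//= eqxx scale1r big1 ?addr0// => b;
  move=> /negbTE ->; rewrite scale0r.
Qed.

Lemma diff_tensor_normalizer q a x : V q ->
  Qat (g i q) (diff_tensor q x *m J a i q - J a i q *m diff_tensor q x).
Proof.
move=> Vq; have Gp := metric_pos_def g Vq.2.
have := QatB Gp (admissible_cov_mx a x qD Vq) (admissible_cov_mx a x q0 Vq).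
congr (Qat _ _); rewrite /cov_mx /diff_tensor mulmxBl mulmxBr.
by apply/matrixP => s t; rewrite !mxE; ring.
Qed.

(** The 1-form alpha_a of the difference tensor, as a row vector. *)
Definition alpha_row a q : 'rV[R]_4 :=
  \row_k (- 4^-1 * \tr (J a i q *m diff_tensor q (delta_mx k 0))).

Lemma alpha_rowE a q x : alpha (fun b => J b i q) (diff_tensor q x) a = (alpha_row a
  q *m x) 0 0.
Proof.
have dE : diff_tensor q x = \sum_k x k 0 *: diff_tensor q (delta_mx k 0).
  have d E k : christoffel E i q (delta_mx k 0) = E i q k.
    rewrite /christoffel (bigD1 k)//= mxE !eqxx scale1r big1 ?addr0// => l lk.
    by rewrite mxE (negbTE lk) scale0r.
  rewrite [diff_tensor q x]/diff_tensor [christoffel D i q x]/christoffel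
    [christoffel D0 i q x]/christoffel -sumrB.
  by apply: eq_bigr => k _; rewrite /diff_tensor !d scalerBr.
rewrite /alpha dE mulmx_sumr linear_sum mulr_sumr mxE; apply: eq_bigr => k _.
by rewrite -scalemxAr linearZ /= mxE; ring.
Qed.

Definition theta q : 'rV[R]_4 := - (alpha_row 0 q *m J 0 i q).

(** The relations of [torsion_alpha] express the three forms by a single one:
    with alpha_a = theta J_a, theta is - alpha_a J_a for any index a. *)
Lemma alpha_row_theta a q : V q -> alpha_row a q = theta q *m J a i q.
Proof.
move=> Vq; have Gp := metric_pos_def g Vq.2.
have tJ := admissible_triple Vq; have QJ b := admissible_Qat b Vq.
have [sq J01 J10] := tJ.
have ext (u v : 'rV[R]_4) : (forall x : 'cV[R]_4, (u *m x) 0 0 = (v *m x) 0 0) -> u = v.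
  move=> uv; apply/rowP => k; have := uv (delta_mx k 0).
  by rewrite -!colE !mxE.
have step b : alpha_row (b + 1) q = alpha_row (b + 2%:R) q *m J b i q.
  apply: ext => x; rewrite -mulmxA -!alpha_rowE.
  apply: (torsion_alpha Gp QJ tJ (A := diff_tensor q)).
  - by rewrite /diff_tensor /christoffel !big1 ?subr0// => k _; rewrite mxE scale0r.
  - by move=> z c; exact: diff_tensor_normalizer.
  - move=> z w; have := tD Vq.2 (QJ b) (sq b) z w; congr (_ = _).
    have T u v : torsion D i q u v = diff_tensor q u *m v - diff_tensor q v *m u.
      have := lc_christoffel_sym lc u v Vq.2;
        rewrite (torsionE D i) /diff_tensor !mulmxBl => ->.
      by rewrite opprB addrA subrK.
    by rewrite /part02 !T.
have [J20 J02 J12 J21] := triple_table 0 tJ; rewrite /= !ord3_add in J20 J02 J12 J21.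
have s0 := step 0; have s1 := step 1; have s2 := step 2%:R;
  rewrite !ord3_add in s0 s1 s2.
elim/ord3P: a; rewrite /theta mulNmx -mulmxA.
- by rewrite sq mulmxN mulmx1 opprK.
- by rewrite J01 s2 -mulmxA sq mulmxN mulmx1 opprK.
- by rewrite J02 mulmxN opprK s1.
Qed.

Section AtPoint.
Variable p : M.
Hypothesis Vp : V p.

Let ip : cdom i p := Vp.2.

Lemma admissible_derivable a : derivable_mx_at i p (J a i).
Proof. by have [/(_ a) [Js _] _] := JU;
  exact: (smooth_derivable_mx_at ip (Js i) Vp.1). Qed.

Lemma diff_tensorE q x : diff_tensor q x = christoffel D i q x + (- 1%:M) *m
  christoffel D0 i q x.
Proof. by rewrite mulNmx mul1mx. Qed.

Let derivable_neg x : derivable_mx_at i p (fun q => (- 1%:M) *m christoffel D0 i q x).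
Proof.
apply: derivable_mx_atM; last exact: derivable_christoffel.
by move=> a b; exact: derivable_at_cst.
Qed.

Lemma derivable_diff_tensor x : derivable_mx_at i p (diff_tensor^~ x).
Proof.
have -> : diff_tensor^~ x = fun q => christoffel D i q x + (- 1%:M) *m christoffel D0
  i q x.
  by apply/funext => q; exact: diff_tensorE.
move=> a b; have -> : (fun q => (christoffel D i q x + (- 1%:M) *m christoffel D0 i q
  x) a b) =
    (fun q => christoffel D i q x a b + ((- 1%:M) *m christoffel D0 i q x) a b).
  by apply/funext => q; rewrite mxE.
by apply: derivable_atD; [exact: derivable_christoffel | exact: derivable_neg].
Qed.

Lemma dir_deriv_diff_tensor x y : dir_deriv i (diff_tensor^~ y) p x =
  dir_deriv i (fun q => christoffel D i q y) p x - dir_deriv i (fun q => christoffel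
    D0 i q y) p x.
Proof.
have -> : diff_tensor^~ y = fun q => christoffel D i q y + (- 1%:M) *m christoffel D0
  i q y.
  by apply/funext => q; exact: diff_tensorE.
rewrite (dir_derivD x (@derivable_christoffel _ _ _ D i p y ip) (@derivable_neg y)).
have dc : derivable_mx_at i p (fun=> - 1%:M : 'M[R]_4).
  by move=> a b; exact: derivable_at_cst.
rewrite (dir_derivM ip x dc (@derivable_christoffel _ _ _ D0 i p y ip)) dir_deriv_cst
  mul0mx add0r.
by rewrite mulNmx mul1mx.
Qed.

Lemma curvature_change x y : curvature D i p x y = curvature D0 i p x y
  + (cov_mx D0 i (diff_tensor^~ y) p x - cov_mx D0 i (diff_tensor^~ x) p y
     + (diff_tensor p x *m diff_tensor p y - diff_tensor p y *m diff_tensor p x)).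
Proof.
rewrite (curvatureE D ip) (curvatureE D0 ip) /cov_mx !dir_deriv_diff_tensor.
have -> : christoffel D i p x = christoffel D0 i p x + diff_tensor p x by rewrite
  /diff_tensor addrC subrK.
have -> : christoffel D i p y = christoffel D0 i p y + diff_tensor p y by rewrite
  /diff_tensor addrC subrK.
rewrite !(mulmxDl, mulmxDr).
move: (diff_tensor p x) (diff_tensor p y) (christoffel D0 i p x) (christoffel D0 i p
  y) => A B X Y.
move: (X *m Y) (Y *m X) (X *m B) (B *m X) (A *m Y) (Y *m A) (A *m B) (B *m A).
move: (dir_deriv _ _ _ _) (dir_deriv _ _ _ _) (dir_deriv _ _ _ _) (dir_deriv _ _ _ _).
by move=> u v w z a b c d e f h k; apply/matrixP => s t; rewrite !mxE; ring.
Qed.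

Lemma derivable_alpha_row a : derivable_mx_at i p (alpha_row a).
Proof.
move=> s k; have -> : (fun q => alpha_row a q s k) =
    (fun q => - 4^-1 * \sum_l (J a i q *m diff_tensor q (delta_mx k 0)) l l).
  by apply/funext => q; rewrite mxE.
apply: derivable_atM; first exact: derivable_at_cst.
apply: derivable_at_sum => l.
exact: (derivable_mx_atM (@admissible_derivable a) (@derivable_diff_tensor _)).
Qed.

Lemma derivable_theta : derivable_mx_at i p theta.
Proof.
have -> : theta = fun q => (- 1%:M : 'M[R]_1) *m (alpha_row 0 q *m J 0 i q).
  by apply/funext => q; rewrite mulNmx mul1mx.
apply: derivable_mx_atM; first by move=> a b; exact: derivable_at_cst.
exact: (derivable_mx_atM (@derivable_alpha_row 0) (@admissible_derivable 0)).
Qed.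

Definition nabla_theta x : 'rV[R]_4 :=
  dir_deriv i theta p x - theta p *m christoffel D0 i p x.

Lemma tr_alpha_row a q y : \tr (J a i q *m diff_tensor q y) = - 4 * (alpha_row a q *m
  y) 0 0.
Proof. by rewrite -alpha_rowE /alpha; field. Qed.

(** Differentiate tr (J_a A_y) = -4 theta (J_a y). The derivative of J_a lies
    in the fibre, where the same relation holds by linearity, so the two terms
    containing it cancel. *)
Lemma tr_cov_mx_diff_tensor a x y :
  \tr (J a i p *m cov_mx D0 i (diff_tensor^~ y) p x) =
  - 4 * ((nabla_theta x *m (J a i p *m y)) 0 0
         + (theta p *m (J a i p *m (christoffel D0 i p x *m y))) 0 0).
Proof.
pose N := cov_mx D0 i (J a i) p x.
have dJ := @admissible_derivable a; have dA := @derivable_diff_tensor y.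
have trN : \tr (N *m diff_tensor p y) = - 4 * (theta p *m (N *m y)) 0 0.
  have [_ /(_ i p Vp.1 ip) [_ _ _ sp]] := JU.
  have [c ->] := (sp N).1 (admissible_cov_mx a x q0 Vp).
  rewrite mulmx_suml linear_sum mulmx_suml mulmx_sumr summxE mulr_sumr.
  apply: eq_bigr => b _; rewrite -!scalemxAl -scalemxAr linearZ /= tr_alpha_row
    (alpha_row_theta b Vp).
  have zE t (B : 'M[R]_1) : (t *: B) 0 0 = t * B 0 0 by rewrite mxE.
  by rewrite zE -mulmxA; ring.
have trJA : \tr (dir_deriv i (fun q => J a i q *m diff_tensor q y) p x) =
    - 4 * ((dir_deriv i theta p x *m (J a i p *m y)) 0 0
           + (theta p *m (dir_deriv i (J a i) p x *m y)) 0 0).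
  have dJy : derivable_mx_at i p (fun q => J a i q *m y).
    by apply: derivable_mx_atM => // s t; exact: derivable_at_cst.
  have dc : derivable_mx_at i p (fun=> (- 4)%:M : 'M[R]_1).
    by move=> s t; exact: derivable_at_cst.
  have dy : derivable_mx_at i p (fun=> y) by move=> s t; exact: derivable_at_cst.
  have E : dir_deriv i (fun q => (\tr (J a i q *m diff_tensor q y))%:M : 'M[R]_1) p x =
      dir_deriv i (fun q => (- 4)%:M *m (theta q *m (J a i q *m y))) p x.
    apply: (dir_deriv_eq ip x oV Vp) => q Vq _;
      rewrite tr_alpha_row (alpha_row_theta a Vq).
    by apply/matrixP => s t; rewrite !ord1 mul_scalar_mx [LHS]mxE [RHS]mxE -mulmxA
      mulr1n.
  move: E; rewrite (dir_deriv_tr x (derivable_mx_atM dJ dA)).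
  rewrite (dir_derivM ip x dc (derivable_mx_atM derivable_theta dJy)) dir_deriv_cst
    mul0mx add0r.
  rewrite (dir_derivM ip x derivable_theta dJy) (dir_derivM ip x dJ dy) dir_deriv_cst
    mulmx0 addr0.
  rewrite mul_scalar_mx => /matrixP/(_ 0 0); rewrite [LHS]mxE eqxx mulr1n => ->.
  by rewrite [LHS]mxE; congr (_ * _); rewrite [LHS]mxE.
have trc (F : M -> 'M[R]_4) : \tr (cov_mx D0 i F p x) = \tr (dir_deriv i F p x).
  by rewrite /cov_mx mxtraceB mxtraceD [\tr (F p *m _)]mxtrace_mulC addrK.
have := trc (fun q => J a i q *m diff_tensor q y);
  rewrite (cov_mxM D0 ip x dJ dA) mxtraceD.
rewrite -/N trN trJA => /(canRL (addKr _)) ->.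
have -> : dir_deriv i (J a i) p x = N - christoffel D0 i p x *m J a i p + J a i p *m
  christoffel D0 i p x.
  by rewrite /N /cov_mx; apply/matrixP => s t; rewrite !mxE; ring.
rewrite /nabla_theta !(mulmxDl, mulmxDr, mulNmx, mulmxN) -!mulmxA.
have aE (A B : 'M[R]_1) : (A + B) 0 0 = A 0 0 + B 0 0 by rewrite mxE.
have nE (A : 'M[R]_1) : (- A) 0 0 = - A 0 0 by rewrite mxE.
by rewrite !(aE, nE); ring.
Qed.

(** The quadratic term is the trace of [J_a, A_x] A_y, known from
    [triple_normalizer]. The derivatives of A give those of theta, and their
    remaining terms cancel by the symmetry of the Levi-Civita connection
    matrix. *)
Lemma ricci_form_change a x y :
  ricci_form D i p (J a i p) x y = ricci_form D0 i p (J a i p) x y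
   + 2 * ((nabla_theta x *m (J a i p *m y)) 0 0
          - (nabla_theta y *m (J a i p *m x)) 0 0)
   + 4 * ((theta p *m (J (a + 1) i p *m x)) 0 0 * (theta p *m (J (a + 2%:R) i p *m
     y)) 0 0
        - (theta p *m (J (a + 2%:R) i p *m x)) 0 0 * (theta p *m (J (a + 1) i p *m
          y)) 0 0).
Proof.
have Gp := metric_pos_def g ip.
have tJ := admissible_triple Vp; have QJ b := admissible_Qat b Vp.
have br : \tr (J a i p *m (diff_tensor p x *m diff_tensor p y - diff_tensor p y *m
  diff_tensor p x)) =
    - 8 * ((alpha_row (a + 1) p *m x) 0 0 * (alpha_row (a + 2%:R) p *m y) 0 0
         - (alpha_row (a + 2%:R) p *m x) 0 0 * (alpha_row (a + 1) p *m y) 0 0).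
  have -> : \tr (J a i p *m (diff_tensor p x *m diff_tensor p y - diff_tensor p y *m
    diff_tensor p x)) =
      \tr ((J a i p *m diff_tensor p x - diff_tensor p x *m J a i p) *m diff_tensor p
        y).
    move: (diff_tensor p x) (diff_tensor p y) (J a i p) => A B K.
    by rewrite mulmxBr mulmxBl !mxtraceB !mulmxA -[\tr (K *m B *m A)]mxtrace_mulC
      mulmxA.
  rewrite (triple_normalizer Gp QJ tJ a (fun b => diff_tensor_normalizer b x Vp)).
  rewrite -scalemxAl mulmxBl -!scalemxAl mxtraceZ mxtraceB !mxtraceZ !tr_alpha_row
    !alpha_rowE.
  by ring.
rewrite /ricci_form (curvature_change x y) mulmxDr mxtraceD mulmxDr mxtraceD br.
rewrite mulmxBr mxtraceB !tr_cov_mx_diff_tensor (lc_christoffel_sym lc x y ip).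
rewrite !(alpha_row_theta _ Vp) -!mulmxA.
by field.
Qed.

End AtPoint.
End Compare.

Section Main.
Variables (R : realType) (M : manifold R 4) (g : metric M) (nabla_g : connection M).
Hypotheses (oM : oriented_atlas M) (lc : levi_civita g nabla_g).

Lemma asd_curvature_condition :
  anti_self_dual g nabla_g <-> curvature_condition g nabla_g.
Proof.
split=> [asd U J oU JU i p Up ip|cc i p W ip Wd].
  have QJ a := admissible_Qat JU a (conj Up ip).
  have tJ := admissible_triple JU (conj Up ip).
  apply: (proj2 (curvature_condition_at nabla_g (fun a => J a i p) ip)).
  apply: (proj2 (quat_bianchi_asd_at (metric_pos_def g ip) QJ tJ (lc_curvature_like
    lc ip))).
  by move=> W Wd; exact: asd.
have [J JU] := local_admissible_basis g oM i; have oi := @cdom_open _ _ M i.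
have QJ a := admissible_Qat JU a (conj ip ip).
have tJ := admissible_triple JU (conj ip ip).
apply: (proj1 (quat_bianchi_asd_at (metric_pos_def g ip) QJ tJ (lc_curvature_like lc
  ip))) => //.
apply: (proj1 (curvature_condition_at nabla_g (fun a => J a i p) ip)).
exact: (cc (cdom i) J oi JU i p ip ip).
Qed.

End Main.

Theorem theorem3p6 (R : realType) (M : manifold R 4) (g : metric M)
    (nabla_g : connection M) :
  oriented_atlas M -> levi_civita g nabla_g ->
  (anti_self_dual g nabla_g <-> curvature_condition g nabla_g) /\
  (anti_self_dual g nabla_g <->
     forall nabla : connection M,
       quaternionic_connection g nabla ->
       torsion_condition g nabla -> curvature_condition g nabla).
Proof.
move=> oM lc; have main := asd_curvature_condition oM lc; split=> //.
have q0 := lc_quaternionic oM lc; rewrite main; split=> [cc nabla qn tn|H].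
  move=> U J oU JU i p Up ip a x y.
  have Vp : (U `&` cdom i) p by [].
  rewrite /= (condition_change_invariant (rho :=
    fun b => ricci_form nabla i p (J b i p))
    a (admissible_triple JU Vp) (ricci_form_change lc q0 qn tn oU JU Vp)).
  exact: (cc U J oU JU i p Up ip a x y).
apply: H => // i p J ip _ _ x y.
have [tor _] := lc i p ip.
by rewrite /part02 !tor !mulmx0 !subr0 scaler0.
Qed.
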